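(* Let $\phi$ satisfy $(\phi_1)$, $(\phi_2)$, $(\phi_3)$. Let $g:\Omega\times\mathbb{R}\to\mathbb{R}$ be a Carathéodory function, let $\alpha\in\{\ell,m\}$ and $\alpha^*=\frac{\alpha N}{N-\alpha}$, and suppose that there is $C>0$ such that either (subcritical) for some $r$ with $\alpha<r<\alpha^*$, $|g(x,t)|\le C(|t|^{\alpha-1}+|t|^{r-1})$ for all $(x,t)\in\Omega\times\mathbb{R}$; or (critical) $|g(x,t)|\le C(|t|^{\alpha-1}+|t|^{\alpha^*-1})$ for all $(x,t)\in\Omega\times\mathbb{R}$. Assume that one of the following holds: (i) $\Phi\not\approx t^m$ and $\alpha=\ell$; (ii) $\Phi\approx t^m$ and $\alpha=m$. Let $u\in W^{1,\Phi}_0(\Omega)$ be a weak solution of $$-\Delta_\Phi u=g(x,u)\ \text{ in }\Omega,\qquad u=0\ \text{ on }\partial\Omega.$$ Then $u\in L^q(\Omega)$ for all $q\in[1,\infty)$.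
   Context: Let $N\ge 2$ and let $\Omega\subset\mathbb{R}^N$ be a bounded domain with smooth boundary. Let $\phi:\mathbb{R}\to\mathbb{R}$ be a $C^1$-function and let $\Phi:\mathbb{R}\to\mathbb{R}$ be the even function given by $\Phi(t)=\int_0^t s\phi(s)\,ds$. The conditions are: $(\phi_1)$ $t\phi(t)\to 0$ as $t\to 0$ and $t\phi(t)\to\infty$ as $t\to\infty$; $(\phi_2)$ $t\phi(t)$ is strictly increasing in $(0,\infty)$; $(\phi_3)$ there exist $\ell\in[1,N)$ and $m\in(1,N)$ such that $\ell-1\le \frac{(t\phi(t))'}{\phi(t)}\le m-1<\ell^*-1$ for all $t>0$, where $\ell^*=\frac{\ell N}{N-\ell}$. The $\Phi$-Laplacian is $\Delta_\Phi u=\mathrm{div}(\phi(|\nabla u|)\nabla u)$. An $N$-function is a convex, continuous, even function $\Theta:\mathbb{R}\to[0,\infty)$ with $\Theta(t)/t\to0$ as $t\to0$, $\Theta(t)/t\to\infty$ as $t\to\infty$, and $\Theta(t)>0$ for $t>0$. For $N$-functions $\Phi,\Psi$ write $\Phi\approx\Psi$ if there exist $c_1,c_2>0$ and $t_0\ge0$ such that $c_1\Psi(t)\le\Phi(t)\le c_2\Psi(t)$ for all $t\ge t_0$; write $\Phi\not\approx\Psi$ otherwise. Here $t^m$ denotes the $N$-function $t\mapsto|t|^m$. The Orlicz space is $L_\Phi(\Omega)=\{u:\Omega\to\mathbb{R}\text{ measurable}:\int_\Omega\Phi(|u|/\lambda)\,dx<\infty\text{ for some }\lambda>0\}$ with Luxemburg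 norm $\|u\|_\Phi=\inf\{\lambda>0:\int_\Omega\Phi(|u|/\lambda)\,dx\le1\}$. The Orlicz-Sobolev space $W^{1,\Phi}(\Omega)$ consists of $u\in L_\Phi(\Omega)$ whose weak first derivatives lie in $L_\Phi(\Omega)$, with norm $\|u\|_{1,\Phi}=\|u\|_\Phi+\sum_{i=1}^N\|\partial u/\partial x_i\|_\Phi$, and $W^{1,\Phi}_0(\Omega)$ is the closure of $C_0^\infty(\Omega)$ in $W^{1,\Phi}(\Omega)$. A function $u\in W^{1,\Phi}_0(\Omega)$ is a weak solution of $-\Delta_\Phi u=g(x,u)$ in $\Omega$, $u=0$ on $\partial\Omega$, if $\int_\Omega\phi(|\nabla u|)\nabla u\cdot\nabla v\,dx=\int_\Omega g(x,u)v\,dx$ for all $v\in W^{1,\Phi}_0(\Omega)$. *)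

(* Defs.v *)
From HB Require Import structures.
From mathcomp Require Import all_boot all_order all_algebra.
From mathcomp Require Import all_classical all_reals all_analysis.

Set Implicit Arguments.
Unset Strict Implicit.
Unset Printing Implicit Defensive.

Import Order.TTheory GRing.Theory Num.Theory.
Import numFieldNormedType.Exports.

Local Open Scope classical_set_scope.
Local Open Scope ring_scope.

(* R^n is 'rV[R]_n, with the sigma-algebra generated by the coordinates, that
   is, the Borel sets. *)

Definition rV_display : measure_display -> measure_display.
Proof. exact. Qed.

Section measurable_rV.
Context {R : realType} (n : nat).

Let coors : 'I_n -> 'rV[R]_n -> R := fun i x => x ord0 i.

Let rV_set0 : g_sigma_preimage coors set0.
Proof. exact: sigma_algebra0. Qed.

Let rV_setC A : g_sigma_preimage coors A -> g_sigma_preimage coors (~` A).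
Proof. exact: sigma_algebraC. Qed.

Let rV_bigcup (F : _^nat) : (forall i, g_sigma_preimage coors (F i)) ->
  g_sigma_preimage coors (\bigcup_i (F i)).
Proof. exact: sigma_algebra_bigcup. Qed.

HB.instance Definition _ := @isMeasurable.Build (rV_display default_measure_display)
  'rV[R]_n (g_sigma_preimage coors) rV_set0 rV_setC rV_bigcup.

End measurable_rV.

Lemma measurable_coord (R : realType) n (i : 'I_n) :
  measurable_fun [set: 'rV[R]_n] (fun x => x ord0 i).
Proof.
move=> _ Y mY; rewrite setTI; apply: sub_sigma_algebra => /=.
rewrite -bigcup_seq/=; exists i => /=; first by rewrite mem_index_enum.
by exists Y => //; rewrite setTI.
Qed.

Lemma measurable_fun_coordP d (T : measurableType d) (R : realType) n
    (f : T -> 'rV[R]_n) :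
  (forall i, measurable_fun [set: T] (fun t => f t ord0 i)) ->
  measurable_fun [set: T] f.
Proof.
move=> mf _ A mA; rewrite setTI.
pose G := [set B : set 'rV[R]_n | measurable (f @^-1` B)].
suff : g_sigma_preimage (fun i (x : 'rV[R]_n) => x ord0 i) `<=` G by exact.
apply: smallest_sub.
  split; rewrite /G /=.
  - by rewrite preimage_set0.
  - by move=> B mB; rewrite setTD preimage_setC; exact: measurableC.
  - by move=> F mF; rewrite preimage_bigcup; exact: bigcup_measurable.
rewrite -bigcup_seq => B [i _ [C mC <-]]; rewrite /G /= setTI.
by have := mf i measurableT C mC; rewrite setTI.
Qed.

Definition rV_cons (R : realType) n (p : R * 'rV[R]_n) : 'rV[R]_n.+1 :=
  row_mx (const_mx p.1 : 'rV_1) p.2.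

Definition rV_uncons (R : realType) n (x : 'rV[R]_n.+1) : R * 'rV[R]_n :=
  (x ord0 ord0, rsubmx (x : 'rV_(1 + n))).

Lemma rV_consK (R : realType) n : cancel (@rV_cons R n) (@rV_uncons R n).
Proof.
move=> [t v]; rewrite /rV_uncons /rV_cons /= row_mxKr; congr pair.
have -> : (ord0 : 'I_n.+1) = lshift n (ord0 : 'I_1) by exact: val_inj.
by rewrite (row_mxEl (const_mx t : 'rV[R]_1) v) mxE.
Qed.

Lemma measurable_rV_cons (R : realType) n : measurable_fun setT (@rV_cons R n).
Proof.
apply: measurable_fun_coordP => i; rewrite /rV_cons.
have [j|j] := @split_ordP 1 n i => ->.
  rewrite (_ : (fun _ => _) = fst); first exact: measurable_fst.
  by apply/funext => p; rewrite (row_mxEl (const_mx p.1 : 'rV[R]_1)) mxE.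
rewrite (_ : (fun _ => _) = (fun x : 'rV[R]_n => x ord0 j) \o snd).
  by apply: (measurableT_comp (measurable_coord j)); exact: measurable_snd.
by apply/funext => p; rewrite (row_mxEr (const_mx p.1 : 'rV[R]_1)).
Qed.

Lemma measurable_rV_uncons (R : realType) n :
  measurable_fun setT (@rV_uncons R n).
Proof.
apply/measurable_fun_pairP; split; first exact: measurable_coord.
apply: measurable_fun_coordP => i /=.
under eq_fun do rewrite mxE.
exact: measurable_coord.
Qed.

Section lebesgue_succ.
Local Open Scope ereal_scope.
Context {R : realType} (n : nat).
Variable mu : {sigma_finite_measure set 'rV[R]_n -> \bar R}.

Definition lebesgue_succ : set 'rV[R]_n.+1 -> \bar R :=
  pushforward (lebesgue_measure \x mu) (@rV_cons R n).

Let pre (A : set 'rV[R]_n.+1) : measurable A -> measurable (@rV_cons R n @^-1` A).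
Proof. by move=> mA; rewrite -[X in measurable X]setTI; exact: measurable_rV_cons. Qed.

Let lebesgue_succ0 : lebesgue_succ set0 = 0.
Proof. by rewrite /lebesgue_succ /pushforward preimage_set0 measure0. Qed.

Let lebesgue_succ_ge0 A : 0 <= lebesgue_succ A.
Proof. exact: (measure_ge0 (lebesgue_measure \x mu)). Qed.

Let lebesgue_succ_sigma_additive : semi_sigma_additive lebesgue_succ.
Proof.
move=> F mF tF mUF; rewrite /lebesgue_succ /pushforward preimage_bigcup.
apply: measure_semi_sigma_additive.
- by move=> i; exact: pre.
- apply/trivIsetP => /= i j _ _ ij; rewrite -preimage_setI.
  by move/trivIsetP : tF => /(_ _ _ _ _ ij) ->//; rewrite preimage_set0.
- by rewrite -preimage_bigcup; exact: pre.
Qed.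

HB.instance Definition _ := isMeasure.Build _ _ _ lebesgue_succ
  lebesgue_succ0 lebesgue_succ_ge0 lebesgue_succ_sigma_additive.

Let lebesgue_succ_sigma_finite : sigma_finite setT lebesgue_succ.
Proof.
have /sigma_finiteP[F [TF ndF Foo]] := sigma_finiteT (@lebesgue_measure R).
have /sigma_finiteP[G [TG ndG Goo]] := sigma_finiteT mu.
have TFG : \bigcup_k (F k `*` G k) = setT.
  rewrite -setXTT TF TG predeqE => -[x y]; split.
    by move=> [k _ []/= ? ?]; split; exists k.
  move=> [/= [i _ Fix] [j _ Gjy]]; exists (maxn i j) => //; split.
  - by move: x Fix; exact/subsetPset/ndF/leq_maxl.
  - by move: y Gjy; exact/subsetPset/ndG/leq_maxr.
exists (fun k => @rV_uncons R n @^-1` (F k `*` G k)).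
  by rewrite -preimage_bigcup TFG preimage_setT.
move=> k; have [? ?] := Foo k; have [? ?] := Goo k; split.
  rewrite -[X in measurable X]setTI.
  by apply: measurable_rV_uncons => //; exact: measurableX.
rewrite /lebesgue_succ /pushforward -comp_preimage.
rewrite (_ : _ \o _ = id) ?preimage_id; last exact/funext/rV_consK.
by rewrite product_measure1E// lte_mul_pinfty// ge0_fin_numE.
Qed.

HB.instance Definition _ := Measure_isSigmaFinite.Build _ _ _ lebesgue_succ
  lebesgue_succ_sigma_finite.

End lebesgue_succ.

(* The N-fold product of the Lebesgue measure of R, on the Borel sets. *)
Fixpoint borel_lebesgue (R : realType) n :
    {sigma_finite_measure set 'rV[R]_n -> \bar R} :=
  match n with
  | 0 => [the {sigma_finite_measure set _ -> \bar R} of dirac (0 : 'rV[R]_0)]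
  | n'.+1 => [the {sigma_finite_measure set _ -> \bar R}
                of lebesgue_succ (borel_lebesgue R n')]
  end.

(* Lebesgue measurable sets (not just Borel sets) and Lebesgue measure on R^n:
   the completion of the product measure above. *)
Definition lebesgue_space (R : realType) n : measurableType _ :=
  caratheodory_type ((borel_lebesgue R n)^*)%mu.

Definition lebesgue (R : realType) n : set (lebesgue_space R n) -> \bar R :=
  @completed_measure_extension _ _ _ (borel_lebesgue R n).

HB.instance Definition _ (R : realType) n := Measure.on (@lebesgue R n).

Definition lebesgue_measurable_fun (R : realType) n (D : set 'rV[R]_n)
    (f : 'rV[R]_n -> R) :=
  @measurable_fun _ _ (lebesgue_space R n) R D f.

Section calculus.
Context {R : realType} {n : nat}.
Implicit Types (f : 'rV[R]_n -> R) (x y : 'rV[R]_n).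

Definition dot x y : R := \sum_i x ord0 i * y ord0 i.

(* The library norm on 'rV[R]_n is the sup norm. *)
Definition enorm x : R := Num.sqrt (dot x x).

Definition partial (i : 'I_n) f : 'rV[R]_n -> R :=
  fun x => 'D_(delta_mx ord0 i) f x.

Fixpoint Ck (k : nat) f : Prop :=
  match k with
  | 0 => continuous f
  | k'.+1 => continuous f /\
      forall i : 'I_n, (forall x, derivable f x (delta_mx ord0 i)) /\
                       Ck k' (partial i f)
  end.

Definition smooth f := forall k, Ck k f.

(* C_0^oo(Omega) *)
Definition test_function (Omega : set 'rV[R]_n) f :=
  [/\ smooth f, compact (closure [set x | f x != 0])
    & closure [set x | f x != 0] `<=` Omega].

End calculus.

(* Near each boundary point, Omega is one side of the graph of a smooth
   function of the n - 1 coordinates other than some x_i. *)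
Definition smooth_boundary (R : realType) n (Omega : set 'rV[R]_n) :=
  forall p, closure Omega p -> ~ interior Omega p ->
  exists (i : 'I_n) (s : bool) (gamma : 'rV[R]_n.-1 -> R), smooth gamma /\
    \forall x \near p,
      Omega x <-> 0 < (-1) ^+ s * (x ord0 i - gamma (col' i x)).

Definition smooth_bounded_domain (R : realType) n (Omega : set 'rV[R]_n) :=
  [/\ Omega !=set0, open Omega, connected Omega, bounded_set Omega
    & smooth_boundary Omega].

Section growth.
Context {R : realType}.
Implicit Types phi Theta Psi : R -> R.

(* Phi t = \int_0^t s phi(s) ds, with the usual orientation for t < 0. *)
Definition Phi_of phi (t : R) : R :=
  if 0 <= t then \int[lebesgue_measure]_(s in `[0, t]) (s * phi s)
  else - \int[lebesgue_measure]_(s in `[t, 0]) (s * phi s).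

Definition C1 phi := (forall t, derivable phi t 1) /\ continuous (derive1 phi).

Definition sobolev_exponent (N : nat) (p : R) : R := p * N%:R / (N%:R - p).

Definition phi1 phi :=
  (t * phi t @[t --> (0 : R)^'] --> (0 : R)) /\
  (t * phi t @[t --> +oo] --> +oo).

Definition phi2 phi :=
  forall s t : R, 0 < s -> s < t -> s * phi s < t * phi t.

Definition phi3 (N : nat) phi (l m : R) :=
  [/\ 1 <= l < N%:R, 1 < m < N%:R,
      forall t : R, 0 < t ->
        l - 1 <= derive1 (fun s : R => s * phi s) t / phi t <= m - 1
    & m - 1 < sobolev_exponent N l - 1].

Definition equivalent_Nfun Theta Psi :=
  exists c1 c2 t0 : R, [/\ 0 < c1, 0 < c2, 0 <= t0
    & forall t, t0 <= t -> c1 * Psi t <= Theta t <= c2 * Psi t].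

Definition abs_power (p t : R) : R := `|t| `^ p.

End growth.

Section orlicz_sobolev.
Context {R : realType} {N : nat}.
Variables (Omega : set 'rV[R]_N) (Phi : R -> R).
Implicit Types u v w : 'rV[R]_N -> R.
Local Notation mu := (@lebesgue R N).

Definition modular u (lambda : R) : \bar R :=
  (\int[mu]_(x in Omega) (Phi (`|u x| / lambda))%:E)%E.

Definition orlicz u :=
  lebesgue_measurable_fun Omega u /\
  exists2 lambda : R, 0 < lambda & (modular u lambda < +oo)%E.

Definition luxemburg u : R :=
  inf [set lambda : R | 0 < lambda /\ (modular u lambda <= 1)%E].

Definition Lp (q : R) u :=
  lebesgue_measurable_fun Omega u /\
  (\int[mu]_(x in Omega) (`|u x| `^ q)%:E < +oo)%E.

Definition locally_L1 u :=
  forall K : set 'rV[R]_N, compact K -> K `<=` Omega ->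
    mu.-integrable K (EFin \o u).

Definition is_weak_partial (i : 'I_N) u w :=
  [/\ locally_L1 u, locally_L1 w &
    forall psi, test_function Omega psi ->
      \int[mu]_(x in Omega) (u x * partial i psi x) =
      - \int[mu]_(x in Omega) (w x * psi x)].

(* The weak partial derivative, which is unique up to equality a.e. in Omega;
   an arbitrary function if there is none. *)
Definition weak_partial (i : 'I_N) u : 'rV[R]_N -> R :=
  get (is_weak_partial i u).

Definition weak_gradient u (x : 'rV[R]_N) : 'rV[R]_N :=
  \row_i weak_partial i u x.

Definition W1 u :=
  orlicz u /\
  forall i : 'I_N, exists2 w, is_weak_partial i u w & orlicz w.

Definition W1_norm u : R :=
  luxemburg u + \sum_(i < N) luxemburg (weak_partial i u).

Definition W10 u :=
  W1 u /\ forall eps : R, 0 < eps ->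
    exists2 psi, test_function Omega psi & W1_norm (u \- psi) < eps.

End orlicz_sobolev.

Definition caratheodory_fun (R : realType) N (Omega : set 'rV[R]_N)
    (g : 'rV[R]_N -> R -> R) :=
  (forall t : R, lebesgue_measurable_fun Omega (g ^~ t)) /\
  {ae @lebesgue R N, forall x, Omega x -> continuous (g x)}.

(* The identity between integrals includes their absolute convergence. *)
Definition weak_solution (R : realType) N (Omega : set 'rV[R]_N)
    (phi : R -> R) (g : 'rV[R]_N -> R -> R) (u : 'rV[R]_N -> R) :=
  let mu := @lebesgue R N in
  let grad := weak_gradient Omega in
  W10 Omega (Phi_of phi) u /\
  forall v, W10 Omega (Phi_of phi) v ->
    let lhs x := phi (enorm (grad u x)) * dot (grad u x) (grad v x) in
    let rhs x := g x (u x) * v x in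
    [/\ mu.-integrable Omega (EFin \o lhs), mu.-integrable Omega (EFin \o rhs)
      & \int[mu]_(x in Omega) lhs x = \int[mu]_(x in Omega) rhs x].

(* Main.v *)
Require Import Defs.
From mathcomp Require Import all_boot all_order all_algebra.
From mathcomp Require Import all_classical all_reals all_analysis.
From mathcomp Require Import measurable_realfun.
From mathcomp Require Import ring lra.

(** The proof is a regularity argument of Brezis-Kato and Moser type, made uniform in
    the Orlicz setting by one remark: in both cases [Phi t >= c t^alpha - c'] for some
    [c > 0] ([Phi_coercive]). In case (i) this holds because (phi_3) makes
    [Phi t / t^l] nondecreasing, in case (ii) by equivalence with [t^m]. Hence the
    gradient of [u] is in [L^alpha] and the Sobolev inequality gives [u] in [L^q] with
    [q] the Sobolev exponent of [alpha]. Both growth conditions give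
    [|g(x,t)| |t| <= K (1 + |t|^alpha + |t|^q)].

    To go further, the equation is tested with [G(u)], [G(t) = t * weight e s t], where
    [weight e s t = ((1 + t^2) / (1 + e t^2))^s] is bounded for each [e > 0], increases
    to [(1 + t^2)^s] as [e] tends to [0], and satisfies
    [weight <= G' <= (1 + 2 s) weight] ([derive_mul_weight]). As
    [phi(t) t^2 >= Phi t], coercivity bounds the integral of
    [weight e s u * |grad u|^alpha] by that of
    [weight e s u * (1 + |u|^alpha + |u|^q)]. The left-hand side controls the gradient of
    [H(u)], [H(t) = t * weight e (s/alpha) t], in [L^alpha], so that the Sobolev
    inequality ([W10_sobolev]) bounds [J], the integral of [|H(u)|^q]. On the set where
    [|u| > M], the integrand on the right is at most three times
    [|u|^(q - alpha) |H(u)|^alpha], and Hoelder's inequality bounds its integral by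
    [J^(alpha/q)] times a power of the integral of [|u|^q] over that set. The latter is
    small for large [M], and the term is absorbed. The bound on [J] does not depend on
    [e], and Fatou's lemma yields the integrability of [|u|^q (1 + u^2)^(s q/alpha)] for
    all [s] ([absorption_powers]). A single step reaches every [s], because nothing but
    [u] in [L^q] enters the absorption; there is no iteration.

    For this, [G(u)] has to be an admissible test function with the gradient given by
    the chain rule ([W10_chain_rule]). Norm convergence in the Orlicz-Sobolev space is
    expressed by modulars ([modular_null]), test functions approximating [u] are composed
    with [G], and the dominated convergence theorem applies thanks to the [Delta_2]
    condition. Weak gradients being arbitrary representatives, their uniqueness is needed;
    it follows from the fundamental lemma of the calculus of variations
    ([annihilates_tests_ae_eq0]). The Sobolev inequality for test functions
    ([sobolev_inequality]) follows from the inequality of Gagliardo and Nirenberg for the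
    gradient in [L^1] ([gagliardo_nirenberg]), applied to a power of the function. *)

Set Implicit Arguments.
Unset Strict Implicit.
Unset Printing Implicit Defensive.

Import Order.TTheory GRing.Theory Num.Theory.
Import numFieldNormedType.Exports.
Local Open Scope classical_set_scope.
Local Open Scope ring_scope.

(** * Smooth functions *)

Section directional.
Context {R : realType} {V : normedModType R}.
Implicit Types (f g : V -> R) (x v : V).

Lemma is_derive_lineP f x v d :
  is_derive x v f d <-> is_derive (0 : R) (1 : R) (fun h => f (h *: v + x)) d.
Proof.
have E : 'D_v f x = 'D_1 (fun h : R => f (h *: v + x)) 0.
  rewrite /derive; set g1 := fun h => h^-1 *: _; set g2 := fun h => h^-1 *: _.
  suff -> : g1 = g2 by [].
  by rewrite funeqE /g1 /g2 => h /=; rewrite addr0 scale0r add0r [_%:A]mulr1.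
split=> -[h1 <-].
  by split; [exact: (derivable1P _ _ _).1 h1 | rewrite E].
by split; [exact: (derivable1P _ _ _).2 h1 | rewrite E].
Qed.

End directional.

Section lines.
Context {R : realType} {V : normedModType R}.
Implicit Types (f g : V -> R) (x v : V).

Lemma is_derive_line f x v t d : is_derive (t *: v + x) v f d ->
  is_derive t (1 : R) (fun h => f (h *: v + x)) d.
Proof.
move=> /is_derive_lineP H; refine (proj2 (@is_derive_lineP R R (fun h => f (h *: v + x)) t 1 d) _).
rewrite (_ : (fun h : R => _) = (fun h => f (h *: v + (t *: v + x)))) //.
by apply/funext => h; rewrite [h%:A]mulr1 scalerDl addrA.
Qed.

Lemma is_derive_comp_dir (G : R -> R) f x v d e :
  is_derive (f x) 1 G e -> is_derive x v f d ->
  is_derive x v (G \o f) (e * d).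
Proof.
move=> hG /is_derive_lineP hf; apply/is_derive_lineP.
apply: (@is_derive1_comp _ G (fun h : R => f (h *: v + x))).
by rewrite scale0r add0r.
Qed.

Lemma continuous_line f x v : continuous f -> continuous (fun h : R => f (h *: v + x)).
Proof.
move=> cf h; apply: (@continuous_comp _ _ _ (fun h : R => h *: v + x)); last exact: cf.
apply: cvgD; last exact: cvg_cst.
by apply: cvgZr_tmp; exact: cvg_id.
Qed.

End lines.

Section smooth_real.
Context {R : realType}.
Implicit Types (f g G : R -> R) (x : R).

Definition smooth1 G := forall n (x : R), derivable (iter n (@derive1 _ _) G) x 1.

Lemma smooth1_deriv G : smooth1 G -> smooth1 (derive1 G).
Proof. by move=> sG n x; rewrite -iterSr; exact: sG. Qed.

Lemma smooth1_derivable G : smooth1 G -> forall x : R, derivable G x 1.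
Proof. by move=> sG x; exact: (sG 0). Qed.

Lemma smooth1_is_derive G : smooth1 G -> forall x : R, is_derive x 1 G (derive1 G x).
Proof.
by move=> sG x; rewrite derive1E; apply: derivableP; exact: smooth1_derivable.
Qed.

Lemma derivable_continuous G : (forall x : R, derivable G x 1) -> continuous G.
Proof. by move=> dG x; apply: differentiable_continuous; exact/derivable1_diffP. Qed.

Lemma smooth1_continuous G : smooth1 G -> continuous G.
Proof. by move=> /smooth1_derivable; exact: derivable_continuous. Qed.

(** A class of functions stable under differentiation consists of smooth
    functions: this is how smoothness is checked for explicit functions, whose
    derivatives of all orders have a common shape. *)
Lemma smooth1_class (S : (R -> R) -> Prop) :
  (forall G, S G -> exists2 G', S G' & forall x : R, is_derive x 1 G (G' x)) ->
  forall G, S G -> smooth1 G.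
Proof.
move=> HS G SG n x.
have SD F : S F -> S (derive1 F).
  move=> /HS[F' SF' hF]; rewrite (_ : derive1 F = F') //.
  by apply/funext => y; rewrite derive1E; exact: (@derive_val _ _ _ _ _ _ _ (hF y)).
have : S (iter n (@derive1 _ _) G).
  by elim: n => // n IH; rewrite iterS; exact: SD.
by move=> /HS[F' _ hF]; exact: (@ex_derive _ _ _ _ _ _ _ (hF x)).
Qed.

End smooth_real.

Section Ck_theory.
Context {R : realType} {n : nat}.
Implicit Types f g : 'rV[R]_n -> R.

Lemma Ck_cont k f : Ck k f -> continuous f.
Proof. by case: k => //= k []. Qed.
Arguments Ck_cont {k f} _ x.

Lemma Ck_derive k f i x : Ck k.+1 f ->
  is_derive x (delta_mx ord0 i) f (partial i f x).
Proof. by move=> /= [_ /(_ i)[df _]]; apply: derivableP; exact: df. Qed.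

Lemma Ck_partial k f i : Ck k.+1 f -> Ck k (partial i f).
Proof. by move=> /= [_ /(_ i)[]]. Qed.

Lemma CkS k f : Ck k.+1 f -> Ck k f.
Proof.
elim: k f => [|k IH] f; first by move=> /= [].
move=> H; split; first exact: Ck_cont H.
move=> i; split; last exact/IH/(Ck_partial i H).
by move=> x; exact: (@ex_derive _ _ _ _ _ _ _ (Ck_derive i x H)).
Qed.

Lemma partialE i f x d : is_derive x (delta_mx ord0 i) f d -> partial i f x = d.
Proof. by move=> H; exact: (@derive_val _ _ _ _ _ _ _ H). Qed.

(** Stated for a family [df] of known partial derivatives, so that inductions on
    [k] run on explicit formulas. *)
Lemma CkSI k f (df : 'I_n -> 'rV[R]_n -> R) : continuous f ->
  (forall i x, is_derive x (delta_mx ord0 i) f (df i x)) ->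
  (forall i, Ck k (df i)) -> Ck k.+1 f.
Proof.
move=> cf hf Hdf; split=> // i; split.
  by move=> x; exact: (@ex_derive _ _ _ _ _ _ _ (hf i x)).
by rewrite (_ : partial i f = df i) //; apply/funext => x; exact: partialE.
Qed.

Lemma Ck_cst k (c : R) : Ck k (cst c : 'rV[R]_n -> R).
Proof.
elim: k c => [|k IH] c; first exact: cst_continuous.
apply: (@CkSI k _ (fun _ => cst 0)) => //; first exact: cst_continuous.
Qed.

Lemma CkD k f g : Ck k f -> Ck k g -> Ck k (f \+ g).
Proof.
elim: k f g => [|k IH] f g Hf Hg.
  by move=> x; exact: (cvgD (Ck_cont Hf x) (Ck_cont Hg x)).
apply: (@CkSI k _ (fun i => partial i f \+ partial i g)).
- by move=> x; exact: (cvgD (Ck_cont Hf x) (Ck_cont Hg x)).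
- by move=> i x; exact: (is_deriveD (Ck_derive i x Hf) (Ck_derive i x Hg)).
- by move=> i; apply: IH; exact: Ck_partial.
Qed.

Lemma CkM k f g : Ck k f -> Ck k g -> Ck k (f \* g).
Proof.
elim: k f g => [|k IH] f g Hf Hg.
  by move=> x; exact: (cvgM (Ck_cont Hf x) (Ck_cont Hg x)).
apply: (@CkSI k _ (fun i => (f \* partial i g) \+ (g \* partial i f))).
- by move=> x; exact: (cvgM (Ck_cont Hf x) (Ck_cont Hg x)).
- move=> i x; have := is_deriveM (Ck_derive i x Hf) (Ck_derive i x Hg).
  exact.
- by move=> i; apply: CkD; apply: IH;
    (try exact: Ck_partial); exact: CkS.
Qed.

Lemma Ck_comp k (G : R -> R) f : smooth1 G -> Ck k f -> Ck k (G \o f).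
Proof.
elim: k G f => [|k IH] G f sG Hf.
  by move=> x; apply: continuous_comp; [exact: (Ck_cont Hf) | exact: smooth1_continuous].
apply: (@CkSI k _ (fun i => (derive1 G \o f) \* partial i f)).
- move=> x; apply: continuous_comp; first exact: (Ck_cont Hf).
  exact: smooth1_continuous.
- move=> i x; apply: is_derive_comp_dir; last exact: Ck_derive Hf.
  exact: smooth1_is_derive.
- move=> i; apply: CkM; last exact: Ck_partial.
  by apply: IH; [exact: smooth1_deriv | exact: CkS].
Qed.

Lemma Ck_coord k (j : 'I_n) : Ck k (fun x : 'rV[R]_n => x ord0 j).
Proof.
have D i x : is_derive x (delta_mx ord0 i) (fun x : 'rV[R]_n => x ord0 j)
    ((ord0 == ord0 :> 'I_1) && (j == i))%:R.
  apply/is_derive_lineP.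
  rewrite (_ : (fun h : R => _) =
    (fun h : R => h * ((ord0 == ord0 :> 'I_1) && (j == i))%:R + x ord0 j)); last first.
    by apply/funext => h; rewrite !mxE.
  by apply: is_derive_eq; rewrite addr0 scaler0 add0r [_%:A]mulr1.
case: k => [|k]; first exact: coord_continuous.
apply: (@CkSI k _ (fun i => cst ((ord0 == ord0 :> 'I_1) && (j == i))%:R)) => //.
  exact: coord_continuous.
by move=> i; exact: Ck_cst.
Qed.

Lemma Ck_prod k (I : Type) (r : seq I) (F : I -> 'rV[R]_n -> R) :
  (forall i, Ck k (F i)) -> Ck k (fun x => \prod_(i <- r) F i x).
Proof.
move=> HF; elim: r => [|i r IH].
  rewrite (_ : (fun x => _) = cst 1); first exact: Ck_cst.
  by apply/funext => x; rewrite big_nil.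
rewrite (_ : (fun x => _) = (F i \* (fun x => \prod_(i <- r) F i x))).
  exact: CkM.
by apply/funext => x; rewrite big_cons.
Qed.

Lemma smoothM f g : smooth f -> smooth g -> smooth (f \* g).
Proof. by move=> sf sg k; exact: CkM. Qed.

Lemma smooth_comp (G : R -> R) f : smooth1 G -> smooth f -> smooth (G \o f).
Proof. by move=> sG sf k; exact: Ck_comp. Qed.

Lemma smooth_partial i f : smooth f -> smooth (partial i f).
Proof. by move=> sf k; exact: (@Ck_partial k f i (sf k.+1)). Qed.

Lemma smooth_is_derive i f x : smooth f ->
  is_derive x (delta_mx ord0 i) f (partial i f x).
Proof. by move=> sf; exact: Ck_derive (sf 1). Qed.

Lemma smooth_continuous f : smooth f -> continuous f.
Proof. by move=> sf; exact: (sf 0). Qed.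

Lemma partial_comp (G : R -> R) f i x : smooth1 G -> smooth f ->
  partial i (G \o f) x = derive1 G (f x) * partial i f x.
Proof.
move=> sG sf; apply: partialE; apply: is_derive_comp_dir.
  exact: smooth1_is_derive.
exact: smooth_is_derive.
Qed.

Lemma partialM f g i x : smooth f -> smooth g ->
  partial i (f \* g) x = f x * partial i g x + g x * partial i f x.
Proof.
move=> sf sg; apply: partialE.
exact: (is_deriveM (smooth_is_derive i x sf) (smooth_is_derive i x sg)).
Qed.

End Ck_theory.

(** * A smooth function flat at the origin *)

Section explicit_smooth.
Context {R : realType}.
Implicit Types (F : R -> R) (t x : R).

(** Composed with a nonnegative smooth function, this is what makes smooth cut-offs
    increase to an indicator as [k] tends to infinity. *)
Lemma smooth1_affine_expR (k : R) : smooth1 (fun y : R => 1 - expR (- k * y)).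
Proof.
apply: (@smooth1_class _ (fun F => exists c d : R, F = fun y => c + d * expR (- k * y))).
  move=> _ [c [d ->]]; exists (fun y => 0 + (- k * d) * expR (- k * y)).
    by exists 0, (- k * d).
  move=> x; rewrite add0r.
  have D : is_derive x 1 (expR \o (fun y => - k * y)) (expR (- k * x) * (- k)).
    apply: is_derive1_comp.
    by apply: is_derive_eq; rewrite [_%:A]mulr1.
  have -> : (fun y => c + d * expR (- k * y)) = (cst c \+ d *: (expR \o (fun y => - k * y))) by [].
  by apply: is_derive_eq; rewrite add0r /GRing.scale /=; ring.
by exists 1, (-1); apply/funext => y; rewrite mulN1r.
Qed.

Lemma powR_near0 (r C e : R) : 0 < r -> 0 <= C -> 0 < e ->
  \forall z \near (0 : R), C * `|z| `^ r <= e.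
Proof.
move=> r0 C0 e0; near=> z.
have : `|z| <= (e / (C + 1)) `^ r^-1.
  near: z; apply/nbhs_ballP; exists ((e / (C + 1)) `^ r^-1) => /=.
    by rewrite powR_gt0// divr_gt0// ltr_wpDl.
  by move=> y; rewrite /ball/= sub0r normrN => /ltW.
move=> /(@ge0_ler_powR _ _ (ltW r0)).
rewrite !nnegrE normr_ge0 powR_ge0 => /(_ isT isT).
rewrite -powRrM mulVf ?gt_eqF// powRr1 ?divr_ge0 ?addr_ge0 ?(ltW e0)//.
move=> /(ler_wpM2l C0) /le_trans; apply.
rewrite mulrA ler_pdivrMr ?ltr_wpDl// mulrC ler_wpM2l ?(ltW e0)//.
by rewrite lerDl.
Unshelve. all: by end_near. Qed.

(** Superlinear vanishing at a point forces the derivative there to be zero. *)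
Lemma is_derive_0_superlinear F (r C : R) : 0 < r -> 0 <= C ->
  (forall t, `|t| <= 1 -> `|F t| <= C * `|t| `^ (1 + r)) -> is_derive (0 : R) (1 : R) F 0.
Proof.
move=> r0 C0 HF.
have F0 : F 0 = 0.
  apply/eqP; rewrite -normr_le0.
  have := HF 0; rewrite normr0 ler01 powR0 ?mulr0; first exact.
  by rewrite gt_eqF// addr_gt0.
apply/is_derive1_caratheodory; exists (fun z => F z / z); split.
- move=> z; rewrite F0 !subr0; have [->|z0] := eqVneq z 0; first by rewrite F0 mulr0.
  by rewrite divfK.
- apply/cvgrPdist_le => e e0 /=; rewrite F0 mul0r.
  near=> z; rewrite sub0r normrN normrM normfV.
  have [->|z0] := eqVneq z 0; first by rewrite F0 normr0 mul0r ltW.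
  have z1 : `|z| <= 1.
    by near: z; apply/nbhs_ballP; exists 1 => //= y; rewrite /ball/= sub0r normrN => /ltW.
  rewrite ler_pdivrMr ?normr_gt0//.
  apply: (le_trans (HF _ z1)).
  rewrite powRD ?normr_eq0 ?z0 ?implybT// powRr1// mulrCA [leRHS]mulrC ler_wpM2l//.
  by near: z; exact: powR_near0.
- by rewrite F0 mul0r.
Unshelve. all: by end_near. Qed.

(** A polynomial in [1/t] is beaten by [exp(-1/t)] as [t] tends to [0]. *)
Lemma horner_expR_bound (p : {poly R}) : exists2 C, 0 <= C & 
  forall t, 0 < t -> t <= 1 -> `|p.[t^-1] * expR (- t^-1)| <= C * t `^ (1 + 1).
Proof.
pose n := size p.
exists ((\sum_(i < n) `|p`_i|) * (n.+2)`!%:R); first by rewrite mulr_ge0// sumr_ge0.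
move=> t t0 t1.
have tV1 : 1 <= t^-1 by rewrite invf_ge1.
have tV0 : 0 < t^-1 by rewrite invr_gt0.
have P : `|p.[t^-1]| <= (\sum_(i < n) `|p`_i|) * t^-1 ^+ n.
  rewrite horner_coef; apply: (le_trans (ler_norm_sum _ _ _)).
  rewrite mulr_suml; apply: ler_sum => i _.
  rewrite normrM ler_wpM2l// normrX ger0_norm ?(ltW tV0)//.
  by rewrite ler_weXn2l// ltnW.
have E : expR (- t^-1) <= (n.+2)`!%:R * t ^+ n.+2.
  rewrite expRN -[leRHS]invrK lef_pV2 ?posrE ?expR_gt0//; last first.
    by rewrite invr_gt0 mulr_gt0// ?ltr0n ?fact_gt0// exprn_gt0.
  apply: le_trans (expR_ge1Dxn n.+1 (ltW tV0)).
  by rewrite invfM exprVn [leLHS]mulrC lerDr.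
rewrite normrM (ger0_norm (expR_ge0 _)).
apply: (le_trans (ler_pM _ _ P E)) => //.
rewrite mulrACA (_ : t^-1 ^+ n * t ^+ n.+2 = t `^ (1 + 1))//.
rewrite (_ : 1 + 1 = 2%:R)// powR_mulrn ?(ltW t0)// -addn2 exprD mulrA.
by rewrite exprVn mulVf ?mul1r// expf_neq0// gt_eqF.
Qed.

(** The derivatives of [flat] below all have this shape. *)
Definition expinv (p : {poly R}) t : R := if 0 < t then p.[t^-1] * expR (- t^-1) else 0.

Lemma is_derive_expinv p t :
  is_derive t (1 : R) (expinv p) (expinv ((p - p^`()) * 'X^2) t).
Proof.
have [t0|t0|->] := ltgtP t 0.
- have -> : expinv ((p - p^`()) * 'X^2) t = 0 by rewrite /expinv ltNge (ltW t0).
  apply: (@near_eq_is_derive _ _ _ (cst (0 : R))) => //.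
  near=> z; rewrite /expinv ifF //; apply/negbTE; rewrite -leNgt ltW//.
  by near: z; exact: lt_nbhsl.
- have -> : expinv ((p - p^`()) * 'X^2) t = ((p - p^`()) * 'X^2).[t^-1] * expR (- t^-1).
    by rewrite /expinv t0.
  apply: (@near_eq_is_derive _ _ _ (fun z : R => p.[z^-1] * expR (- z^-1))).
    near=> z; rewrite /expinv ifT //.
    by near: z; exact: lt_nbhsr.
  have tn0 : t != 0 by rewrite gt_eqF.
  have DV : is_derive t 1 (fun y : R => y^-1) (- t ^- 2).
    by have := is_deriveV tn0 (is_derive_id t 1); rewrite /GRing.scale /= mulr1.
  have D1 : is_derive t 1 ((horner p) \o (fun y => y^-1)) (p^`().[t^-1] * (- t ^- 2)).
    apply: is_derive1_comp; rewrite derivE derive1E; apply: derivableP.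
  have D2 : is_derive t 1 (expR \o (fun y => - y^-1)) (expR (- t^-1) * (t ^- 2)).
    apply: is_derive1_comp; apply: is_derive_eq; by rewrite opprK.
  have D := is_deriveM D1 D2.
  apply: (@is_derive_eq _ _ _ _ _ _ _ _ D).
  rewrite /= /GRing.scale /= hornerM hornerXn hornerD hornerN; field; exact: tn0.
- have -> : expinv ((p - p^`()) * 'X^2) 0 = 0 by rewrite /expinv ltxx.
  have [C C0 HC] := horner_expR_bound p.
  apply: (@is_derive_0_superlinear _ 1 C) => // z z1.
  rewrite /expinv; case: ifPn => z0; last by rewrite normr0 mulr_ge0// powR_ge0.
  by rewrite (gtr0_norm z0); apply: HC => //; rewrite -(gtr0_norm z0).
Unshelve. all: by end_near. Qed.

(** The standard smooth function that is flat at the origin. *)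
Definition flat t : R := if 0 < t then expR (- t^-1) else 0.

Lemma smooth1_flat : smooth1 flat.
Proof.
apply: (@smooth1_class _ (fun F => exists p, F = expinv p)).
  move=> _ [p ->]; exists (expinv ((p - p^`()) * 'X^2)); first by eexists.
  exact: is_derive_expinv.
by exists 1; apply/funext => t; rewrite /flat /expinv hornerC mul1r.
Qed.

Lemma flat_ge0 t : 0 <= flat t.
Proof. by rewrite /flat; case: ifP => // _; exact: expR_ge0. Qed.

Lemma flat_gt0 t : (0 < flat t) = (0 < t).
Proof. by rewrite /flat; case: ifP => // _; rewrite ?expR_gt0 ?ltxx. Qed.

End explicit_smooth.

(** * Bounded substitutes for powers *)

Section regularized_powers.
Context {R : realType}.
Implicit Types (c s t : R).

(** A bounded substitute for the power [(1 + t^2)^s], which it increases to as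
    [c] decreases to [0]. *)
Definition weight c s t : R := (1 + t ^+ 2) `^ s * (1 + c * t ^+ 2) `^ (- s).

Lemma sqr1_gt0 c t : 0 <= c -> 0 < 1 + c * t ^+ 2.
Proof. by move=> c0; rewrite ltr_wpDr// mulr_ge0// sqr_ge0. Qed.

Lemma sqr2_gt0 t : 0 < 1 + t ^+ 2.
Proof. by rewrite ltr_wpDr// sqr_ge0. Qed.

Lemma is_derive_powR_quad c a t : 0 <= c ->
  is_derive t (1 : R) (fun t => (1 + c * t ^+ 2) `^ a)
    (a * (1 + c * t ^+ 2) `^ (a - 1) * (c * (2 * t))).
Proof.
move=> c0.
have D1 : is_derive t (1 : R) (fun t => 1 + c * t ^+ 2) (c * (2 * t)).
  by apply: is_derive_eq; rewrite add0r /GRing.scale /=; ring.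
exact: (@is_derive1_comp _ (@powR R ^~ a) (fun t : R => 1 + c * t ^+ 2) t _ _
  (is_derive1_powR a (sqr1_gt0 t c0)) D1).
Qed.

(* The factor [1 * t ^+ 2] gives both factors the same form, so that one formula
   differentiates them. *)
Let wt c a b t : R := (1 + 1 * t ^+ 2) `^ a * (1 + c * t ^+ 2) `^ b.

Let is_derive_wt c a b t : 0 <= c ->
  is_derive t (1 : R) (wt c a b)
    ((2 * a * t * (1 + c * t ^+ 2) + 2 * b * c * t * (1 + 1 * t ^+ 2))
     * wt c (a - 1) (b - 1) t).
Proof.
move=> c0.
have := is_deriveM (is_derive_powR_quad a t ler01) (is_derive_powR_quad b t c0).
move=> D; apply: (@is_derive_eq _ _ _ _ _ _ _ _ D).
have E d e : 0 <= d -> (1 + d * t ^+ 2) `^ e = (1 + d * t ^+ 2) * (1 + d * t ^+ 2) `^ (e - 1).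
  move=> d0; rewrite -{2}[1 + d * _]powRr1 ?(ltW (sqr1_gt0 _ _))// -powRD.
    by congr (_ `^ _); ring.
  by rewrite (gt_eqF (sqr1_gt0 _ d0)) implybT.
by rewrite /= /GRing.scale /= /wt (E 1 a)// (E c b)//; ring.
Qed.

Let smooth1_wt (p : {poly R}) c a b : 0 <= c -> smooth1 (fun t => p.[t] * wt c a b t).
Proof.
move=> c0; apply: (@smooth1_class _ (fun F => exists (p : {poly R}) a b,
    F = fun t => p.[t] * wt c a b t)); last by exists p, a, b.
move=> _ [{a b}{}p [a [b ->]]].
pose u : {poly R} := 1 + 'X^2; pose v : {poly R} := 1 + c *: 'X^2.
pose r := p^`() * (u * v) + p * ((2 * a) *: ('X * v) + (2 * b * c) *: ('X * u)).
exists (fun t => r.[t] * wt c (a - 1) (b - 1) t); first by exists r, (a - 1), (b - 1).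
move=> t.
have Dp : is_derive t 1 (horner p) p^`().[t].
  rewrite derivE derive1E; apply: derivableP; exact: derivable_horner.
have D := is_deriveM Dp (is_derive_wt a b t c0).
apply: (@is_derive_eq _ _ _ _ _ _ _ _ D).
have E d e : 0 <= d -> (1 + d * t ^+ 2) `^ e = (1 + d * t ^+ 2) * (1 + d * t ^+ 2) `^ (e - 1).
  move=> d0; rewrite -{2}[1 + d * _]powRr1 ?(ltW (sqr1_gt0 _ _))// -powRD.
    by congr (_ `^ _); ring.
  by rewrite (gt_eqF (sqr1_gt0 _ d0)) implybT.
rewrite /= /GRing.scale /= /r /u /v.
rewrite !(hornerD, hornerM, hornerZ, hornerXn, hornerX, hornerC).
by rewrite /wt (E 1 a)// (E c b)//; ring.
Qed.

Let weightE c s t : weight c s t = wt c s (- s) t.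
Proof. by rewrite /weight /wt mul1r. Qed.

Lemma smooth1_mul_weight c s : 0 <= c -> smooth1 (fun t => t * weight c s t).
Proof.
move=> c0; have := @smooth1_wt 'X c s (- s) c0.
rewrite (_ : (fun t => _) = fun t => t * weight c s t)//.
by apply/funext => t; rewrite hornerX weightE.
Qed.

Lemma weight_ge1 c s t : 0 <= c -> c <= 1 -> 0 <= s -> 1 <= weight c s t.
Proof.
move=> c0 c1 s0; rewrite /weight powRN ler_pdivlMr ?mul1r; last first.
  by rewrite powR_gt0// sqr1_gt0.
apply: ge0_ler_powR => //; rewrite ?nnegrE ?(ltW (sqr2_gt0 _)) ?(ltW (sqr1_gt0 _ c0))//.
by rewrite lerD2l ler_piMl// sqr_ge0.
Qed.

Lemma weight_le c s t : 0 <= c -> 0 <= s -> weight c s t <= (1 + t ^+ 2) `^ s.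
Proof.
move=> c0 s0; rewrite /weight powRN ler_piMr ?powR_ge0//.
rewrite invf_le1 ?powR_gt0 ?sqr1_gt0//.
rewrite -[leLHS](@powRr0 _ (1 + c * t ^+ 2)) ler_powR//.
by rewrite lerDl mulr_ge0// sqr_ge0.
Qed.

Lemma weight_bounded c s t : 0 < c -> c <= 1 -> 0 <= s -> weight c s t <= c `^ (- s).
Proof.
move=> c0 c1 s0; rewrite /weight !powRN ler_pdivrMr ?powR_gt0 ?sqr1_gt0 ?(ltW c0)//.
have t1 := ltW (sqr1_gt0 t (ltW c0)); have t2 := ltW (sqr2_gt0 t).
rewrite mulrC ler_pdivlMr ?powR_gt0// -powRM ?(ltW c0)//.
apply: ge0_ler_powR => //; rewrite ?nnegrE ?mulr_ge0 ?(ltW c0)//.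
by rewrite mulrDl mul1r [_ * c]mulrC lerD2r.
Qed.

Lemma weight_powR c s a t : 0 <= c -> weight c s t `^ a = weight c (s * a) t.
Proof.
move=> c0; rewrite /weight powRM ?powR_ge0// -!powRrM mulNr//.
Qed.

Lemma weight_cvg s t : weight (k.+1%:R^-1) s t @[k --> \oo] --> (1 + t ^+ 2) `^ s.
Proof.
rewrite /weight -[X in _ --> X]mulr1; apply: cvgM; first exact: cvg_cst.
rewrite [X in _ --> X](_ : _ = (1 + 0 * t ^+ 2) `^ (- s)); last first.
  by rewrite mul0r addr0 powR1.
have cf : {for 0, continuous (fun c : R => (1 + c * t ^+ 2) `^ (- s))}.
  apply: differentiable_continuous; apply/derivable1_diffP.
  have D1 : is_derive (0 : R) (1 : R) (fun c => 1 + c * t ^+ 2) (t ^+ 2).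
    by apply: is_derive_eq; rewrite /GRing.scale /=; ring.
  have p0 : 0 < 1 + 0 * t ^+ 2 by rewrite mul0r addr0.
  exact: (@ex_derive _ _ _ _ _ _ _ (@is_derive1_comp _ (@powR R ^~ (- s))
    (fun c : R => 1 + c * t ^+ 2) 0 _ _ (is_derive1_powR (- s) p0) D1)).
apply: (@cvg_comp _ _ _ (fun k => k.+1%:R^-1) (fun c : R => (1 + c * t ^+ 2) `^ (- s))
   _ (nbhs (0:R))); last exact: cf.
exact: cvg_harmonic.
Qed.

(** The point of [weight]: up to a constant factor, differentiating
    [t * weight c s t] amounts to dividing by [t], uniformly in [c]. *)
Lemma derive_mul_weight c s t : 0 < c -> c <= 1 -> 0 <= s ->
  weight c s t <= derive1 (fun t => t * weight c s t) t <= (1 + 2 * s) * weight c s t.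
Proof.
move=> c0 c1 s0.
have D : is_derive t (1 : R) (fun t => t * weight c s t)
  (weight c s t * (1 + 2 * s * (t ^+ 2 * (1 - c) / ((1 + t ^+ 2) * (1 + c * t ^+ 2))))).
  rewrite (_ : (fun t => _) = (fun t => t * wt c s (- s) t)); last first.
    by apply/funext => x; rewrite weightE.
  have D := is_deriveM (is_derive_id t 1) (is_derive_wt s (- s) t (ltW c0)).
  apply: (@is_derive_eq _ _ _ _ _ _ _ _ D).
  have E d e : 0 <= d -> (1 + d * t ^+ 2) `^ (e - 1) = (1 + d * t ^+ 2) `^ e / (1 + d * t ^+ 2).
    move=> d0; rewrite powRB ?powRr1 ?(ltW (sqr1_gt0 _ _))//.
    by rewrite (gt_eqF (sqr1_gt0 _ _))// implybT.
  rewrite weightE /= /GRing.scale /= /wt !E ?(ltW c0)// !mul1r.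
  field.
  by rewrite (gt_eqF (sqr1_gt0 _ (ltW c0))) (gt_eqF (sqr2_gt0 _)).
rewrite derive1E (@derive_val _ _ _ _ _ _ _ D).
have w0 : 0 <= weight c s t by rewrite mulr_ge0 ?powR_ge0.
set y := (X in 2 * s * X).
have d0 : 0 < (1 + t ^+ 2) * (1 + c * t ^+ 2).
  by rewrite mulr_gt0// ?sqr1_gt0 ?(ltW c0)// sqr2_gt0.
have y0 : 0 <= y by rewrite divr_ge0 ?(ltW d0)// mulr_ge0 ?sqr_ge0// subr_ge0.
have y1 : y <= 1.
  rewrite ler_pdivrMr// mul1r.
  have := sqr_ge0 t; have := mulr_ge0 (mulr_ge0 (ltW c0) (sqr_ge0 t)) (sqr_ge0 t).
  nra.
apply/andP; split.
  by rewrite ler_peMr// lerDl; apply: mulr_ge0 => //; exact: mulr_ge0.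
by rewrite mulrC ler_wpM2r// lerD2l ler_piMr//; exact: mulr_ge0.
Qed.

End regularized_powers.

(** * Hoelder's inequality and Borel sets of R^n *)

Section hoelder_nonneg.
Local Open Scope ereal_scope.
Context d (T : measurableType d) (R : realType) (mu : {measure set T -> \bar R}).

Lemma hoelder_ge0 (f g : T -> R) (p q : R) :
  measurable_fun setT f -> measurable_fun setT g ->
  (forall x, 0 <= f x)%R -> (forall x, 0 <= g x)%R ->
  (0 < p)%R -> (0 < q)%R -> (p^-1 + q^-1 = 1)%R ->
  \int[mu]_x (f x * g x)%:E <=
    (\int[mu]_x (f x `^ p)%:E) `^ p^-1 * (\int[mu]_x (g x `^ q)%:E) `^ q^-1.
Proof.
move=> mf mg f0 g0 p0 q0 pq.
have := hoelder mu mf mg p0 q0 pq.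
rewrite Lnorm1 unlock /=.
have E (h : T -> R) r : (forall x, 0 <= h x)%R ->
    \int[mu]_x `|(EFin \o h) x| `^ r = \int[mu]_x (h x `^ r)%:E.
  by move=> h0; apply: eq_integral => x _ /=; rewrite ger0_norm.
rewrite (E _ _ f0) (E _ _ g0); apply: le_trans; rewrite le_eqVlt; apply/orP; left.
by apply/eqP; apply: eq_integral => x _; rewrite ger0_norm// mulr_ge0.
Qed.

End hoelder_nonneg.

Section borel_rV.
Context {R : realType}.

Lemma measurable_fin_forall (n : nat) d (T : measurableType d) (P : 'I_n -> set T) :
  (forall i, measurable (P i)) -> measurable [set x | forall i, P i x].
Proof.
move=> mP; rewrite (_ : [set x | _] = \bigcap_i P i).
  by apply: fin_bigcap_measurable => //; exact: finite_finset.
by apply/seteqP; split => x /= H i; [move=> _; exact: H|exact: (H i I)].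
Qed.

(** The sigma-algebra is generated by coordinates: an open set is the union of the
    countably many cubes with rational centre and radius [1/(k+1)] inside it. *)
Lemma open_measurable_rV n (A : set 'rV[R]_n) : open A -> measurable A.
Proof.
move=> oA.
pose B (qk : 'rV[rat]_n * nat) : set 'rV[R]_n :=
  [set x | forall i, `|x ord0 i - ratr (qk.1 ord0 i)| < qk.2.+1%:R^-1].
pose F qk := if `[< B qk `<=` A >] then B qk else set0.
have -> : A = \bigcup_qk F qk.
  apply/seteqP; split => x; last first.
    by move=> [qk _]; rewrite /F; case: asboolP => // + Bx; exact.
  move=> Ax; have /nbhs_ballP[e /= e0 eA] := open_nbhs_nbhs (conj oA Ax).
  have [k ke] : exists k, k.+1%:R^-1 < e / 2 :> R.
    have := near_infty_natSinv_lt (PosNum (divr_gt0 e0 (ltr0Sn R 1))).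
    by move=> /(@filter_ex _ _ _)[k /= ?]; exists k.
  have k0 : 0 < k.+1%:R^-1 :> R by rewrite invr_gt0 ltr0n.
  have /choice[q Hq] : forall i, exists q : rat, `|x ord0 i - ratr q| < k.+1%:R^-1.
    move=> i; have /rat_in_itvoo[q] : x ord0 i - k.+1%:R^-1 < x ord0 i + k.+1%:R^-1.
      by rewrite ltrBlDr -addrA ltrDl addr_gt0.
    by rewrite in_itv/= => /andP[? ?]; exists q; rewrite distrC ltr_distl; apply/andP.
  exists (\row_i q i, k) => //; rewrite /F asboolT.
    by move=> i /=; rewrite mxE.
  move=> y By; apply: eA; split => // i j; rewrite (ord1 i).
  have H1 := Hq j; have H2 := By j; rewrite /= mxE in H2.
  rewrite /ball /= -(subrKA (ratr (q j))).
  apply: (le_lt_trans (ler_normD _ _)); rewrite [ltRHS]splitr.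
  apply: ltrD; first exact: (lt_trans H1 ke).
  by rewrite distrC; exact: (lt_trans H2 ke).
apply: countable_bigcupT_measurable; first exact: countableP.
move=> qk; rewrite /F; case: asboolP => // _.
apply: measurable_fin_forall => i; rewrite -[X in measurable X]setTI.
have := @measurable_coord R n i measurableT _ (open_measurable (@ball_open R R (ratr (qk.1 ord0 i)) qk.2.+1%:R^-1)).
congr measurable; apply/seteqP; split => x /= [_]; rewrite /ball/= distrC => ?; by split.
Qed.

Lemma continuous_measurable_rV n (f : 'rV[R]_n -> R) : continuous f -> measurable_fun setT f.
Proof.
move=> /continuousP cf; apply: (measurability _ (RGenOpens.measurableE R)).
move=> _ [_ [a [b ->] <-]]; rewrite setTI; apply: open_measurable_rV.
exact/cf/interval_open.
Qed.

Definition cube n (M : R) : set 'rV[R]_n := [set x | forall i, `|x ord0 i| <= M].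
Arguments cube n M _ : clear implicits.

Lemma measurable_cube n M : measurable (cube n M).
Proof.
apply: measurable_fin_forall => i; rewrite -[X in measurable X]setTI.
have := @measurable_coord R n i measurableT `[- M, M]%classic (measurable_itv _).
by congr measurable; apply/seteqP; split => x /= [_]; rewrite in_itv/= -?ler_norml.
Qed.

Lemma rV_cons0 n (p : R * 'rV[R]_n) : rV_cons p ord0 ord0 = p.1.
Proof. by rewrite -[in RHS](rV_consK p). Qed.

Lemma rV_consS n (p : R * 'rV[R]_n) (j : 'I_n) : rV_cons p ord0 (lift ord0 j) = p.2 ord0 j.
Proof.
have /= := congr1 (fun q : R * 'rV[R]_n => q.2 ord0 j) (rV_consK p); rewrite mxE => <-.
by congr (rV_cons p _ _); exact: val_inj.
Qed.

Lemma cube_cons n M (p : R * 'rV[R]_n) :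
  cube n.+1 M (rV_cons p) <-> `|p.1| <= M /\ cube n M p.2.
Proof.
split.
  by move=> H; split=> [|i]; [rewrite -rV_cons0; exact: H|rewrite -rV_consS; exact: H].
move=> [H1 H2] i; have [j ->|->] := unliftP ord0 i; last by rewrite rV_cons0.
by rewrite rV_consS; exact: H2.
Qed.

Local Notation B n := (borel_lebesgue R n).

Lemma borel_lebesgue_succE n A :
  B n.+1 A = (lebesgue_measure \x B n)%E (@rV_cons R n @^-1` A).
Proof. by []. Qed.

Lemma borel_cube_lty n M : (B n (cube n M) < +oo)%E.
Proof.
elim: n => [|n IH].
  exact: ltry.
rewrite borel_lebesgue_succE (_ : _ @^-1` _ = `[- M, M]%classic `*` cube n M).
  rewrite product_measure1E//; last exact: measurable_cube.
  rewrite lte_mul_pinfty//= lebesgue_measure_itv/=.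
  by case: ifP => // _; rewrite -EFinB ltry.
by apply/seteqP; split => p /=; rewrite cube_cons in_itv/= ler_norml.
Qed.

End borel_rV.
Arguments cube {R} n M _.

(** * Iterated integrals *)

Section product_integrals.
Context {R : realType}.
Local Open Scope ereal_scope.
Local Notation B n := (borel_lebesgue R n).
Local Notation leb := (@lebesgue_measure R).

Lemma measurable_section n d (T : measurableType d) (f : 'rV[R]_n.+1 -> T) t :
  measurable_fun setT f -> measurable_fun setT (fun y : 'rV[R]_n => f (rV_cons (t, y))).
Proof.
move=> mf; apply: (measurableT_comp mf).
exact: (measurableT_comp (@measurable_rV_cons R n) (pair1_measurable t)).
Qed.

Lemma measurable_line0 n d (T : measurableType d) (f : 'rV[R]_n.+1 -> T) y :
  measurable_fun setT f -> measurable_fun setT (fun t : R => f (rV_cons (t, y))).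
Proof.
move=> mf; apply: (measurableT_comp mf).
exact: (measurableT_comp (@measurable_rV_cons R n) (pair2_measurable y)).
Qed.

Let mcons n :
  measurable_fun [set: (g_sigma_algebraType R.-ocitv.-measurable * 'rV[R]_n)%type]
    (@rV_cons R n).
Proof. exact: measurable_rV_cons. Qed.

Let pm n := [the {measure set _ -> \bar R} of (leb \x B n)].

Lemma borel_fubini_ge0 n (f : 'rV[R]_n.+1 -> \bar R) :
  measurable_fun setT f -> (forall x, 0 <= f x) ->
  \int[B n.+1]_x f x = \int[leb]_t \int[B n]_y f (rV_cons (t, y)).
Proof.
move=> mf f0.
have := @ge0_integral_pushforward _ _ _ _ _ _ (@mcons n) (pm n) _ f measurableT mf
  (fun x _ => f0 x).
rewrite preimage_setT => E; rewrite [LHS]E.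
apply: (@fubini_tonelli1 _ _ _ _ _ leb (B n) (f \o @rV_cons R n)).
  by apply: measurableT_comp => //; exact: measurable_rV_cons.
by move=> p; exact: f0.
Qed.

Lemma borel_fubini_ge0_swap n (f : 'rV[R]_n.+1 -> \bar R) :
  measurable_fun setT f -> (forall x, 0 <= f x) ->
  \int[B n.+1]_x f x = \int[B n]_y \int[leb]_t f (rV_cons (t, y)).
Proof.
move=> mf f0; rewrite borel_fubini_ge0//.
apply: (@fubini_tonelli _ _ _ _ _ leb (B n) (f \o @rV_cons R n)).
  by apply: measurableT_comp => //; exact: measurable_rV_cons.
by move=> p; exact: f0.
Qed.

Lemma borel_fubini n (f : 'rV[R]_n.+1 -> \bar R) :
  (B n.+1).-integrable setT f ->
  \int[B n.+1]_x f x = \int[leb]_t \int[B n]_y f (rV_cons (t, y)) /\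
  \int[B n.+1]_x f x = \int[B n]_y \int[leb]_t f (rV_cons (t, y)).
Proof.
move=> If; have mf := measurable_int _ If.
have mfc : measurable_fun setT (f \o @rV_cons R n).
  by apply: measurableT_comp => //; exact: mcons.
have Ifc : (pm n).-integrable setT (f \o @rV_cons R n).
  apply/integrableP; split => //; move/integrableP : If => [_]; apply: le_lt_trans.
  have mfa : measurable_fun setT (abse \o f) by exact: measurableT_comp.
  have := @ge0_integral_pushforward _ _ _ _ _ _ (@mcons n) (pm n) _ (abse \o f) measurableT
    mfa (fun x _ => abse_ge0 (f x)).
  by rewrite preimage_setT => E; rewrite [leRHS]E.
have E : \int[B n.+1]_x f x = \int[pm n]_x (f \o @rV_cons R n) x.
  exact: (@integral_pushforward _ _ _ _ _ _ (@mcons n) (pm n) setT f mf Ifc measurableT).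
rewrite E; split.
  by rewrite -(@integral12_prod_meas1 _ _ _ _ _ leb (B n)).
by rewrite -(@integral21_prod_meas1 _ _ _ _ _ leb (B n)).
Qed.

(** Bounded measurable functions with bounded support: all the integrals below
    are finite for them, and the class is stable under sections and under
    integration of one variable. *)
Definition bounded_bsupp n (f : 'rV[R]_n -> R) :=
  measurable_fun setT f /\
  exists M, forall x, (`|f x| <= M)%R /\ (f x != 0%R -> cube n M x).

Lemma bounded_bsupp_integrable n (f : 'rV[R]_n -> R) : bounded_bsupp f ->
  (B n).-integrable setT (EFin \o f).
Proof.
move=> [mf [M HM]].
rewrite (_ : EFin \o f = (EFin \o f) \_ (cube n M)); last first.
  apply/funext => x; rewrite patchE; case: ifPn => //.
  rewrite notin_setE /= => cx; have [_ H] := HM x.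
  by have [->//|/H] := eqVneq (f x) 0%R.
rewrite -integrable_mkcond; last exact: measurable_cube.
apply: measurable_bounded_integrable.
- exact: measurable_cube.
- exact: borel_cube_lty.
- exact: measurable_funTS.
- exists M; split; first exact: num_real.
  by move=> y My x _ /=; rewrite (le_trans (HM x).1)// ltW.
Qed.

Lemma bounded_bsupp_section n (f : 'rV[R]_n.+1 -> R) t : bounded_bsupp f ->
  bounded_bsupp (fun y : 'rV[R]_n => f (rV_cons (t, y))).
Proof.
move=> [mf [M HM]]; split; first exact: measurable_section.
by exists M => y; split; [exact: (HM _).1|move=> /((HM _).2) /cube_cons[]].
Qed.

Lemma bounded_bsupp_line0 n (f : 'rV[R]_n.+1 -> R) y : bounded_bsupp f ->
  leb.-integrable setT (fun t => (f (rV_cons (t, y)))%:E).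
Proof.
move=> [mf [M HM]].
rewrite (_ : (fun t => _) = (fun t => (f (rV_cons (t, y)))%:E) \_ `[(- M)%R, M]%classic); last first.
  apply/funext => t; rewrite patchE; case: ifPn => //.
  rewrite notin_setE /= in_itv/= -ler_norml => cx.
  have [_ H] := HM (rV_cons (t, y)).
  by have [->//|/H /cube_cons[/= ]] := eqVneq (f (rV_cons (t, y))) 0%R.
rewrite -integrable_mkcond//.
change (leb.-integrable `[(- M)%R, M] (EFin \o (fun t : R => f (rV_cons (t, y))))).
apply: measurable_bounded_integrable => //.
- rewrite /= lebesgue_measure_itv/=.
  by case: ifP => // _; rewrite -EFinB ltry.
- by apply: measurable_funTS; exact: measurable_line0.
- exists M; split; first exact: num_real.
  by move=> z Mz x _ /=; rewrite (le_trans (HM _).1)// ltW.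
Qed.

Lemma bounded_bsupp_marginal n (f : 'rV[R]_n.+1 -> R) : bounded_bsupp f ->
  (forall x, 0 <= f x)%R ->
  bounded_bsupp (fun y : 'rV[R]_n => \int[leb]_t (f (rV_cons (t, y))))%R.
Proof.
move=> bf f0; have [mf [M HM]] := bf; split.
  apply: measurableT_comp => //.
  apply: (measurable_fun_fubini_tonelli_G (m1 := leb) (fun p => (f (rV_cons p))%:E)) => //.
    by apply/measurable_EFinP; apply: measurableT_comp => //; exact: measurable_rV_cons.
  by move=> p; rewrite lee_fin.
have M0 : (0 <= M)%R by exact: le_trans (normr_ge0 _) (HM 0%R).1.
exists (Num.max M (M * (M + M)))%R => y; split.
  rewrite le_max; apply/orP; right.
  rewrite ger0_norm; last by apply: Rintegral_ge0.
  rewrite -lee_fin /Rintegral fineK; last first.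
    exact/integrable_fin_num/bounded_bsupp_line0.
  apply: (@le_trans _ _ (\int[leb]_(t in `[(- M)%R, M]) (cst M%:E) t)).
    rewrite [leRHS]integral_mkcond; apply: ge0_le_integral => //.
    - by move=> t _; rewrite lee_fin.
    - by apply/measurable_EFinP; exact: measurable_line0.
    - by apply/measurable_restrict => //; exact: measurable_cst.
    - move=> t _; rewrite patchE; case: ifPn => [_|].
        by rewrite lee_fin (le_trans (ler_norm _) (HM _).1).
      rewrite notin_setE /= in_itv/= -ler_norml => cx.
      have [_ H] := HM (rV_cons (t, y)).
      by have [->//|/H /cube_cons[/= ]] := eqVneq (f (rV_cons (t, y))) 0%R.
  rewrite integral_cst//= lebesgue_measure_itv/=.
  case: ifP => [_|_]; last by rewrite mule0 lee_fin mulr_ge0// addr_ge0.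
  by rewrite -EFinB opprK -EFinM.
move=> fy; have : exists t, f (rV_cons (t, y)) != 0%R.
  apply: contrapT => /forallNP H; move/eqP: fy; apply.
  rewrite (_ : (fun _ => _) = cst 0%R); first by rewrite Rintegral_cst// mul0r.
  by apply/funext => t; apply/eqP/negPn/negP; exact: H.
move=> [t /((HM _).2)/cube_cons[_ /= cy]] i; rewrite (le_trans (cy i))// le_max lexx//.
Qed.

End product_integrals.

(** * The Gagliardo-Nirenberg inequality *)

Section lines.
Context {R : realType}.
Local Open Scope ereal_scope.
Local Notation B n := (borel_lebesgue R n).
Local Notation leb := (@lebesgue_measure R).

Let eq_lee (a b : \bar R) : a = b -> a <= b.
Proof. by move=> ->. Qed.

Definition set_coord n (x : 'rV[R]_n) (i : 'I_n) (t : R) : 'rV[R]_n :=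
  \row_j (if j == i then t else x ord0 j).

Lemma rV_unconsK n : cancel (@rV_uncons R n) (@rV_cons R n).
Proof.
move=> x; apply/rowP => i; have [j ->|->] := unliftP ord0 i; last by rewrite rV_cons0.
by rewrite rV_consS /= mxE; congr (x _ _); exact: val_inj.
Qed.

Lemma set_coord_cons0 n (p : R * 'rV[R]_n) t :
  set_coord (rV_cons p) ord0 t = rV_cons (t, p.2).
Proof.
apply/rowP => i; rewrite mxE; have [j ->|->] := unliftP ord0 i.
  by rewrite -(inj_eq val_inj)/= !rV_consS.
by rewrite eqxx rV_cons0.
Qed.

Lemma set_coord_consS n s (y : 'rV[R]_n) (j : 'I_n) t :
  set_coord (rV_cons (s, y)) (lift ord0 j) t = rV_cons (s, set_coord y j t).
Proof.
apply/rowP => i; rewrite mxE; have [k ->|->] := unliftP ord0 i.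
  by rewrite (inj_eq lift_inj) !rV_consS mxE.
by rewrite (negbTE (neq_lift _ _)) !rV_cons0.
Qed.

(** Fubini's theorem: split off coordinates until the one numbered [i] comes first. *)
Lemma integral_lines_eq0 n (i : 'I_n) (f : 'rV[R]_n -> R) : bounded_bsupp f ->
  (forall x, \int[leb]_t (f (set_coord x i t))%:E = 0) ->
  \int[B n]_x (f x)%:E = 0.
Proof.
elim: n i f => [[]//|n IH] i f bf.
have [j ->|->] := unliftP ord0 i => f0.
  rewrite (borel_fubini (bounded_bsupp_integrable bf)).1.
  apply: integral0_eq => t _; apply: (IH j); first exact: bounded_bsupp_section.
  by move=> y; rewrite -[RHS](f0 (rV_cons (t, y))); under [RHS]eq_integral do rewrite set_coord_consS.
rewrite (borel_fubini (bounded_bsupp_integrable bf)).2.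
apply: integral0_eq => y _; rewrite -[RHS](f0 (rV_cons (0%R, y))).
by under [RHS]eq_integral do rewrite set_coord_cons0.
Qed.

(** The hypothesis of the Gagliardo-Nirenberg inequality: [f] is controlled by
    the integral of [g] along each line parallel to an axis. *)
Definition line_bounded n (f g : 'rV[R]_n -> R) := forall x i,
  (f x)%:E <= \int[leb]_t (g (set_coord x i t))%:E.

Let nonneg n (f : 'rV[R]_n -> R) := forall x, (0 <= f x)%R.

(* Testing with a weight [k] in [L^1] is the dual form of the bound of [f] in
   [L^(n/(n-1))] by [g] in [L^1]; it makes sense for [n = 1], where the exponent is
   infinite. *)
Let weighted n := forall f g k : 'rV[R]_n -> R,
  bounded_bsupp f -> nonneg f -> bounded_bsupp g -> nonneg g ->
  bounded_bsupp k -> nonneg k -> line_bounded f g ->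
  \int[B n]_x (f x * k x `^ n%:R^-1)%:E <=
    \int[B n]_x (g x)%:E * (\int[B n]_x (k x)%:E) `^ n%:R^-1.

Let weighted1 : weighted 1.
Proof.
move=> f g k bf f0 bg g0 bk k0 fg.
have fle x : (f x)%:E <= \int[B 1]_x (g x)%:E.
  apply: (le_trans (fg x ord0)).
  have mg : measurable_fun setT (fun x => (g x)%:E) by apply/measurable_EFinP; exact: bg.1.
  have gz z : 0 <= (g z)%:E by rewrite lee_fin.
  rewrite (borel_fubini_ge0 mg gz).
  apply: eq_lee; apply: eq_integral => t _.
  rewrite integral_dirac//; last exact: (measurable_section t mg).
  rewrite diracT mul1e -(rV_unconsK x) set_coord_cons0.
  by congr (g (rV_cons (t, _)))%:E; apply/rowP => -[].
rewrite invr1 poweRe1; last by apply: integral_ge0 => x _; rewrite lee_fin.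
rewrite -ge0_integralZl//; first last.
- by apply: integral_ge0 => x _; rewrite lee_fin.
- by move=> x _; rewrite lee_fin.
- by apply/measurable_EFinP; exact: bk.1.
apply: ge0_le_integral => //.
- by move=> x _; rewrite lee_fin mulr_ge0// powR_ge0.
- by apply/measurable_EFinP; apply: measurable_funM; [exact: bf.1|exact: (measurableT_comp (measurable_powR _) bk.1)].
- by apply: emeasurable_funM => //; apply/measurable_EFinP; exact: bk.1.
- by move=> x _; rewrite powRr1// EFinM lee_wpmul2r// lee_fin.
Qed.

(* The weight is [K y], the integral of [g] along the line through [y] in the first
   direction, which bounds [f]. *)
Let sobolev_step n : (0 < n)%N -> weighted n -> forall f g : 'rV[R]_n.+1 -> R,
  bounded_bsupp f -> nonneg f -> bounded_bsupp g -> nonneg g -> line_bounded f g ->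
  \int[B n.+1]_x (f x `^ (1 + n%:R^-1))%:E <=
    (\int[B n.+1]_x (g x)%:E) `^ (1 + n%:R^-1).
Proof.
move=> n0 W f g bf f0 bg g0 fg.
have nV0 : (0 < n%:R^-1 :> R)%R by rewrite invr_gt0 ltr0n.
pose K (y : 'rV[R]_n) := (\int[leb]_t g (rV_cons (t, y)))%R.
have KE y : (K y)%:E = \int[leb]_t (g (rV_cons (t, y)))%:E.
  rewrite fineK//; exact/integrable_fin_num/bounded_bsupp_line0.
have bK : bounded_bsupp K by exact: bounded_bsupp_marginal.
have K0 : nonneg K by move=> y; apply: Rintegral_ge0.
have mg : measurable_fun setT (fun x => (g x)%:E) by apply/measurable_EFinP; exact: bg.1.
have intK : \int[B n]_y (K y)%:E = \int[B n.+1]_x (g x)%:E.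
  rewrite borel_fubini_ge0_swap//.
  by apply: eq_integral => y _; exact: KE.
have mfp : measurable_fun setT (fun x => (f x `^ (1 + n%:R^-1))%:E).
  by apply/measurable_EFinP; exact: (measurableT_comp (measurable_powR _) bf.1).
rewrite (borel_fubini_ge0 mfp); last by move=> z; rewrite lee_fin powR_ge0.
have mG : measurable_fun setT (fun t : R => \int[B n]_y (g (rV_cons (t, y)))%:E).
  apply: (@measurable_fun_fubini_tonelli_F _ _ _ _ _ (B n)
    (fun p : R * 'rV[R]_n => (g (rV_cons p))%:E)); last by move=> p; rewrite lee_fin.
  by apply: (measurableT_comp mg); exact: measurable_rV_cons.
have G0 t : 0 <= \int[B n]_y (g (rV_cons (t, y)))%:E.
  by apply: integral_ge0 => y _; rewrite lee_fin.
have I0 : 0 <= \int[B n.+1]_x (g x)%:E by apply: integral_ge0 => x _; rewrite lee_fin.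
apply: (@le_trans _ _ (\int[leb]_t (\int[B n]_y (g (rV_cons (t, y)))%:E *
    (\int[B n.+1]_x (g x)%:E) `^ n%:R^-1))).
  apply: ge0_le_integral => //.
  - by move=> t _; apply: integral_ge0 => y _; rewrite lee_fin powR_ge0.
  - apply: (@measurable_fun_fubini_tonelli_F _ _ _ _ _ (B n)
      (fun p : R * 'rV[R]_n => (f (rV_cons p) `^ (1 + n%:R^-1))%:E)).
      by apply: (measurableT_comp mfp); exact: measurable_rV_cons.
    by move=> p; rewrite lee_fin powR_ge0.
  - apply: emeasurable_funM => //; exact: measurable_cst.
  move=> t _; have bft := bounded_bsupp_section t bf; have bgt := bounded_bsupp_section t bg.
  rewrite -intK; apply: le_trans; last first.
    apply: (W (fun y => f (rV_cons (t, y))) (fun y => g (rV_cons (t, y))) K) => //.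
    move=> y i; apply: (le_trans (fg (rV_cons (t, y)) (lift ord0 i))).
      by apply: eq_lee; apply: eq_integral => s _; rewrite set_coord_consS.
  apply: ge0_le_integral => //.
  - by move=> y _; rewrite lee_fin powR_ge0.
  - by apply/measurable_EFinP; exact: (measurableT_comp (measurable_powR _) bft.1).
  - apply/measurable_EFinP; apply: measurable_funM; first exact: bft.1.
    exact: (measurableT_comp (measurable_powR _) bK.1).
  - move=> y _; rewrite lee_fin powRD; last first.
      by rewrite gt_eqF ?implyFb// addr_gt0.
    rewrite powRr1// ler_wpM2l// ge0_ler_powR ?(ltW nV0)// ?nnegrE//.
    rewrite -lee_fin KE; apply: (le_trans (fg (rV_cons (t, y)) ord0)).
    by apply: eq_lee; apply: eq_integral => s _; rewrite set_coord_cons0.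
rewrite ge0_integralZr//; last exact: poweR_ge0.
rewrite -(borel_fubini_ge0 mg); last by move=> z; rewrite lee_fin.
rewrite poweRD ?poweRe1//.
by apply: add_neq0_poweRD_def; rewrite gt_eqF// addr_gt0.
Qed.

(* Hoelder's inequality for the exponents [1 + 1/n] and [n + 1]. *)
Let weighted_succ n : (0 < n)%N -> weighted n -> weighted n.+1.
Proof.
move=> n0 W f g k bf f0 bg g0 bk k0 fg.
have n0R : (0 < n%:R :> R)%R by rewrite ltr0n.
have nS0 : (0 < n.+1%:R :> R)%R by rewrite ltr0n.
have nV0 : (0 < n%:R^-1 :> R)%R by rewrite invr_gt0.
have I0 : 0 <= \int[B n.+1]_x (g x)%:E by apply: integral_ge0 => x _; rewrite lee_fin.
have p0 : (0 < 1 + n%:R^-1 :> R)%R by rewrite addr_gt0.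
have mk : measurable_fun setT (fun x => (k x `^ n.+1%:R^-1)%R).
  exact: (measurableT_comp (measurable_powR _) bk.1).
have pq : ((1 + n%:R^-1)^-1 + n.+1%:R^-1 = 1 :> R)%R.
  have n1 : (n%:R != 0 :> R)%R by rewrite gt_eqF.
  have n2 : (n%:R + 1 != 0 :> R)%R by rewrite gt_eqF// addr_gt0.
  by rewrite -natr1; field; rewrite n1 ?n2 // addrC.
have /le_trans := hoelder_ge0 (B n.+1) bf.1 mk f0 (fun x => powR_ge0 _ _) p0 nS0 pq.
apply.
have -> : \int[B n.+1]_x ((k x `^ n.+1%:R^-1) `^ n.+1%:R)%:E = \int[B n.+1]_x (k x)%:E.
  by apply: eq_integral => x _; rewrite -powRrM mulVf ?gt_eqF// powRr1.
apply: lee_wpmul2r; first exact: poweR_ge0.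
rewrite -[leRHS](poweRe1 I0) -[X in _ <= _ `^ X](mulfV (negbT (gt_eqF p0))).
rewrite poweRrM; apply: gt0_ler_poweR.
- by rewrite invr_ge0 ltW.
- by rewrite in_itv/= leey andbT; apply: integral_ge0 => x _; rewrite lee_fin powR_ge0.
- by rewrite in_itv/= leey andbT poweR_ge0.
exact: (sobolev_step n0 W bf f0 bg g0 fg).
Qed.

(** The Gagliardo-Nirenberg inequality for the gradient in [L^1]. Integrating in
    one variable at a time, one only ever needs Hoelder's inequality for two
    functions: the induction carries the inequality with a weight, which is the
    dual form of the inequality itself. *)
Lemma gagliardo_nirenberg n (f g : 'rV[R]_n.+2 -> R) :
  bounded_bsupp f -> (forall x, 0 <= f x)%R ->
  bounded_bsupp g -> (forall x, 0 <= g x)%R -> line_bounded f g ->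
  \int[B n.+2]_x (f x `^ (1 + n.+1%:R^-1))%:E <=
    (\int[B n.+2]_x (g x)%:E) `^ (1 + n.+1%:R^-1).
Proof.
apply: sobolev_step => //; elim: n {f g} => [|n IH]; first exact: weighted1.
exact: weighted_succ.
Qed.

End lines.

(** * Lebesgue measure and test functions *)

Section completion.
Context {R : realType} (n : nat).
Local Open Scope ereal_scope.
Local Notation B := (borel_lebesgue R n).
Local Notation L := (lebesgue_space R n).
Local Notation mu := (@lebesgue R n).

Lemma borel_measurable_lebesgue (A : set 'rV[R]_n) :
  measurable A -> measurable (A : set L).
Proof. by move=> mA; exact: caratheodory_measurable_mu_ext. Qed.

Lemma lebesgue_borelE (A : set 'rV[R]_n) : measurable A -> mu A = B A.
Proof. by move=> mA; rewrite /lebesgue /completed_measure_extension measurable_mu_extE. Qed.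

(** The identity transports integrals of Borel functions between Lebesgue measure
    and the product measure: its image measure is the latter. *)
Lemma measurable_id_lebesgue : measurable_fun [set: L] (id : L -> 'rV[R]_n).
Proof. by move=> _ A mA; rewrite setTI; exact: borel_measurable_lebesgue. Qed.

Lemma borel_fun_lebesgue d (T : measurableType d) (f : 'rV[R]_n -> T) :
  measurable_fun setT f -> measurable_fun [set: L] (f : L -> T).
Proof. by move=> mf; exact: (measurableT_comp mf measurable_id_lebesgue). Qed.

Lemma continuous_lebesgue (f : 'rV[R]_n -> R) :
  continuous f -> measurable_fun [set: L] (f : L -> R).
Proof. by move=> cf; apply: borel_fun_lebesgue; exact: continuous_measurable_rV. Qed.

Let pm : {measure set 'rV[R]_n -> \bar R} :=
  measure_function_pushforward__canonical__measure_function_Measure mu measurable_id_lebesgue.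

Lemma ge0_integral_lebesgueE (f : 'rV[R]_n -> \bar R) :
  measurable_fun setT f -> (forall x, 0 <= f x) ->
  \int[mu]_x f x = \int[B]_x f x.
Proof.
move=> mf f0.
have := @ge0_integral_pushforward _ _ _ _ _ _ measurable_id_lebesgue mu _ f measurableT mf
  (fun x _ => f0 x).
rewrite preimage_setT => E; apply: (eq_trans (esym E)).
apply: (@eq_measure_integral _ _ _ setT B pm f) => A mA _; exact: (lebesgue_borelE mA).
Qed.

Lemma integral_lebesgueE (f : 'rV[R]_n -> R) : measurable_fun setT f ->
  B.-integrable setT (EFin \o f) ->
  mu.-integrable setT (EFin \o f) /\ \int[mu]_x (f x)%:E = \int[B]_x (f x)%:E.
Proof.
move=> mf If.
have mfE : measurable_fun setT (EFin \o f) by exact/measurable_EFinP.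
have If' : mu.-integrable setT (EFin \o f).
  apply/integrableP; split.
    by apply/measurable_EFinP; exact: borel_fun_lebesgue.
  move/integrableP : If => [_]; apply: le_lt_trans.
  rewrite (@ge0_integral_lebesgueE (fun x => `|(EFin \o f) x|))//.
  exact: measurableT_comp.
split => //.
have := @integral_pushforward _ _ _ _ _ _ measurable_id_lebesgue mu setT (EFin \o f) mfE If' measurableT.
rewrite preimage_setT => E; apply: (eq_trans (esym E)).
apply: (@eq_measure_integral _ _ _ setT B pm (EFin \o f)) => A mA _.
exact: (lebesgue_borelE mA).
Qed.

End completion.

Section test_functions.
Context {R : realType} {n : nat}.
Implicit Types (psi eta f : 'rV[R]_n -> R) (Omega : set 'rV[R]_n).

Local Notation supp f := (closure [set x | f x != 0]).

Lemma supp_out f x : ~ supp f x -> \forall y \near x, f y = 0.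
Proof.
move=> /= nx; have : open (~` supp f) by apply: closed_openC; exact: closed_closure.
move=> oS; have : nbhs x (~` supp f) by apply: open_nbhs_nbhs; split.
apply: filterS => y ny; apply/eqP/negPn/negP => fy; apply: ny.
exact: subset_closure.
Qed.

(** A smooth function is a test function as soon as it vanishes away from the
    support of one. *)
Lemma test_functionS Omega psi f : test_function Omega psi -> smooth f ->
  (forall x, f x != 0 -> supp psi x) -> test_function Omega f.
Proof.
move=> [_ cK KO] sf Hf.
have HK : supp f `<=` supp psi.
  rewrite [X in _ `<=` X]((closure_id (supp psi)).1 (@closed_closure _ _)).
  exact: closure_subset.
split => //; last exact: subset_trans KO.
by apply: (subclosed_compact _ cK) => //; exact: closed_closure.
Qed.

Lemma partial_out psi i x : ~ supp psi x -> partial i psi x = 0.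
Proof.
move=> /supp_out H; rewrite /partial (@near_eq_derive _ _ _ _ (cst 0))//.
exact: derive_cst.
Qed.

Lemma test_partial Omega psi i : test_function Omega psi ->
  test_function Omega (partial i psi).
Proof.
move=> tpsi; have [sp _ _] := tpsi; apply: (test_functionS tpsi).
  exact: smooth_partial.
by move=> x; apply: contraPP => /(partial_out i) ->; rewrite eqxx.
Qed.

Lemma test_comp Omega (G : R -> R) psi : smooth1 G -> G 0 = 0 ->
  test_function Omega psi -> test_function Omega (G \o psi).
Proof.
move=> sG G0 tpsi; have [sp _ _] := tpsi; apply: (test_functionS tpsi).
  exact: smooth_comp.
move=> x; apply: contraPP => /supp_out /nbhs_singleton /= ->.
by rewrite G0 eqxx.
Qed.

Lemma testM Omega f psi : smooth f -> test_function Omega psi ->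
  test_function Omega (f \* psi).
Proof.
move=> sf tpsi; have [sp _ _] := tpsi; apply: (test_functionS tpsi).
  exact: smoothM.
move=> x; apply: contraPP => /supp_out /nbhs_singleton /= ->.
by rewrite mulr0 eqxx.
Qed.

Lemma test_bounded_bsupp Omega psi : test_function Omega psi -> bounded_bsupp psi.
Proof.
move=> [sp cK _]; have cp := smooth_continuous sp.
split; first exact: continuous_measurable_rV.
have [M1 [_ HM1]] := compact_bounded cK.
have cI : compact (psi @` supp psi).
  by apply: continuous_compact => //; apply: continuous_subspaceT.
have [M2 [_ HM2]] := compact_bounded cI.
pose M := Num.max (`|M1| + 1) (`|M2| + 1).
have M0 : 0 <= M by rewrite le_max addr_ge0.
exists M => x; split.
  have [->|px] := eqVneq (psi x) 0; first by rewrite normr0.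
  apply: (HM2 M).
    by rewrite lt_max (ltr_pwDr _ (ler_norm M2))// orbT.
  by exists x => //; exact: subset_closure.
move=> px i; have M1M : M1 < M by rewrite lt_max (ltr_pwDr _ (ler_norm M1)).
have H : `|x| <= M := HM1 M M1M x (@subset_closure _ [set x | psi x != 0] x px).
apply: le_trans H; rewrite [leRHS]/Num.norm /= mx_normrE.
by apply/bigmax_geP; right => /=; exists (ord0, i).
Qed.

End test_functions.

(** * Integrals of derivatives along lines *)

Section power.
Context {R : realType}.
Implicit Types (p y : R).

(** The derivative of [y |-> |y|^p]. *)
Definition dpower p y : R := p * `|y| `^ (p - 1) * Num.sg y.

Lemma norm_dpower_le p y : 1 <= p -> `|dpower p y| <= p * `|y| `^ (p - 1).
Proof.
move=> p1; have p0 : 0 <= p by exact: le_trans p1.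
rewrite /dpower normrM ger0_norm ?mulr_ge0 ?powR_ge0// ler_piMr ?mulr_ge0 ?powR_ge0//.
by rewrite normr_sg; case: (y != 0).
Qed.

Lemma is_derive_power p y : 1 < p ->
  is_derive y (1 : R) (fun y : R => `|y| `^ p) (dpower p y).
Proof.
move=> p1; rewrite /dpower; have [y0|y0|->] := ltgtP y 0.
- rewrite ltr0_sg// mulrN1 ltr0_norm//.
  apply: (@near_eq_is_derive _ _ _ (fun z : R => (- z) `^ p)).
    by near=> z; rewrite ltr0_norm//; near: z; exact: lt_nbhsl.
  have D1 : is_derive y (1 : R) (fun z : R => - z) (- 1) by apply: is_derive_eq.
  have yN : 0 < - y by rewrite oppr_gt0.
  have := @is_derive1_comp _ (@powR R ^~ p) (fun z : R => - z) y _ _ (is_derive1_powR p yN) D1.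
  by rewrite mulrN1.
- rewrite gtr0_sg// mulr1 gtr0_norm//.
  apply: (@near_eq_is_derive _ _ _ (fun z : R => z `^ p)).
    by near=> z; rewrite gtr0_norm//; near: z; exact: lt_nbhsr.
  exact: is_derive1_powR.
- rewrite sgr0 mulr0; apply: (@is_derive_0_superlinear _ _ (p - 1) 1) => //.
    by rewrite subr_gt0.
  by move=> t _; rewrite ger0_norm ?powR_ge0// mul1r addrCA subrr addr0.
Unshelve. all: by end_near. Qed.

Let near_eq_continuous (f g : R -> R) y d : (\forall z \near y, g z = f z) ->
  is_derive y (1 : R) g d -> {for y, continuous f}.
Proof.
move=> gf Dg; apply/differentiable_continuous/derivable1_diffP.
exact: (near_eq_derivable gf (@ex_derive _ _ _ _ _ _ _ Dg)).
Qed.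

Lemma continuous_dpower p : 1 < p -> continuous (dpower p).
Proof.
move=> p1 y; have p0 : 0 < p - 1 by rewrite subr_gt0.
have [y0|y0|->] := ltgtP y 0.
- have yN : 0 < - y by rewrite oppr_gt0.
  have D1 : is_derive y (1 : R) (fun z : R => - z) (- 1) by apply: is_derive_eq.
  have D := @is_derive1_comp _ (@powR R ^~ (p - 1)) (fun z : R => - z) y _ _
    (is_derive1_powR (p - 1) yN) D1.
  apply: (near_eq_continuous _ (is_deriveZ (- p) D)); near=> z.
  have z0 : z < 0 by near: z; exact: lt_nbhsl.
  by rewrite /dpower ltr0_sg// ltr0_norm//= mulrN1 -mulNr.
- apply: (near_eq_continuous _ (is_deriveZ p (is_derive1_powR (p - 1) y0))); near=> z.
  have z0 : 0 < z by near: z; exact: lt_nbhsr.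
  by rewrite /dpower gtr0_sg// gtr0_norm//= mulr1.
- apply/cvgrPdist_le => e e0 /=.
  rewrite /dpower normr0 sgr0 mulr0; near=> z; rewrite sub0r normrN.
  apply: (le_trans (norm_dpower_le _ (ltW p1))).
  by near: z; apply: powR_near0 => //; exact: le_trans (ltW p1).
Unshelve. all: by end_near. Qed.

End power.

Section line_integrals.
Context {R : realType}.
Local Notation leb := (@lebesgue_measure R).
Variables (h h' : R -> R) (M : R).
Hypothesis dh : forall t : R, is_derive t (1 : R) h (h' t).
Hypothesis ch' : continuous h'.
Hypothesis supp_h : forall t, h t != 0 -> `|t| <= M.
Hypothesis supp_h' : forall t, h' t != 0 -> `|t| <= M.

Let FTC a b : a < b -> (\int[leb]_(t in `[a, b]) (h' t)%:E = (h b)%:E - (h a)%:E)%E.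
Proof.
move=> ab.
have ch : continuous h.
  by apply: derivable_continuous => t; exact: (@ex_derive _ _ _ _ _ _ _ (dh t)).
apply: continuous_FTC2 => //.
- exact: continuous_subspaceT.
- split.
  + by move=> t _; exact: (@ex_derive _ _ _ _ _ _ _ (dh t)).
  + by apply: cvg_at_right_filter; exact: ch.
  + by apply: cvg_at_left_filter; exact: ch.
- by move=> t _; rewrite derive1E; exact: (@derive_val _ _ _ _ _ _ _ (dh t)).
Qed.

Let hout t : M < `|t| -> h t = 0.
Proof. by move=> Mt; apply/eqP/negPn/negP => /supp_h; rewrite leNgt Mt. Qed.

Let mh' : measurable_fun setT h'.
Proof. exact: continuous_measurable_fun. Qed.

Lemma integral_derivative_compact_supp : (\int[leb]_t (h' t)%:E = 0)%E.
Proof.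
pose K : R := `|M| + 1.
have MK : M < K by rewrite (le_lt_trans (ler_norm M))// ltrDl.
have K0 : 0 < K by rewrite ltr_wpDl.
rewrite (_ : (\int[leb]_t _ = \int[leb]_(t in `[(- K)%R, K%R]) (h' t)%:E)%E).
  by rewrite FTC ?gtrN// !hout ?normrN ?gtr0_norm// subee.
rewrite [RHS]integral_mkcond; apply: eq_integral => t _; rewrite patchE.
case: ifPn => //; rewrite notin_setE /= in_itv/= -ler_norml => tK.
have [->//|/supp_h' tM] := eqVneq (h' t) 0.
by exfalso; apply: tK; rewrite (le_trans tM)// ltW.
Qed.

Lemma norm_le_integral_derivative t : ((`|h t|)%:E <= \int[leb]_s (`|h' s|)%:E)%E.
Proof.
pose K : R := `|M| + 1.
have MK : M < K by rewrite (le_lt_trans (ler_norm M))// ltrDl.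
have K0 : 0 < K by rewrite ltr_wpDl.
have [->|/supp_h tM] := eqVneq (h t) 0.
  by rewrite normr0; apply: integral_ge0 => s _; rewrite lee_fin.
have Kt : - K < t.
  by have := le_lt_trans tM MK; rewrite ltr_norml => /andP[].
have hK : h (- K) = 0 by rewrite hout// normrN gtr0_norm.
have mf : measurable_fun setT (fun s => (h' s)%:E) by exact/measurable_EFinP.
have := FTC Kt; rewrite hK sube0 => E.
rewrite -abse_EFin -E; apply: (le_trans (le_abse_integral _ _ _)) => //.
  exact: measurable_funTS.
apply: ge0_subset_integral => //.
by apply: measurableT_comp.
Qed.

End line_integrals.

Section sobolev.
Context {R : realType} {n : nat}.
Local Notation leb := (@lebesgue_measure R).
Implicit Types (psi : 'rV[R]_n -> R).

Lemma set_coordE (x : 'rV[R]_n) i t :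
  set_coord x i t = t *: delta_mx ord0 i + set_coord x i 0.
Proof.
apply/rowP => j; rewrite !mxE eqxx /=; have [_|_] := eqVneq j i.
  by rewrite mulr1 addr0.
by rewrite mulr0 add0r.
Qed.

Lemma set_coord_id (x : 'rV[R]_n) i : set_coord x i (x ord0 i) = x.
Proof. by apply/rowP => j; rewrite mxE; have [->|] := eqVneq j i. Qed.

Lemma continuous_set_coord psi x i : continuous psi -> continuous (fun t => psi (set_coord x i t)).
Proof.
move=> cp; rewrite (_ : (fun t => _) = (fun t => psi (t *: delta_mx ord0 i + set_coord x i 0))).
  exact: continuous_line.
by apply/funext => t; rewrite -set_coordE.
Qed.

Lemma is_derive_set_coord psi x i t d : is_derive (set_coord x i t) (delta_mx ord0 i) psi d ->
  is_derive t (1 : R) (fun t => psi (set_coord x i t)) d.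
Proof.
rewrite (_ : (fun t => _) = (fun t => psi (t *: delta_mx ord0 i + set_coord x i 0))).
  by rewrite set_coordE; exact: is_derive_line.
by apply/funext => s; rewrite -set_coordE.
Qed.

(** The integral of the derivative vanishes on each line in the direction [i]. *)
Lemma test_integral_partial0 Omega psi i : test_function Omega psi ->
  (\int[borel_lebesgue R n]_x (partial i psi x)%:E = 0)%E.
Proof.
move=> tpsi; have [sp _ _] := tpsi.
have [_ [M HM]] := test_bounded_bsupp tpsi.
have [_ [M' HM']] := test_bounded_bsupp (test_partial i tpsi).
apply: (integral_lines_eq0 (i := i)); first exact: test_bounded_bsupp (test_partial i tpsi).
move=> x.
have S (f : 'rV[R]_n -> R) K : (forall y, f y != 0 -> cube n K y) -> forall t,
    f (set_coord x i t) != 0 -> `|t| <= K.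
  by move=> H t /H /(_ i); rewrite mxE eqxx.
apply: (@integral_derivative_compact_supp _ (fun t => psi (set_coord x i t)) _ (Num.max M M')).
- by move=> t; apply: is_derive_set_coord; exact: smooth_is_derive.
- by apply: continuous_set_coord; apply: smooth_continuous; exact: smooth_partial.
- by move=> t H; rewrite le_max (S _ _ (fun y => (HM y).2))//.
- by move=> t H; rewrite le_max (S _ _ (fun y => (HM' y).2))// orbT.
Qed.

End sobolev.

(** * The Sobolev inequality for test functions *)

Lemma ler_powR2 (R : realType) (r x y : R) : 0 <= r -> 0 <= x -> x <= y -> x `^ r <= y `^ r.
Proof.
move=> r0 x0 xy; apply: (ge0_ler_powR r0 _ _ xy); rewrite nnegrE//.
exact: le_trans xy.
Qed.

Section bounded_bsupp_closure.
Context {R : realType} {n : nat}.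
Implicit Types (f k : 'rV[R]_n -> R).

Lemma cube_le (M M' : R) (x : 'rV[R]_n) : M <= M' -> cube n M x -> cube n M' x.
Proof. by move=> MM' H i; exact: le_trans (H i) MM'. Qed.

Lemma bounded_bsuppM k f C : measurable_fun setT k -> (forall x, `|k x| <= C) ->
  bounded_bsupp f -> bounded_bsupp (fun x => k x * f x).
Proof.
move=> mk kC [mf [M HM]]; split; first exact: measurable_funM.
exists (Num.max M (C * M)) => x; split.
  by rewrite le_max normrM ler_pM ?orbT//; exact: (HM x).1.
move=> /eqP kf; apply: (@cube_le M); first by rewrite le_max lexx.
by apply: (HM x).2; apply/eqP => f0; apply: kf; rewrite f0 mulr0.
Qed.

Lemma bounded_bsuppD f k : bounded_bsupp f -> bounded_bsupp k ->
  bounded_bsupp (fun x => f x + k x).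
Proof.
move=> [mf [M HM]] [mk [C HC]]; split; first exact: measurable_funD.
exists (`|M| + `|C|) => x; split.
  apply: (le_trans (ler_normD _ _)); apply: lerD; apply: le_trans (ler_norm _).
    exact: (HM x).1.
  exact: (HC x).1.
have [f0|f0] := eqVneq (f x) 0.
  rewrite f0 add0r => /((HC x).2); apply: cube_le.
  by apply: (le_trans (ler_norm _)); rewrite lerDr.
move=> _; move: f0 => /((HM x).2); apply: cube_le.
by apply: (le_trans (ler_norm _)); rewrite lerDl.
Qed.

Lemma bounded_bsupp0 : bounded_bsupp (fun _ : 'rV[R]_n => 0).
Proof. by split => //; exists 0 => x; rewrite normr0 eqxx. Qed.

Lemma bounded_bsupp_sum (I : Type) (r : seq I) (F : I -> 'rV[R]_n -> R) :
  (forall i, bounded_bsupp (F i)) -> bounded_bsupp (fun x => \sum_(i <- r) F i x).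
Proof.
move=> HF; elim: r => [|i r IH].
  by under eq_fun do rewrite big_nil; exact: bounded_bsupp0.
by under eq_fun do rewrite big_cons; exact: bounded_bsuppD.
Qed.

Lemma bounded_bsupp_norm f : bounded_bsupp f -> bounded_bsupp (fun x => `|f x|).
Proof.
move=> [mf [M HM]]; split; first exact: measurableT_comp.
by exists M => x; rewrite normr_id normr_eq0; exact: HM.
Qed.

Lemma bounded_bsupp_power f p : 1 <= p -> bounded_bsupp f ->
  bounded_bsupp (fun x => `|f x| `^ p).
Proof.
move=> p1 bf; have [mf [M HM]] := bf.
have p0 : 0 < p by exact: lt_le_trans p1.
rewrite (_ : (fun x => _) = (fun x => `|f x| `^ (p - 1) * `|f x|)); last first.
  by apply/funext => x; rewrite mulrC mulr_powRB1.
apply: (@bounded_bsuppM _ _ (M `^ (p - 1))); last exact: bounded_bsupp_norm.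
  by apply: (measurableT_comp (measurable_powR _)); exact: measurableT_comp.
move=> x; rewrite ger0_norm ?powR_ge0//; apply: ler_powR2; rewrite ?subr_ge0//.
exact: (HM x).1.
Qed.

End bounded_bsupp_closure.

(** If the power [p] is chosen so that Hoelder's inequality gives the same
    integral on both sides, the inequality for the exponent [1] yields the one
    for the exponent [a]. *)
Section from_exponent_one.
Context d (T : measurableType d) (R : realType) (mu : {measure set T -> \bar R}) (n : nat).
Local Notation N := n.+2.
Variables (a : R) (P G : T -> R).
Hypothesis aN : 1 <= a < N%:R.
Let p := a * n.+1%:R / (N%:R - a).
Let q := 1 + n.+1%:R^-1 : R.
Let as_ := sobolev_exponent N a.
Hypothesis (mP : measurable_fun setT P) (mG : measurable_fun setT G).
Hypothesis (G0 : forall x, 0 <= G x).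
Let Je := (\int[mu]_x (P x `^ as_)%:E)%E.
Let Ee := (\int[mu]_x (G x `^ a)%:E)%E.
Hypothesis (Jfin : Je \is a fin_num) (Efin : Ee \is a fin_num).

Let a1 : 1 <= a. Proof. by case/andP: aN. Qed.
Let a0 : 0 < a. Proof. exact: lt_le_trans a1. Qed.
Let Na0 : 0 < N%:R - a. Proof. by rewrite subr_gt0; case/andP: aN. Qed.
Let NE : N%:R = n.+1%:R + 1 :> R. Proof. by rewrite natr1. Qed.
Let n0 : 0 < n.+1%:R :> R. Proof. by rewrite ltr0n. Qed.
Let q0 : 0 < q. Proof. by rewrite addr_gt0// invr_gt0. Qed.
Let nn1 : 1 + n%:R != 0 :> R. Proof. by rewrite nat1r. Qed.
Let Nn1 : 1 + n%:R + 1 - a != 0.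
Proof. by rewrite nat1r natr1 gt_eqF. Qed.
Let as0 : 0 < as_. Proof. by rewrite divr_gt0// mulr_gt0// ltr0n. Qed.

Lemma sobolev_power_ge1 : 1 <= p.
Proof. by rewrite ler_pdivlMr// mul1r lerBlDr NE; move: a1 n0; nra. Qed.

Lemma sobolev_powerE : p * q = as_.
Proof. by rewrite /p /q /as_ /sobolev_exponent NE; field; rewrite Nn1 nn1. Qed.

Let p1 := sobolev_power_ge1.
Let p0 : 0 < p. Proof. exact: lt_le_trans p1. Qed.

Hypothesis GN : (Je <= (\int[mu]_x (p * P x `^ (p - 1) * G x)%:E) `^ q)%E.

Let J0 : 0 <= fine Je.
Proof. by apply: fine_ge0; apply: integral_ge0 => x _; rewrite lee_fin powR_ge0. Qed.
Let E0 : 0 <= fine Ee.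
Proof. by apply: fine_ge0; apply: integral_ge0 => x _; rewrite lee_fin powR_ge0. Qed.

Let mpp : measurable_fun setT (fun x => P x `^ (p - 1)).
Proof. exact: (measurableT_comp (measurable_powR _)). Qed.

Let hoelder_step : (\int[mu]_x (P x `^ (p - 1) * G x)%:E <=
    (fine Je `^ (1 - a^-1) * fine Ee `^ a^-1)%:E)%E.
Proof.
have := a1; rewrite le_eqVlt => /predU1P[aE|a1'].
  have -> : p - 1 = 0 by rewrite /p -aE NE mul1r addrK mulfV ?subrr.
  have -> : fine Je `^ (1 - a^-1) * fine Ee `^ a^-1 = fine Ee.
    by move: E0; move: (fine Ee) => E posE; rewrite -aE invr1 subrr powRr0 mul1r powRr1.
  rewrite (fineK Efin); apply: ge0_le_integral => //.
  - by move=> x _; rewrite lee_fin mulr_ge0// powR_ge0.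
  - by apply/measurable_EFinP; apply: measurable_funM => //;
       apply: (measurableT_comp (measurable_powR _)).
  - by apply/measurable_EFinP; apply: (measurableT_comp (measurable_powR _)).
  - by move=> x _; rewrite powRr0 mul1r -aE powRr1.
have am0 : 0 < a - 1 by rewrite subr_gt0.
have an : a != 0 by rewrite gt_eqF.
have am : a - 1 != 0 by rewrite gt_eqF.
have b0 : 0 < a / (a - 1) by rewrite divr_gt0.
have conj : (a / (a - 1))^-1 + a^-1 = 1 by field; rewrite an am.
have := hoelder_ge0 mu mpp mG (fun x => powR_ge0 _ _) G0 b0 a0 conj.
move=> /le_trans; apply.
rewrite (_ : (\int[mu]_x ((P x `^ (p - 1)) `^ (a / (a - 1)))%:E)%E = Je); last first.
  apply: eq_integral => x _; rewrite -powRrM; congr (_ `^ _)%:E.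
  by rewrite /p /as_ /sobolev_exponent NE; field; rewrite am Nn1.
rewrite -/Ee; have := fineK Jfin; have := fineK Efin.
case: Ee => // E _; case: Je => // J _; rewrite !poweR_EFin -EFinM lee_fin /=.
by rewrite (_ : (a / (a - 1))^-1 = 1 - a^-1)//; field; rewrite an am.
Qed.

Let power_step : fine Je <= (p * (fine Je `^ (1 - a^-1) * fine Ee `^ a^-1)) `^ q.
Proof.
rewrite -lee_fin (fineK Jfin) -poweR_EFin; apply: (le_trans GN).
apply: gt0_ler_poweR; first exact: ltW.
- by rewrite in_itv/= leey andbT; apply: integral_ge0 => x _;
    rewrite lee_fin (mulr_ge0 (mulr_ge0 (ltW p0) (powR_ge0 _ _)) (G0 x)).
- rewrite in_itv/= leey andbT lee_fin.
  exact: (mulr_ge0 (ltW p0) (mulr_ge0 (powR_ge0 _ _) (powR_ge0 _ _))).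
under eq_integral do rewrite -mulrA EFinM.
rewrite ge0_integralZl//.
- by rewrite [leRHS]EFinM lee_wpmul2l// lee_fin ltW.
- by apply/measurable_EFinP; apply: measurable_funM.
- by move=> x _; rewrite lee_fin mulr_ge0// powR_ge0.
- by rewrite lee_fin ltW.
Qed.

Let solve_power (J E : R) : 0 <= J -> 0 <= E ->
  J <= (p * (J `^ (1 - a^-1) * E `^ a^-1)) `^ q -> J <= (p `^ a * E) `^ (as_ / a).
Proof.
rewrite le_eqVlt => /predU1P[<- _ _|posJ posE H]; first exact: powR_ge0.
have JaE : 0 <= J `^ (1 - a^-1) * E `^ a^-1 := mulr_ge0 (powR_ge0 _ _) (powR_ge0 _ _).
have K0 := mulr_ge0 (ltW p0) JaE.
have an : a != 0 by rewrite gt_eqF.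
have qn : q != 0 by rewrite gt_eqF.
have asn : as_ != 0 by rewrite gt_eqF.
have step1 : J `^ q^-1 <= p * (J `^ (1 - a^-1) * E `^ a^-1).
  move: H K0; move: (p * _) => K H K0.
  have -> : K = (K `^ q) `^ q^-1 by rewrite -powRrM (mulfV qn) powRr1.
  have qV0 : 0 <= q^-1 by rewrite invr_ge0 (ltW q0).
  exact: (ler_powR2 qV0 (ltW posJ) H).
have step2 : J `^ (as_^-1) <= p * E `^ a^-1.
  have -> : as_^-1 = q^-1 - (1 - a^-1).
    rewrite /as_ /q /sobolev_exponent NE; field.
    by rewrite an nn1 Nn1 nat1r natr1 pnatr_eq0.
  rewrite powRB ?(gt_eqF posJ) ?implybT// ler_pdivrMr ?powR_gt0//.
  by rewrite -mulrA [E `^ _ * _]mulrC.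
have -> : p `^ a * E = (p * E `^ a^-1) `^ a.
  by rewrite powRM ?powR_ge0 ?(ltW p0)// -powRrM mulVf// powRr1.
rewrite -powRrM mulrCA mulfV// mulr1.
have -> : J = (J `^ as_^-1) `^ as_ by rewrite -powRrM (mulVf asn) (powRr1 (ltW posJ)).
exact: (ler_powR2 (ltW as0) (powR_ge0 _ _) step2).
Qed.

Lemma sobolev_from_exponent_one : (Je <= ((p `^ a)%:E * Ee) `^ (as_ / a))%E.
Proof.
have := solve_power J0 E0 power_step; have := fineK Jfin; have := fineK Efin.
by case: Ee => // E _; case: Je => // J _; rewrite -EFinM poweR_EFin lee_fin.
Qed.

End from_exponent_one.

Section sobolev_inequality.
Context {R : realType} {n : nat}.
Local Notation N := n.+2.
Local Notation leb := (@lebesgue_measure R).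
Local Notation mu := (@lebesgue R N).
Variable Omega : set 'rV[R]_N.
Implicit Types (psi : 'rV[R]_N -> R).

Definition gradient_l1 psi x : R := \sum_(i < N) `|partial i psi x|.

Lemma bounded_bsupp_gradient psi : test_function Omega psi ->
  bounded_bsupp (gradient_l1 psi).
Proof.
move=> tpsi; apply: bounded_bsupp_sum => i; apply: bounded_bsupp_norm.
exact: test_bounded_bsupp (test_partial i tpsi).
Qed.

(** The Gagliardo-Nirenberg inequality for [|psi|^p]: on each line, [|psi|^p] is
    bounded by the integral of the modulus of its derivative. *)
Lemma sobolev_power1 (p : R) psi : 1 <= p -> test_function Omega psi ->
  (\int[mu]_x (`|psi x| `^ (p * (1 + n.+1%:R^-1)))%:E <=
    (\int[mu]_x (p * `|psi x| `^ (p - 1) * gradient_l1 psi x)%:E) `^ (1 + n.+1%:R^-1))%E.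
Proof.
move=> p1 tpsi; have [sp _ _] := tpsi; have cp := smooth_continuous sp.
have p0 : 0 < p by exact: lt_le_trans p1.
have bpsi := test_bounded_bsupp tpsi; have [mpsi [M HM]] := bpsi.
pose g x := p * `|psi x| `^ (p - 1) * gradient_l1 psi x.
have bf : bounded_bsupp (fun x => `|psi x| `^ p) by exact: bounded_bsupp_power.
have G0 x : 0 <= gradient_l1 psi x by apply: sumr_ge0.
have bg : bounded_bsupp g.
  apply: (@bounded_bsuppM _ _ _ _ (p * M `^ (p - 1))).
  - apply: measurable_funM => //; apply: (measurableT_comp (measurable_powR _)).
    exact: measurableT_comp.
  - move=> x; rewrite ger0_norm ?mulr_ge0 ?powR_ge0 ?(ltW p0)// ler_wpM2l ?(ltW p0)//.
    by apply: ler_powR2; rewrite ?subr_ge0//; exact: (HM x).1.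
  - exact: bounded_bsupp_gradient.
have g0 x : 0 <= g x by rewrite !mulr_ge0 ?powR_ge0 ?(ltW p0).
have H : line_bounded (fun x => `|psi x| `^ p) g.
  move=> x i.
  have mg : measurable_fun setT (fun t : R => (g (set_coord x i t))%:E).
    apply/measurable_EFinP.
    have mc (F : 'rV[R]_N -> R) : continuous F -> measurable_fun setT (fun t : R => F (set_coord x i t)).
      by move=> cF; apply: continuous_measurable_fun; exact: continuous_set_coord.
    apply: measurable_funM.
      apply: measurable_funM => //; apply: (measurableT_comp (measurable_powR _)).
      by apply: measurableT_comp => //; exact: mc.
    rewrite /gradient_l1; apply: measurable_sum => j; apply: measurableT_comp => //; apply: mc.
    exact: smooth_continuous (smooth_partial _ sp).
  have fin (h' : R -> R) : (forall t, `|h' t| <= g (set_coord x i t)) ->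
      measurable_fun setT h' -> ((`|psi x| `^ p)%:E <= \int[leb]_t (`|h' t|)%:E)%E ->
      ((`|psi x| `^ p)%:E <= \int[leb]_t (g (set_coord x i t))%:E)%E.
    move=> h'g mh' /le_trans; apply; apply: ge0_le_integral => //.
      by apply/measurable_EFinP; apply: measurableT_comp.
    by move=> t _; rewrite lee_fin; exact: h'g.
  have S (f : 'rV[R]_N -> R) K : (forall y, f y != 0 -> cube N K y) -> forall t,
      f (set_coord x i t) != 0 -> `|t| <= K.
    by move=> Hf t /Hf /(_ i); rewrite mxE eqxx.
  have gi t : `|partial i psi (set_coord x i t)| <= gradient_l1 psi (set_coord x i t).
    by rewrite /gradient_l1 (bigD1 i)//= lerDl sumr_ge0.
  have cpart : continuous (partial i psi) by exact: smooth_continuous (smooth_partial _ sp).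
  (* [|y|^p] is differentiable at [0] only for [1 < p]. *)
  move: p1; rewrite le_eqVlt => /predU1P[pE|p1].
    apply: (fin (fun t : R => partial i psi (set_coord x i t))) => [t||].
    - by rewrite /g -pE subrr powRr0 mul1r mul1r.
    - by apply: continuous_measurable_fun; exact: continuous_set_coord.
    rewrite -pE powRr1// -{1}(set_coord_id x i).
    apply: (@norm_le_integral_derivative _ (fun t => psi (set_coord x i t)) _ M).
    - by move=> t; apply: is_derive_set_coord; exact: smooth_is_derive.
    - exact: continuous_set_coord.
    - by move=> t Ht; exact: (S _ _ (fun y => (HM y).2)).
  pose h' t := dpower p (psi (set_coord x i t)) * partial i psi (set_coord x i t).
  have ch' : continuous h'.
    move=> t; apply: cvgM; last exact: continuous_set_coord.
    apply: (@continuous_comp _ _ _ (fun t => psi (set_coord x i t))).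
      exact: continuous_set_coord.
    exact: continuous_dpower.
  apply: (fin h') => [t||].
  - by rewrite normrM /g ler_pM// norm_dpower_le// ltW.
  - exact: continuous_measurable_fun.
  rewrite -{1}(set_coord_id x i) -[X in X%:E]ger0_norm ?powR_ge0//.
  apply: (@norm_le_integral_derivative _ (fun t => `|psi (set_coord x i t)| `^ p) _ M).
  - move=> t; apply: (@is_derive_set_coord _ _ ((fun y : R => `|y| `^ p) \o psi)).
    apply: is_derive_comp_dir; last exact: smooth_is_derive.
    exact: is_derive_power.
  - exact: ch'.
  - move=> t; rewrite powR_eq0 (gt_eqF p0) andbT normr_eq0 => Ht.
    exact: (S _ _ (fun y => (HM y).2)).
have := gagliardo_nirenberg bf (fun x => powR_ge0 _ _) bg g0 H.
rewrite (@ge0_integral_lebesgueE _ _ (fun x => (`|psi x| `^ (p * (1 + n.+1%:R^-1)))%:E)).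
- rewrite (@ge0_integral_lebesgueE _ _ (fun x => (g x)%:E)).
  + by under eq_integral do rewrite -powRrM.
  + by apply/measurable_EFinP; exact: bg.1.
  + by move=> x; rewrite lee_fin.
- apply/measurable_EFinP; apply: (measurableT_comp (measurable_powR _)).
  exact: measurableT_comp.
- by move=> x; rewrite lee_fin powR_ge0.
Qed.

Let fin_bb (f : 'rV[R]_N -> R) : bounded_bsupp f -> (forall x, 0 <= f x) ->
  (\int[mu]_x (f x)%:E)%E \is a fin_num.
Proof.
move=> bf f0; rewrite (@ge0_integral_lebesgueE _ _ (fun x => (f x)%:E)).
- exact/integrable_fin_num/bounded_bsupp_integrable.
- by apply/measurable_EFinP; exact: bf.1.
- by move=> x; rewrite lee_fin.
Qed.

(** The Gagliardo-Nirenberg-Sobolev inequality for test functions. *)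
Theorem sobolev_inequality (a : R) : 1 <= a < N%:R ->
  exists2 C, 0 <= C & forall psi, test_function Omega psi ->
  (\int[mu]_x (`|psi x| `^ sobolev_exponent N a)%:E <=
    (C%:E * \int[mu]_x (gradient_l1 psi x `^ a)%:E) `^ (sobolev_exponent N a / a))%E.
Proof.
move=> aN; exists ((a * n.+1%:R / (N%:R - a)) `^ a); first exact: powR_ge0.
move=> psi tpsi; have [sp _ _] := tpsi; have cp := smooth_continuous sp.
have bpsi := test_bounded_bsupp tpsi.
have bG := bounded_bsupp_gradient tpsi.
have G0 x : 0 <= gradient_l1 psi x by apply: sumr_ge0.
have as1 : 1 <= sobolev_exponent N a.
  rewrite -sobolev_powerE// -[leLHS]mul1r ler_pM// ?sobolev_power_ge1//.
  by rewrite lerDl invr_ge0 ler0n.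
have mpsi : measurable_fun [set: lebesgue_space R N] psi by exact: borel_fun_lebesgue bpsi.1.
have mnpsi : measurable_fun [set: lebesgue_space R N] (fun x => `|psi x|).
  exact: measurableT_comp.
have mG := borel_fun_lebesgue bG.1.
have Jfin : (\int[mu]_x (`|psi x| `^ sobolev_exponent N a)%:E)%E \is a fin_num.
  by apply: fin_bb => [|x]; [exact: bounded_bsupp_power|exact: powR_ge0].
have Efin : (\int[mu]_x (gradient_l1 psi x `^ a)%:E)%E \is a fin_num.
  apply: fin_bb => [|x]; last exact: powR_ge0.
  have /andP[a1 _] := aN; have := bounded_bsupp_power a1 bG.
  by under eq_fun do rewrite ger0_norm//.
have := sobolev_power1 (sobolev_power_ge1 aN) tpsi.
rewrite (sobolev_powerE aN) => GN.
exact: (sobolev_from_exponent_one aN mnpsi mG G0 Jfin Efin GN).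
Qed.

End sobolev_inequality.

(** * Functions with vanishing integrals over Borel sets *)

Section vanishing_integrals.
Context d (T : measurableType d) (R : realType) (mu : {measure set T -> \bar R}).
Local Open Scope ereal_scope.
Variables (f : T -> \bar R) (G : set (set T)).
Hypothesis fint : mu.-integrable setT f.
Hypotheses (GI : setI_closed G) (Gm : G `<=` measurable).
Hypothesis f0 : \int[mu]_x f x = 0.
Hypothesis fG0 : forall A, G A -> \int[mu]_(x in A) f x = 0.

(** The sets over which [f] has integral [0] form a Dynkin system. *)
Lemma integral_eq0_sigma A : <<s G >> A -> \int[mu]_(x in A) f x = 0.
Proof.
have mf : measurable_fun setT f := measurable_int _ fint.
suff D : dynkin [set A | measurable A /\ \int[mu]_(x in A) f x = 0].
  rewrite -setI_closed_g_dynkin_g_sigma_algebra// => GA.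
  suff : [set A | measurable A /\ \int[mu]_(x in A) f x = 0] A by case.
  apply: GA; split => // B GB; split; [exact: Gm|exact: fG0].
split.
- by split => //; exact: measurableT.
- move=> B [mB fB]; split; first exact: measurableC.
  have := @integral_setU _ _ _ mu B (~` B) f mB (measurableC mB) _ _.
  rewrite setUv f0 fB add0e => <-//.
  by apply/disj_set2P; exact: setICr.
- move=> F tF HF; have mF k := (HF k).1; split; first exact: bigcup_measurable.
  rewrite integral_bigcup//; first by apply: eseries0 => k _ _; exact: (HF k).2.
  by apply: integrableS fint => //; exact: bigcup_measurable.
Qed.

End vanishing_integrals.

Section borel_hull.
Context {R : realType} {n : nat}.
Local Open Scope ereal_scope.
Local Notation L := (lebesgue_space R n).
Local Notation mu := (@lebesgue R n).
Local Notation B := (borel_lebesgue R n).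

(** Completion adds nothing but null sets: coverings by Borel sets that compute the
    outer measure of [E] intersect to a Borel set of the same measure. *)
Lemma borel_hull (E : set L) : measurable E -> mu E < +oo ->
  exists A : set 'rV[R]_n, [/\ measurable A, E `<=` A & mu (A `\` E) = 0].
Proof.
move=> mE Efin.
have Efn : mu E \is a fin_num by rewrite ge0_fin_numE.
have H k : exists F : (set 'rV[R]_n)^nat, [/\ forall i, measurable (F i), E `<=` \bigcup_i F i &
    \sum_(i <oo) B (F i) < mu E + (k.+1%:R^-1)%:E].
  have e0 : (0 < k.+1%:R^-1 :> R)%R by rewrite invr_gt0 ltr0n.
  have [_ [F [mF EF] <-] HF] := lb_ereal_inf_adherent e0 Efn.
  by exists F; split.
have [F HF] := choice H.
pose A := \bigcap_k \bigcup_i F k i.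
have mFk k : measurable (\bigcup_i F k i : set 'rV[R]_n).
  by apply: bigcup_measurable => i _; have [] := HF k.
have mA : measurable (A : set 'rV[R]_n) by exact: bigcap_measurable.
have EA : E `<=` A by move=> x Ex k _; have [_ + _] := HF k; apply.
have mAL : measurable (A : set L) := borel_measurable_lebesgue mA.
exists A; split => //.
have AE : mu A <= mu E.
  apply/lee_addgt0Pr => e e0.
  have [k ke] : exists k, (k.+1%:R^-1 < e :> R)%R.
    have := near_infty_natSinv_lt (PosNum e0).
    by move=> /(@filter_ex _ _ _)[k /= ?]; exists k.
  have [mFi _ HFk] := HF k.
  apply: (@le_trans _ _ (mu E + (k.+1%:R^-1)%:E)); last by rewrite leeD2l// lee_fin ltW.
  apply: le_trans (ltW HFk).
  apply: (@le_trans _ _ (B (\bigcup_i F k i))).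
    rewrite -(lebesgue_borelE (mFk k)); apply: le_measure; rewrite ?inE//.
      exact: borel_measurable_lebesgue (mFk k).
    by move=> x; apply.
  exact: measure_sigma_subadditive.
have -> : mu (A `\` E) = mu A - mu (A `&` E).
  by apply: measureD => //; exact: le_lt_trans AE Efin.
rewrite (_ : A `&` E = E); last by apply/setIidPr.
apply/eqP; rewrite eq_le sube_le0 AE/= sube_ge0//; last by rewrite Efn.
by apply: le_measure; rewrite ?inE.
Qed.

Let nonpos_ae (f : L -> \bar R) : mu.-integrable setT f ->
  mu [set x | 0 < f x] < +oo ->
  (forall A : set 'rV[R]_n, measurable A -> \int[mu]_(x in (A : set L)) f x = 0) ->
  {ae mu, forall x, f x <= 0}.
Proof.
move=> fint Efin fB; have mf : measurable_fun setT f := measurable_int _ fint.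
set E := [set x | 0 < f x] in Efin.
have mE : measurable E by rewrite -[E]setTI; exact: emeasurable_fun_o_infty.
have [A [mA EA AE0]] := borel_hull mE Efin.
have mAL : measurable (A : set L) := borel_measurable_lebesgue mA.
have mAE : measurable (A `\` E : set L) by exact: measurableD.
have fE0 : \int[mu]_(x in E) f x = 0.
  have fAE0 : \int[mu]_(x in A `\` E) f x = 0.
    by apply: null_set_integral => //; exact: measurable_funTS.
  have mEA : measurable_fun (E `|` A `\` E) f by exact: measurable_funTS.
  have EAE : [disjoint E & A `\` E] by apply/disj_set2P; rewrite setDIK.
  have := integral_setU mu mE mAE mEA EAE.
  by rewrite (setDUK EA) (fB A mA) fAE0 adde0 => <-.
have : \int[mu]_(x in E) `|f x| = 0.
  rewrite -[RHS]fE0; apply: eq_integral => x /set_mem /= fx.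
  by rewrite gee0_abs// ltW.
move=> /ae_eq_integral_abs; move=> /(_ mE (measurable_funTS mf)).
apply: filterS => x H; rewrite leNgt; apply/negP => fx.
by have := H fx => /= fx0; rewrite fx0 ltxx in fx.
Qed.

(** Integrate over a Borel hull of the set where [f] is positive. *)
Lemma borel_integrals_eq0 (f : L -> \bar R) : mu.-integrable setT f ->
  mu [set x | f x != 0] < +oo ->
  (forall A : set 'rV[R]_n, measurable A -> \int[mu]_(x in (A : set L)) f x = 0) ->
  {ae mu, forall x, f x = 0}.
Proof.
move=> fint Efin fB; have mf : measurable_fun setT f := measurable_int _ fint.
have mE : measurable [set x | f x != 0] by rewrite -[X in measurable X]setTI; exact: emeasurable_neq.
have le_fin (E : set L) : measurable E -> E `<=` [set x | f x != 0] -> mu E < +oo.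
  by move=> mE' EE; apply: le_lt_trans Efin; apply: le_measure; rewrite ?inE.
have H1 : {ae mu, forall x, f x <= 0}.
  apply: nonpos_ae => //; apply: le_fin.
    by rewrite -[X in measurable X]setTI; exact: emeasurable_fun_o_infty.
  by move=> x /=; rewrite lt0e => /andP[].
have H2 : {ae mu, forall x, - f x <= 0}.
  apply: nonpos_ae.
  - exact: integrableN.
  - apply: le_fin.
      rewrite (_ : [set x | _] = [set x | f x < 0]).
        by rewrite -[X in measurable X]setTI; exact: emeasurable_fun_infty_o.
      by apply/seteqP; split => x /=; rewrite oppe_gt0.
    by move=> x /=; rewrite oppe_gt0 => /lt_eqF ->.
  - move=> A mA; rewrite integralN ?fB ?oppe0//.
    have fintA : mu.-integrable (A : set L) f.
      by apply: integrableS fint => //; exact: borel_measurable_lebesgue.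
    exact: (integrable_add_def (borel_measurable_lebesgue mA) fintA).
by apply: filterS2 H1 H2 => x; rewrite oppe_le0 => ? ?; apply/eqP; rewrite eq_le; apply/andP.
Qed.

End borel_hull.

(** * Boxes and their smooth approximations *)

Section boxes.
Context {R : realType} {n : nat}.
Local Notation L := (lebesgue_space R n).
Local Notation mu := (@lebesgue R n).
Implicit Types (a b x : 'rV[R]_n).

Definition box a b : set 'rV[R]_n := [set x | forall i, a ord0 i < x ord0 i < b ord0 i].
Definition cbox a b : set 'rV[R]_n := [set x | forall i, a ord0 i <= x ord0 i <= b ord0 i].

Lemma box_cbox a b : box a b `<=` cbox a b.
Proof. by move=> x H i; have /andP[/ltW -> /ltW ->] := H i. Qed.

Lemma compact_cbox a b : compact (cbox a b).
Proof.
rewrite (_ : cbox a b = [set v | forall i, `[a ord0 i, b ord0 i]%classic (v ord0 i)]).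
  apply: (@rV_compact R n (fun i => `[a ord0 i, b ord0 i]%classic)) => i.
  exact: segment_compact.
by apply/seteqP; split => x H i; have := H i; rewrite /= in_itv.
Qed.

Lemma closed_cbox a b : closed (cbox a b).
Proof. exact: (compact_closed (@norm_hausdorff _ _) (@compact_cbox a b)). Qed.

Lemma closed_measurable_rV (A : set 'rV[R]_n) : closed A -> measurable A.
Proof.
by move=> /closed_openC/open_measurable_rV/measurableC; rewrite setCK.
Qed.

Lemma measurable_box a b : measurable (box a b).
Proof.
apply: measurable_fin_forall => i; rewrite -[X in measurable X]setTI.
have := @measurable_coord R n i measurableT `]a ord0 i, b ord0 i[%classic (measurable_itv _).
by congr measurable; apply/seteqP; split => x /= [_]; rewrite in_itv.
Qed.

Lemma boxI a b a' b' : box a b `&` box a' b' =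
  box (\row_i Num.max (a ord0 i) (a' ord0 i)) (\row_i Num.min (b ord0 i) (b' ord0 i)).
Proof.
apply/seteqP; split => x /=.
  move=> [H H'] i; rewrite !mxE gt_max lt_min.
  by have /andP[-> ->] := H i; have /andP[-> ->] := H' i.
move=> H; split=> i; have := H i; rewrite !mxE gt_max lt_min => /andP[/andP[? ?] /andP[? ?]];
  exact/andP.
Qed.

(** A slab [l < x_i < r] is a countable union of boxes. *)
Lemma borel_box_generated (A : set 'rV[R]_n) : measurable A ->
  <<s [set B | exists a b, B = box a b] >> A.
Proof.
set G := [set B | _]; have sG : sigma_algebra setT <<s G>> by exact: smallest_sigma_algebra.
have sU (F : (set 'rV[R]_n)^nat) : (forall k, <<s G>> (F k)) -> <<s G>> (\bigcup_k F k).
  by case: sG => _ _; apply.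
have sC (C : set 'rV[R]_n) : <<s G>> C -> <<s G>> (~` C).
  by case: sG => _ + _ => /(_ C); rewrite setTD.
suff : g_sigma_preimage (fun i (x : 'rV[R]_n) => x ord0 i) `<=` <<s G>> by apply.
apply: smallest_sub => //.
rewrite -bigcup_seq => B [i _ [C mC <-]]; rewrite setTI.
have {mC} : (@RGenOpens.G R).-sigma.-measurable C by rewrite -RGenOpens.measurableE.
pose S := [set C : set R | <<s G>> ((fun x : 'rV[R]_n => x ord0 i) @^-1` C)].
suff : <<s @RGenOpens.G R >> `<=` S by apply.
apply: smallest_sub.
  split; rewrite /S /=.
  - by rewrite preimage_set0; case: sG.
  - by move=> D; rewrite setTD preimage_setC; exact: sC.
  - by move=> F HF; rewrite preimage_bigcup; exact: sU.
move=> _ [l [r ->]]; rewrite /S /=.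
rewrite (_ : _ @^-1` _ = \bigcup_k box (\row_j (if j == i then l else - k%:R))
                                      (\row_j (if j == i then r else k%:R))).
  apply: sU => k; apply: sub_sigma_algebra; by eexists; eexists.
apply/seteqP; split => x /=; last first.
  by move=> [k _ /(_ i)]; rewrite !mxE eqxx in_itv.
rewrite in_itv/= => xi; pose M := \sum_j `|x ord0 j|.
exists (Num.truncn M).+1 => // j; rewrite !mxE; case: eqP => [->//|_].
rewrite -ltr_norml; apply: le_lt_trans (truncnS_gt _).
by rewrite /M (bigD1 j)//= lerDl sumr_ge0.
Qed.

Definition box_fun a b x : R :=
  \prod_(i < n) (flat (x ord0 i - a ord0 i) * flat (b ord0 i - x ord0 i)).

Lemma smooth_box_fun a b : smooth (box_fun a b).
Proof.
move=> k; apply: Ck_prod => i; apply: CkM.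
  apply: (@Ck_comp _ _ k flat (fun x : 'rV[R]_n => x ord0 i - a ord0 i) smooth1_flat).
  by apply: CkD; [exact: Ck_coord|exact: Ck_cst].
apply: (@Ck_comp _ _ k flat (fun x : 'rV[R]_n => b ord0 i - x ord0 i) smooth1_flat).
rewrite (_ : (fun x : 'rV[R]_n => _) = cst (b ord0 i) \+ (cst (-1) \* (fun x : 'rV[R]_n => x ord0 i))).
  by apply: CkD; [exact: Ck_cst|apply: CkM; [exact: Ck_cst|exact: Ck_coord]].
by apply/funext => x; rewrite /= mulN1r.
Qed.

Lemma box_fun_ge0 a b x : 0 <= box_fun a b x.
Proof. by apply: prodr_ge0 => i _; rewrite mulr_ge0// flat_ge0. Qed.

Lemma box_fun_gt0 a b x : (0 < box_fun a b x) <-> box a b x.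
Proof.
split=> [H i|H]; last first.
  apply: prodr_gt0 => i _; have /andP[h1 h2] := H i.
  by rewrite mulr_gt0// flat_gt0 subr_gt0.
move: H; rewrite lt_neqAle box_fun_ge0 andbT eq_sym => /prodf_neq0/(_ i isT).
have pos t : flat t != 0 -> 0 < t.
  by move=> t0; rewrite -flat_gt0 lt_neqAle eq_sym t0 flat_ge0.
by rewrite mulf_eq0 negb_or -(subr_gt0 (a ord0 i)) -(subr_gt0 (x ord0 i)) => /andP[/pos -> /pos ->].
Qed.

(** A sequence of test functions increasing to the indicator of an open box. *)
Definition box_bump a b (k : nat) x : R := 1 - expR (- k%:R * box_fun a b x).

Lemma box_bump_out a b k x : ~ box a b x -> box_bump a b k x = 0.
Proof.
move=> /box_fun_gt0/negP; rewrite -leNgt => H.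
have B0 : box_fun a b x = 0 by apply/eqP; rewrite eq_le H box_fun_ge0.
by rewrite /box_bump B0 mulr0 expR0 subrr.
Qed.

Lemma test_box_bump (Omega : set 'rV[R]_n) a b k : cbox a b `<=` Omega ->
  test_function Omega (box_bump a b k).
Proof.
move=> abO.
have S : closure [set x | box_bump a b k x != 0] `<=` cbox a b.
  rewrite [X in _ `<=` X]((closure_id (cbox a b)).1 (@closed_cbox _ _)).
  apply: closure_subset => x /=; apply: contraPP => H; rewrite box_bump_out ?eqxx//.
  by move=> /box_cbox.
split.
- apply: (@smooth_comp _ _ (fun y => 1 - expR (- k%:R * y))); last exact: smooth_box_fun.
  exact: smooth1_affine_expR.
- by apply: (subclosed_compact _ (@compact_cbox a b)) => //; exact: closed_closure.
- exact: subset_trans abO.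
Qed.

Lemma box_bump_norm a b k x : `|box_bump a b k x| <= 1.
Proof.
have e1 : expR (- k%:R * box_fun a b x) <= 1.
  by rewrite expR_le1 mulNr oppr_le0 mulr_ge0// box_fun_ge0.
rewrite ger0_norm ?subr_ge0// /box_bump gerBl expR_ge0//.
Qed.

Lemma box_bump_cvg a b x :
  box_bump a b k x @[k --> \oo] --> (if `[< box a b x >] then 1 else 0 : R).
Proof.
case: asboolP => [/box_fun_gt0 H|H]; last first.
  by rewrite (_ : (fun k => _) = cst 0); [exact: cvg_cst|apply/funext => k; exact: box_bump_out].
rewrite -[X in _ --> X]subr0; apply: cvgB; first exact: cvg_cst.
rewrite (_ : (fun k => _) = (fun k => (expR (- box_fun a b x)) ^+ k)).
  by apply: cvg_expr; rewrite ger0_norm ?expR_ge0// expR_lt1 oppr_lt0.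
by apply/funext => k; rewrite -expRM_natl mulNr mulrN.
Qed.

End boxes.

(** * Uniqueness of weak derivatives *)

Section weak_derivatives.
Context {R : realType} {n : nat}.
Local Notation L := (lebesgue_space R n).
Local Notation mu := (@lebesgue R n).
Variable Omega : set 'rV[R]_n.
Hypothesis oOmega : open Omega.
Implicit Types (w u psi : 'rV[R]_n -> R).

Let mOmega : measurable (Omega : set L).
Proof. exact: (borel_measurable_lebesgue (open_measurable_rV oOmega)). Qed.

Lemma compact_measurable (K : set 'rV[R]_n) : compact K -> measurable (K : set L).
Proof.
move=> cK; have cl := compact_closed (@norm_hausdorff _ _) cK.
exact: (borel_measurable_lebesgue (closed_measurable_rV cl)).
Qed.

Lemma integrable_mul_bounded (D : set L) w psi : measurable D ->
  mu.-integrable D (EFin \o w) -> measurable_fun D psi ->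
  (exists M, forall x, `|psi x| <= M) ->
  mu.-integrable D (EFin \o (fun x => w x * psi x)).
Proof.
move=> mD iw mpsi [M HM].
have -> : EFin \o (fun x => w x * psi x) = ((EFin \o w) \* (EFin \o psi))%E by [].
apply: integrableMl => //.
exists M; split; first exact: num_real.
by move=> y My x _; rewrite /= (le_trans (HM x))// ltW.
Qed.

Let supp psi := closure [set x | psi x != 0].

Let patch_supp w psi : test_function Omega psi ->
  (EFin \o (fun x => w x * psi x)) \_ Omega = (EFin \o (fun x => w x * psi x)) \_ (supp psi).
Proof.
move=> [_ _ SO]; apply/funext => x; rewrite !patchE.
have [p0|px] := eqVneq (psi x) 0; first by rewrite /= p0 mulr0; do 2 case: ifP.
have Sx : supp psi x by exact: subset_closure.
by rewrite !mem_set//; exact: SO.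
Qed.

Lemma integrable_test w psi : locally_L1 Omega w -> test_function Omega psi ->
  mu.-integrable Omega (EFin \o (fun x => w x * psi x)).
Proof.
move=> lw tpsi; have [sp cK SO] := tpsi.
apply/integrable_mkcond => //; rewrite patch_supp//.
apply/(integrable_mkcond _ (compact_measurable cK)).
apply: integrable_mul_bounded.
- exact: compact_measurable.
- exact: lw.
- by apply: measurable_funTS; apply: continuous_lebesgue; exact: smooth_continuous.
- have [_ [M HM]] := test_bounded_bsupp tpsi.
  by exists M => x; have [] := HM x.
Qed.

Definition annihilates_tests w :=
  forall psi, test_function Omega psi -> \int[mu]_(x in Omega) (w x * psi x) = 0.

(** By dominated convergence along test functions increasing to the indicator of
    the box. *)
Lemma box_integral_eq0 w a b : locally_L1 Omega w -> annihilates_tests w ->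
  cbox a b `<=` Omega -> (\int[mu]_(x in box a b) (w x)%:E = 0)%E.
Proof.
move=> lw Hw abO; pose K : set L := cbox a b.
have mK : measurable K by exact: compact_measurable (@compact_cbox _ _ a b).
have iwK : mu.-integrable K (EFin \o w) by apply: lw => //; exact: compact_cbox.
have mbox : measurable (box a b : set L).
  exact: (borel_measurable_lebesgue (measurable_box a b)).
have Kbump k : (\int[mu]_(x in K) (w x * box_bump a b k x)%:E = 0)%E.
  have := Hw _ (test_box_bump k abO); rewrite /Rintegral.
  have iO := integrable_test lw (test_box_bump k abO).
  have E : (\int[mu]_(x in Omega) (w x * box_bump a b k x)%:E =
      \int[mu]_(x in K) (w x * box_bump a b k x)%:E)%E.
    rewrite integral_mkcond [RHS]integral_mkcond; congr integral.
    apply/funext => x; rewrite !patchE.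
    have [Bx|Bx] := pselect (box a b x); last by rewrite box_bump_out// mulr0; do 2 case: ifP.
    by rewrite !mem_set//; [exact: box_cbox|exact/abO/box_cbox].
  rewrite E => fK0; rewrite -[LHS]fineK ?fK0// -E.
  exact: integrable_fin_num iO.
have mw : measurable_fun K w by apply/measurable_EFinP; exact: measurable_int iwK.
pose ind x : R := if `[< box a b x >] then 1 else 0.
have mwb k : measurable_fun K (fun x : L => (w x * box_bump a b k x)%:E).
  apply/measurable_EFinP; apply: measurable_funM => //; apply: measurable_funTS.
  have [sp _ _] := test_box_bump k abO.
  by apply: continuous_lebesgue; exact: smooth_continuous sp.
have cvgw x : (w x * box_bump a b k x)%:E @[k --> \oo] --> (w x * ind x)%:E.
  apply: cvg_EFin; first by apply: nearW.
  by apply: cvgM; [exact: cvg_cst|exact: box_bump_cvg].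
have mind : measurable_fun K (fun x : L => (w x * ind x)%:E).
  by apply: (@emeasurable_fun_cvg _ _ _ _ _ _ mwb) => x _; exact: cvgw.
have gle x k : (`|(w x * box_bump a b k x)%:E| <= (`|w x|)%:E)%E.
  by rewrite lee_fin normrM ler_piMr// box_bump_norm.
have [_ _] := @dominated_convergence _ _ _ mu K mK _ _ _ mwb mind
  (aeW mu (fun x _ => cvgw x)) (integrable_norm iwK) (aeW mu (fun x k _ => gle x k)).
rewrite (_ : (fun k => _) = cst 0%E); last by apply/funext => k; exact: Kbump.
move=> /cvg_lim - /(_ (@ereal_hausdorff R)); rewrite lim_cst; last exact: ereal_hausdorff.
move=> E; rewrite [RHS]E.
transitivity (\int[mu]_(x in K `&` box a b) (w x)%:E)%E.
  by congr integral; apply/esym/setIidPr; exact: box_cbox.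
rewrite integral_mkcondr; apply: eq_integral => x _; rewrite patchE /ind.
case: ifPn => [/set_mem Bx|]; first by rewrite asboolT// mulr1.
by rewrite notin_setE => Bx; rewrite asboolF// mulr0.
Qed.

Lemma bounded_set_cube (A : set 'rV[R]_n) : bounded_set A ->
  exists M : R, A `<=` cube n M.
Proof.
move=> [M [_ HM]]; exists (`|M| + 1) => x Ax i.
have M1 : M < `|M| + 1 by rewrite (le_lt_trans (ler_norm M))// ltrDl.
have H : `|x| <= `|M| + 1 := HM _ M1 x Ax.
apply: le_trans H; rewrite [leRHS]/Num.norm /= mx_normrE.
by apply/bigmax_geP; right => /=; exists (ord0, i).
Qed.

Lemma bounded_set_lty (A : set 'rV[R]_n) : bounded_set A -> measurable (A : set L) ->
  (mu A < +oo)%E.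
Proof.
move=> /bounded_set_cube[M AM] mA; apply: le_lt_trans (@borel_cube_lty R n M).
rewrite -(lebesgue_borelE (@measurable_cube R n M)); apply: le_measure => //; rewrite inE//.
exact: (borel_measurable_lebesgue (@measurable_cube R n M)).
Qed.

(** Boxes are stable under intersection and generate the Borel sets, so all the
    integrals of [w] over Borel subsets of the box vanish. *)
Lemma box_ae_eq0 w a b : locally_L1 Omega w -> annihilates_tests w ->
  cbox a b `<=` Omega -> {ae mu, forall x : L, box a b x -> w x = 0}.
Proof.
move=> lw Hw abO; pose K : set L := cbox a b.
have mK : measurable K by exact: compact_measurable (@compact_cbox _ _ a b).
have iwK : mu.-integrable K (EFin \o w) by apply: lw => //; exact: compact_cbox.
have mbox c d : measurable (box c d : set L).
  exact: (borel_measurable_lebesgue (measurable_box c d)).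
have bK : box a b `<=` K by exact: box_cbox.
have Koo : (mu K < +oo)%E.
  exact: (bounded_set_lty (compact_bounded (@compact_cbox R n a b)) mK).
pose f : L -> \bar R := (EFin \o w) \_ (box a b).
have fint : mu.-integrable setT f.
  apply/(integrable_mkcond _ (mbox a b)).
  exact: (integrableS mK (mbox a b) bK iwK).
have fbox c d : (\int[mu]_(x in box c d) f x = 0)%E.
  rewrite -integral_mkcondr boxI; apply: box_integral_eq0 => // x H; apply: abO => i.
  by have := H i; rewrite !mxE ge_max le_min => /andP[/andP[_ ->] /andP[_ ->]].
have fT : (\int[mu]_x f x = 0)%E by rewrite -integral_mkcond; exact: box_integral_eq0.
pose G := [set B : set L | exists c d, B = box c d].
have GI : setI_closed G.
  by move=> _ _ [c [d ->]] [c' [d' ->]]; rewrite boxI; eexists; eexists.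
have Gm : G `<=` measurable by move=> _ [c [d ->]]; exact: mbox.
have fG A : G A -> (\int[mu]_(x in A) f x = 0)%E by move=> [c [d ->]]; exact: fbox.
have fB (A : set 'rV[R]_n) : measurable A -> (\int[mu]_(x in (A : set L)) f x = 0)%E.
  move=> /borel_box_generated; exact: (integral_eq0_sigma fint GI Gm fT fG).
have foo : (mu [set x | f x != 0%E] < +oo)%E.
  apply: le_lt_trans Koo; apply: le_measure; rewrite ?inE//.
    rewrite -[X in measurable X]setTI.
    exact: (emeasurable_neq measurableT (measurable_int _ fint)).
  move=> x /=; rewrite /f patchE; case: ifPn => [/set_mem/bK//|]; by rewrite eqxx.
have := borel_integrals_eq0 fint foo fB; apply: filterS => x fx Bx.
by move: fx; rewrite /f patchE mem_set// => -[].
Qed.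

(** The fundamental lemma of the calculus of variations: an open set is covered by
    the countably many boxes with rational vertices whose closure it contains. *)
Theorem annihilates_tests_ae_eq0 w : locally_L1 Omega w -> annihilates_tests w ->
  {ae mu, forall x : L, Omega x -> w x = 0}.
Proof.
move=> lw Hw.
pose rv (q : 'rV[rat]_n) : 'rV[R]_n := \row_i ratr (q ord0 i).
pose P (k : nat) (x : L) := if unpickle k is Some (p, q) then
  cbox (rv p) (rv q) `<=` Omega -> box (rv p) (rv q) x -> w x = 0 else True.
have : {ae mu, forall x k, P k x}.
  apply/ae_foralln => k; rewrite /P; case: unpickle => [[p q]|]; last by apply: aeW.
  have [pqO|pqO] := pselect (cbox (rv p) (rv q) `<=` Omega); last by apply: aeW.
  by have := box_ae_eq0 lw Hw pqO; apply: filterS => x H _.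
move=> H0; apply: filterS H0 => x H Ox.
have /nbhs_ballP[e /= e0 eO] := open_nbhs_nbhs (conj oOmega Ox).
have /choice[p Hp] i : exists q : rat, x ord0 i - e / 2 < ratr q < x ord0 i.
  have /rat_in_itvoo[q] : x ord0 i - e / 2 < x ord0 i by rewrite gtrBl divr_gt0.
  by rewrite in_itv/= => Hq; exists q.
have /choice[q Hq] i : exists q : rat, x ord0 i < ratr q < x ord0 i + e / 2.
  have /rat_in_itvoo[r] : x ord0 i < x ord0 i + e / 2 by rewrite ltrDl divr_gt0.
  by rewrite in_itv/= => Hr; exists r.
have := H (pickle (\row_i p i, \row_i q i)); rewrite /P pickleK; apply.
- move=> y Hy; apply: eO; split => // i j; rewrite (ord1 i) /ball/=.
  have := Hy j; have /andP[p1 p2] := Hp j; have /andP[q1 q2] := Hq j.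
  rewrite !mxE => /andP[y1 y2]; rewrite distrC ltr_distl; apply/andP; split.
    apply: lt_le_trans y1; apply: le_lt_trans p1.
    by rewrite lerD2l lerN2 ler_pdivrMr// ler_peMr ?(ltW e0)// ler1n.
  apply: le_lt_trans y2 _; apply: lt_le_trans q2 _.
  by rewrite lerD2l ler_pdivrMr// ler_peMr ?(ltW e0)// ler1n.
- move=> j; rewrite !mxE; have /andP[p1 p2] := Hp j; have /andP[q1 q2] := Hq j.
  by rewrite p2 q1.
Qed.

Lemma weak_partial_ae_unique i u w1 w2 :
  is_weak_partial Omega i u w1 -> is_weak_partial Omega i u w2 ->
  {ae mu, forall x : L, Omega x -> w1 x = w2 x}.
Proof.
move=> [_ l1 H1] [_ l2 H2].
have l12 : locally_L1 Omega (fun x => w1 x - w2 x).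
  by move=> K cK KO; exact: (integrableB (compact_measurable cK) (l1 _ cK KO) (l2 _ cK KO)).
have : annihilates_tests (fun x => w1 x - w2 x).
  move=> psi tpsi; under eq_Rintegral do rewrite mulrBl.
  rewrite RintegralB//; [|exact: integrable_test|exact: integrable_test].
  have := H1 _ tpsi; rewrite (H2 _ tpsi) => /oppr_inj ->.
  by rewrite subrr.
move=> /(annihilates_tests_ae_eq0 l12); apply: filterS => x H Ox.
by apply/eqP; rewrite -subr_eq0; apply/eqP; exact: H.
Qed.

Lemma weak_partial_aeE i u w : is_weak_partial Omega i u w ->
  {ae mu, forall x : L, Omega x -> weak_partial Omega i u x = w x}.
Proof.
move=> H; apply: (@weak_partial_ae_unique i u) => //.
by apply: getPex; exists w.
Qed.

Lemma is_weak_partial_weak_partial i u w : is_weak_partial Omega i u w ->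
  is_weak_partial Omega i u (weak_partial Omega i u).
Proof. by move=> H; apply: getPex; exists w. Qed.

End weak_derivatives.

(** * The N-function *)

Section monotonicity.
Context {R : realType}.

Lemma gt0_derive_nondecreasing (f f' : R -> R) :
  (forall t : R, 0 < t -> is_derive t (1 : R) f (f' t)) -> (forall t, 0 < t -> 0 <= f' t) ->
  forall s t, 0 < s -> s <= t -> f s <= f t.
Proof.
move=> df f'0 s t s0 st; apply: (@ger0_derive1_ndecr _ f s t) => //.
- move=> x /[!in_itv]/= /andP[sx _].
  exact: (@ex_derive _ _ _ _ _ _ _ (df x (lt_trans s0 sx))).
- move=> x /[!in_itv]/= /andP[sx _]; have x0 := lt_trans s0 sx.
  by rewrite derive1E (@derive_val _ _ _ _ _ _ _ (df x x0)) f'0.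
- apply: derivable_within_continuous => x /[!in_itv]/= /andP[sx _].
  exact: (@ex_derive _ _ _ _ _ _ _ (df x (lt_le_trans s0 sx))).
Qed.

Lemma gt0_derive_nonincreasing (f f' : R -> R) :
  (forall t : R, 0 < t -> is_derive t (1 : R) f (f' t)) -> (forall t, 0 < t -> f' t <= 0) ->
  forall s t, 0 < s -> s <= t -> f t <= f s.
Proof.
move=> df f'0 s t s0 st; rewrite -lerN2.
apply: (@gt0_derive_nondecreasing (fun t => - f t) (fun t => - f' t)) => //.
  by move=> x x0; have dfx := df x x0; exact: is_deriveN.
by move=> x x0; rewrite oppr_ge0 f'0.
Qed.

End monotonicity.

Section N_function.
Context {R : realType}.
Variables (N : nat) (phi : R -> R) (l m : R).
Hypotheses (C1phi : C1 phi) (phi2_phi : phi2 phi) (phi3_phi : phi3 N phi l m).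
Local Notation Phi := (Phi_of phi).
Local Notation leb := (@lebesgue_measure R).
Let h t : R := t * phi t.

Let dphi (t : R) : is_derive t (1 : R) phi (derive1 phi t).
Proof. by rewrite derive1E; apply: derivableP; exact: C1phi.1. Qed.

Let dh t : is_derive t (1 : R) h (derive1 h t).
Proof.
have := is_deriveM (is_derive_id t 1) (dphi t).
move=> H; rewrite derive1E; apply: derivableP.
exact: (@ex_derive _ _ _ _ _ _ _ H).
Qed.

Let ch : continuous h.
Proof. by apply: derivable_continuous => t; exact: (@ex_derive _ _ _ _ _ _ _ (dh t)). Qed.

Let h0 : h 0 = 0. Proof. by rewrite /h mul0r. Qed.

Let lm : [/\ 1 <= l, 0 < l & 1 < m].
Proof.
have [/andP[l1 _] /andP[m1 _] _ _] := phi3_phi.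
by split => //; exact: lt_le_trans l1.
Qed.

(* [h] is strictly increasing on positive reals and tends to [0] at [0]. *)
Let h_gt0 t : 0 < t -> 0 < h t.
Proof.
move=> t0.
have h2 : 0 < t / 2 by rewrite divr_gt0.
have ht2 : h (t / 2) < h t by apply: phi2_phi => //; rewrite gtr_pMr// invf_lt1// ltr1n.
apply: le_lt_trans ht2; rewrite leNgt; apply/negP => hneg.
have e0 : 0 < - h (t / 2) by rewrite oppr_gt0.
have := @ch 0; rewrite /continuous_at h0 => /cvgrPdist_lt/(_ _ e0)/nbhs_ballP[d /= d0 H].
pose s := Num.min (d / 2) (t / 2 / 2).
have s0 : 0 < s by rewrite lt_min !divr_gt0.
have sd : s < d.
  by rewrite (@le_lt_trans _ _ (d / 2))// ?ge_min ?lexx// gtr_pMr// invf_lt1// ltr1n.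
have st : s < t / 2.
  by rewrite (@le_lt_trans _ _ (t / 2 / 2)) ?ge_min ?lexx ?orbT// gtr_pMr// invf_lt1// ltr1n.
have := H s; rewrite /ball/= sub0r normrN gtr0_norm// => /(_ sd).
rewrite sub0r => /(le_lt_trans (ler_norm _)).
have hs := phi2_phi s0 st; rewrite -/(h s) -/(h (t / 2)) in hs.
by rewrite ltrN2 => /(lt_trans hs); rewrite ltxx.
Qed.

Let h_ge0 t : 0 <= t -> 0 <= h t.
Proof. by rewrite le_eqVlt => /predU1P[<-|/h_gt0/ltW//]; rewrite h0. Qed.

Let h_nondecr s t : 0 <= s -> s <= t -> h s <= h t.
Proof.
rewrite le_eqVlt => /predU1P[<- t0|s0]; first by rewrite h0 h_ge0.
by rewrite le_eqVlt => /predU1P[->//|st]; exact/ltW/phi2_phi.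
Qed.

Let h'_bounds t : 0 < t -> (l - 1) * h t <= t * derive1 h t <= (m - 1) * h t.
Proof.
move=> t0; have [_ _ /(_ t t0) H _] := phi3_phi.
have p0 : 0 < phi t by have := h_gt0 t0; rewrite /h pmulr_rgt0.
move: H; rewrite ler_pdivlMr// ler_pdivrMr// => /andP[H1 H2].
rewrite /h !(mulrCA _ t) !ler_pM2l//; exact/andP.
Qed.

Let int_h a b : leb.-integrable `[a, b] (EFin \o h).
Proof.
apply: continuous_compact_integrable; first exact: segment_compact.
exact: continuous_subspaceT.
Qed.

Let PhiE (t : R) : 0 <= t -> Phi t = \int[leb]_(s in `[0, t]) h s.
Proof. by move=> t0; rewrite /Phi_of t0. Qed.

Lemma Phi0 : Phi 0 = 0.
Proof. by rewrite PhiE// set_itv1 Rintegral_set1. Qed.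

Lemma Phi_ge0 t : 0 <= t -> 0 <= Phi t.
Proof.
move=> t0; rewrite PhiE//; apply: Rintegral_ge0 => s /=.
by rewrite in_itv/= => /andP[s0 _]; exact: h_ge0.
Qed.

Lemma Phi_le t : 0 <= t -> Phi t <= t * h t.
Proof.
move=> t0; rewrite PhiE//.
have E : \int[leb]_(s in `[0, t]) h t = t * h t.
  rewrite Rintegral_cst//= lebesgue_measure_itv/= lte_fin mulrC.
  by case: ltP => t0'; rewrite ?sube0//=; have -> : t = 0 by apply/eqP; rewrite eq_le t0' t0.
rewrite -E; apply: le_Rintegral => //.
  apply: continuous_compact_integrable; first exact: segment_compact.
  by apply: continuous_subspaceT; exact: cst_continuous.
by move=> s /=; rewrite in_itv/= => /andP[s0 st]; exact: h_nondecr.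
Qed.

Let dPhi (t : R) : 0 < t -> is_derive t (1 : R) Phi (h t).
Proof.
move=> t0.
have t1 : t < t + 1 by rewrite ltrDl.
have [dF F'] := continuous_FTC1_closed t1 (int_h 0 (t + 1)) t0 (@ch t).
apply: (@near_eq_is_derive _ _ _ (fun x : R => \int[leb]_(s in `[0, x]) h s)).
  near=> z; rewrite PhiE// ltW//; near: z; exact: lt_nbhsr.
by rewrite -F' derive1E; exact: derivableP.
Unshelve. all: by end_near. Qed.

Let th_cvg0 e : 0 < e -> exists2 s0, 0 < s0 & forall s, 0 < s -> s <= s0 -> s * h s <= e.
Proof.
move=> e0.
have : (fun s => s * h s) @ (0 : R) --> 0 * h 0.
  by apply: cvgM; [exact: cvg_id|exact: ch].
rewrite mul0r => /cvgrPdist_le/(_ _ e0)/nbhs_ballP[d /= d0 H].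
exists (d / 2); first by rewrite divr_gt0.
move=> s s0 sd; have := H s; rewrite /ball/= !sub0r !normrN => /(_ _).
rewrite gtr0_norm// => /(_ _) H'.
apply: (le_trans (ler_norm _)); apply: H'.
by rewrite (le_lt_trans sd)// gtr_pMr// invf_lt1// ltr1n.
Qed.

(* This function tends to [0] at [0], and for [a = m] and [a = l] its derivative has
   a constant sign by the bounds on [h']. *)
Let dK (a t : R) : 0 < t -> is_derive t (1 : R) (fun t => t * h t - a * Phi t)
  ((1 - a) * h t + t * derive1 h t).
Proof.
move=> t0.
have D := is_deriveB (is_deriveM (is_derive_id t 1) (dh t)) (is_deriveZ a (dPhi t0)).
by apply: (@is_derive_eq _ _ _ _ _ _ _ _ D); rewrite /GRing.scale /=; ring.
Qed.

Lemma th_le_Phi t : 0 < t -> t * h t <= m * Phi t.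
Proof.
move=> t0; have [l1 l0 m1] := lm; rewrite -subr_le0; apply/ler_addgt0Pl => e e0; rewrite addr0.
have [s0 s00 Hs] := th_cvg0 e0; pose s := Num.min s0 t.
have s1 : 0 < s by rewrite lt_min s00.
apply: (@le_trans _ _ (s * h s - m * Phi s)); last first.
  rewrite lerBlDr (le_trans (Hs s s1 _)) ?ge_min ?lexx//.
  by rewrite lerDl mulr_ge0 ?Phi_ge0 ?(ltW s1)// (le_trans ler01)// ltW.
apply: (gt0_derive_nonincreasing (fun t t0 => dK m t0)) => //.
  move=> x x0; have /andP[_ H] := h'_bounds x0.
  by rewrite -opprB mulNr addrC subr_le0.
by rewrite /s ge_min lexx orbT.
Qed.

Lemma Phi_le_th t : 0 < t -> l * Phi t <= t * h t.
Proof.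
move=> t0; have [l1 l0 m1] := lm; rewrite -subr_ge0 -oppr_le0; apply/ler_addgt0Pl => e e0; rewrite addr0.
have [s0 s00 Hs] := th_cvg0 (divr_gt0 e0 l0); pose s := Num.min s0 t.
have s1 : 0 < s by rewrite lt_min s00.
rewrite -lerN2 opprK; apply: (@le_trans _ _ (s * h s - l * Phi s)).
  have := Phi_le (ltW s1); have := Hs s s1; rewrite ge_min lexx => /(_ isT).
  rewrite ler_pdivlMr// => H1 H2; have := mulr_ge0 (ltW s1) (h_ge0 (ltW s1)).
  have := ler_wpM2l (ltW l0) H2; lra.
apply: (gt0_derive_nondecreasing (fun t t0 => dK l t0)) => //.
  move=> x x0; have /andP[H _] := h'_bounds x0.
  by rewrite -opprB mulNr addrC subr_ge0.
by rewrite /s ge_min lexx orbT.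
Qed.

Lemma Phi_nondecreasing s t : 0 <= s -> s <= t -> Phi s <= Phi t.
Proof.
rewrite le_eqVlt => /predU1P[<- t0|s0]; first by rewrite Phi0 Phi_ge0.
apply: (gt0_derive_nondecreasing dPhi) => //.
by move=> x /ltW; exact: h_ge0.
Qed.

(* Hence [Phi t / t^m] is nonincreasing and [Phi t / t^l] is nondecreasing. *)
Let dRatio (a t : R) : 0 < t -> is_derive t (1 : R) (fun t => Phi t * t `^ (- a))
  ((t * h t - a * Phi t) * t `^ (- a - 1)).
Proof.
move=> t0.
have D := is_deriveM (dPhi t0) (is_derive1_powR (- a) t0).
apply: (@is_derive_eq _ _ _ _ _ _ _ _ D); rewrite /GRing.scale /=.
have -> : t `^ (- a) = t * t `^ (- a - 1).
  rewrite -{2}(powRr1 (ltW t0)) -powRD ?(gt_eqF t0) ?implybT//; congr (_ `^ _); ring.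
ring.
Qed.

Lemma Phi_scale_ge c t : 1 <= c -> 0 <= t -> c `^ l * Phi t <= Phi (c * t).
Proof.
move=> c1; rewrite le_eqVlt => /predU1P[<-|t0]; first by rewrite mulr0 Phi0 mulr0.
have c0 : 0 < c by exact: lt_le_trans c1.
have ct0 : 0 < c * t by rewrite mulr_gt0.
have : Phi t * t `^ (- l) <= Phi (c * t) * (c * t) `^ (- l).
  apply: (gt0_derive_nondecreasing (fun t t0 => dRatio l t0)) => //.
    by move=> x x0; rewrite mulr_ge0 ?powR_ge0// subr_ge0 Phi_le_th.
  by rewrite ler_peMl// ltW.
rewrite !powRN ler_pdivlMr ?powR_gt0// mulrAC ler_pdivrMr ?powR_gt0//.
rewrite powRM ?(ltW c0) ?(ltW t0)// mulrA ler_pM2r ?powR_gt0//.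
by rewrite mulrC.
Qed.

Lemma Phi_scale_le c t : 1 <= c -> 0 <= t -> Phi (c * t) <= c `^ m * Phi t.
Proof.
move=> c1; rewrite le_eqVlt => /predU1P[<-|t0]; first by rewrite mulr0 Phi0 mulr0.
have c0 : 0 < c by exact: lt_le_trans c1.
have ct0 : 0 < c * t by rewrite mulr_gt0.
have : Phi (c * t) * (c * t) `^ (- m) <= Phi t * t `^ (- m).
  apply: (gt0_derive_nonincreasing (fun t t0 => dRatio m t0)) => //.
    by move=> x x0; rewrite mulr_le0_ge0 ?powR_ge0// subr_le0 th_le_Phi.
  by rewrite ler_peMl// ltW.
rewrite !powRN ler_pdivrMr ?powR_gt0// mulrAC ler_pdivlMr ?powR_gt0//.
rewrite powRM ?(ltW c0) ?(ltW t0)// mulrA ler_pM2r ?powR_gt0//.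
by rewrite [leRHS]mulrC.
Qed.

Lemma Phi_gt0 t : 0 < t -> 0 < Phi t.
Proof.
move=> t0; have [_ _ m1] := lm; have := lt_le_trans (mulr_gt0 t0 (h_gt0 t0)) (th_le_Phi t0).
by rewrite pmulr_rgt0// (lt_trans ltr01).
Qed.

Lemma continuous_Phi_norm : continuous (fun y : R => Phi `|y|).
Proof.
have cPhi (t : R) : 0 < t -> {for t, continuous Phi}.
  move=> t0; apply/differentiable_continuous/derivable1_diffP.
  exact: (@ex_derive _ _ _ _ _ _ _ (dPhi t0)).
move=> y; have [->|y0] := eqVneq y 0; last first.
  by apply: continuous_comp; [exact: norm_continuous|apply: cPhi; rewrite normr_gt0].
apply/cvgrPdist_le => e e0; rewrite normr0 Phi0.
have [s0 s00 Hs] := th_cvg0 e0.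
near=> z; rewrite sub0r normrN ger0_norm ?Phi_ge0//.
have [->|z0] := eqVneq z 0; first by rewrite normr0 Phi0 ltW.
apply: (le_trans (Phi_le (normr_ge0 _))); apply: Hs; first by rewrite normr_gt0.
by near: z; apply/nbhs_ballP; exists s0 => //= x; rewrite /ball/= sub0r normrN => /ltW.
Unshelve. all: by end_near. Qed.

(** For [a = l], because [Phi t / t^l] is nondecreasing; otherwise by equivalence of
    [Phi] with [t^a] for large [t]. *)
Lemma Phi_coercive a : a = l \/ equivalent_Nfun Phi (abs_power a) ->  0 < a ->
  exists c c', [/\ 0 < c, 0 <= c' & forall t, 0 <= t -> c * t `^ a - c' <= Phi t].
Proof.
move=> [->|[c1 [c2 [t0 [c10 c20 t00 H]]]]] a0.
  exists (Phi 1), (Phi 1); split; [exact: Phi_gt0|exact: Phi_ge0|].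
  move=> t t0; have [t1|/ltW t1] := leP 1 t.
    rewrite lerBlDr (@le_trans _ _ (Phi t))//; last by rewrite lerDl Phi_ge0.
    by have := Phi_scale_ge t1 ler01; rewrite mulr1 mulrC.
  apply: (@le_trans _ _ 0); last exact: Phi_ge0.
  rewrite subr_le0 ler_piMr ?Phi_ge0//.
  by apply: (le_trans (ler_powR2 (ltW a0) t0 t1)); rewrite powR1.
exists c1, (c1 * t0 `^ a); split => //; first by rewrite mulr_ge0 ?powR_ge0 ?(ltW c10).
move=> t tge0; have [tt|/ltW tt] := leP t0 t.
  have /andP[+ _] := H t tt; rewrite /abs_power ger0_norm// => H1.
  by rewrite lerBlDr (le_trans H1)// lerDl mulr_ge0 ?powR_ge0 ?(ltW c10).
apply: (@le_trans _ _ 0); last exact: Phi_ge0.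
rewrite subr_le0 ler_wpM2l ?(ltW c10)//.
exact: (ler_powR2 (ltW a0) tge0 tt).
Qed.

End N_function.

(** * Modulars *)

(** Convexity appears as superlinearity along rays, the [Delta_2] condition as a
    bound by the power [m]; the last four fields say that [P] dominates [t^a]. *)
Record young_function (R : realType) (P : R -> R) (m a c c' : R) : Prop := YoungFunction {
  young0 : P 0 = 0;
  young_ge0 : forall t, 0 <= t -> 0 <= P t;
  young_nondecreasing : forall s t, 0 <= s -> s <= t -> P s <= P t;
  young_continuous : continuous (fun y : R => P `|y|);
  young_convex : forall k t, 1 <= k -> 0 <= t -> k * P t <= P (k * t);
  young_delta2 : forall k t, 1 <= k -> 0 <= t -> P (k * t) <= k `^ m * P t;
  young_exponent : 1 <= a;
  young_coercive_gt0 : 0 < c;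
  young_coercive_ge0 : 0 <= c';
  young_coercive : forall t, 0 <= t -> c * t `^ a - c' <= P t
}.

Section modular.
Context d (T : measurableType d) (R : realType) (mu : {measure set T -> \bar R}).
Variables (D : set T) (P : R -> R) (m a c c' : R).
Hypothesis mD : measurable D.
Hypothesis yP : young_function P m a c c'.
Implicit Types f g : T -> R.
Local Open Scope ereal_scope.

Definition pmodular f (k : R) : \bar R := \int[mu]_(x in D) (P (`|f x| / k))%:E.

Let P_div f k x : (0 < k)%R -> (P (`|f x| / k) = P `|f x / k|)%R.
Proof. by move=> k0; rewrite normrM normfV [in RHS](gtr0_norm k0). Qed.

Lemma measurable_young f k : (0 < k)%R -> measurable_fun D f ->
  measurable_fun D (fun x => (P (`|f x| / k))%:E).
Proof.
move=> k0 mf; apply/measurable_EFinP.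
under eq_fun do rewrite P_div//.
apply: (measurableT_comp (continuous_measurable_fun (young_continuous yP))).
exact: measurable_funM.
Qed.

Lemma young_div_ge0 f k x : (0 < k)%R -> (0 <= P (`|f x| / k))%R.
Proof. by move=> k0; apply: (young_ge0 yP); rewrite divr_ge0// ltW. Qed.

Let young_EFin_ge0 f k : (0 < k)%R -> forall x, D x -> 0 <= (P (`|f x| / k))%:E.
Proof. by move=> k0 x _; rewrite lee_fin young_div_ge0. Qed.

Lemma pmodular_ge0 f k : (0 < k)%R -> 0 <= pmodular f k.
Proof. by move=> k0; apply: integral_ge0 => x _; rewrite lee_fin young_div_ge0. Qed.

Lemma le_pmodular f g k j : (0 < k)%R -> (0 < j)%R ->
  measurable_fun D f -> measurable_fun D g ->
  (forall x, D x -> (`|f x| / k <= `|g x| / j)%R) -> pmodular f k <= pmodular g j.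
Proof.
move=> k0 j0 mf mg fg; apply: ge0_le_integral => //.
- by move=> x _; rewrite lee_fin young_div_ge0.
- exact: measurable_young.
- exact: measurable_young.
- by move=> x Dx; rewrite lee_fin; apply: (young_nondecreasing yP); [rewrite divr_ge0// ltW|exact: fg].
Qed.

Lemma ae_eq_pmodular f g k : (0 < k)%R -> measurable_fun D f -> measurable_fun D g ->
  {ae mu, forall x, D x -> f x = g x} -> pmodular f k = pmodular g k.
Proof.
move=> k0 mf mg fg; apply: ge0_ae_eq_integral => //.
- exact: measurable_young.
- exact: measurable_young.
- by move=> x _; rewrite lee_fin young_div_ge0.
- by move=> x _; rewrite lee_fin young_div_ge0.
- by move: fg; apply: filterS => x H Dx; rewrite H.
Qed.

Lemma pmodular_scale f k j : (0 < k)%R -> (1 <= j)%R -> measurable_fun D f ->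
  j%:E * pmodular f (j * k) <= pmodular f k.
Proof.
move=> k0 j1 mf; have j0 : (0 < j)%R by exact: lt_le_trans j1.
have jk0 : (0 < j * k)%R by rewrite mulr_gt0.
rewrite -ge0_integralZl//; last 3 first.
- exact: measurable_young.
- by move=> x _; rewrite lee_fin young_div_ge0.
- by rewrite lee_fin ltW.
apply: ge0_le_integral => //.
- by move=> x _; rewrite -EFinM lee_fin mulr_ge0 ?young_div_ge0// ltW.
- by apply: emeasurable_funM => //; exact: measurable_young.
- exact: measurable_young.
- move=> x _; rewrite -EFinM lee_fin.
  have -> : (`|f x| / k = j * (`|f x| / (j * k)))%R by field; rewrite !gt_eqF.
  by apply: (young_convex yP) => //; rewrite divr_ge0// ltW.
Qed.

(** The mean of two numbers is at most their maximum, and [P] of the maximum is at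
    most the sum of the values of [P]. *)
Lemma pmodularD f g k : (0 < k)%R -> measurable_fun D f -> measurable_fun D g ->
  pmodular (fun x => f x + g x)%R (2 * k) <= pmodular f k + pmodular g k.
Proof.
move=> k0 mf mg; have k20 : (0 < 2 * k)%R by rewrite mulr_gt0.
rewrite /pmodular -(ge0_integralD mu mD (young_EFin_ge0 f k0) (measurable_young k0 mf)
  (young_EFin_ge0 g k0) (measurable_young k0 mg)).
apply: ge0_le_integral => //.
- exact: (young_EFin_ge0 (fun x => (f x + g x)%R) k20).
- by apply: (measurable_young (f := fun x => (f x + g x)%R)) => //; exact: measurable_funD.
- by apply: emeasurable_funD; exact: measurable_young.
move=> x _; rewrite -EFinD lee_fin.
pose M := Num.max `|f x|%R `|g x|%R.
have H : (`|f x + g x| / (2 * k) <= M / k)%R.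
  rewrite invfM mulrA ler_pM2r ?invr_gt0// ler_pdivrMr// (le_trans (ler_normD _ _))//.
  by rewrite mulr_natr mulr2n lerD// le_max lexx ?orbT.
have N0 : (0 <= `|f x + g x| / (2 * k))%R by rewrite divr_ge0// ltW.
apply: (le_trans (young_nondecreasing yP N0 H)); rewrite /M.
case: (leP `|f x|%R `|g x|%R) => _.
  by rewrite lerDr; exact: young_div_ge0.
by rewrite lerDl; exact: young_div_ge0.
Qed.

Lemma pmodular_rescale f k j : (0 < k)%R -> (0 < j)%R -> measurable_fun D f ->
  pmodular f k < +oo -> pmodular f j < +oo.
Proof.
move=> k0 j0 mf fk; have [kj|/ltW jk] := leP k j.
  apply: le_lt_trans fk; apply: le_pmodular => // x _.
  by rewrite ler_wpM2l// lef_pV2.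
have kj1 : (1 <= k / j)%R by rewrite ler_pdivlMr// mul1r.
apply: (@le_lt_trans _ _ (((k / j) `^ m)%:E * pmodular f k)).
  rewrite -ge0_integralZl//; last 3 first.
  - exact: measurable_young.
  - by move=> x _; rewrite lee_fin young_div_ge0.
  - by rewrite lee_fin powR_ge0.
  apply: ge0_le_integral => //.
  - by move=> x _; rewrite lee_fin young_div_ge0.
  - exact: measurable_young.
  - by apply: emeasurable_funM => //; exact: measurable_young.
  - move=> x _; rewrite -EFinM lee_fin.
    have -> : (`|f x| / j = (k / j) * (`|f x| / k))%R by field; rewrite !gt_eqF.
    by apply: (young_delta2 yP) => //; rewrite divr_ge0// ltW.
by rewrite lte_mul_pinfty// lee_fin powR_ge0.
Qed.

Lemma pmodular_power f k : mu D < +oo -> (0 < k)%R -> measurable_fun D f ->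
  c%:E * \int[mu]_(x in D) ((`|f x| / k) `^ a)%:E <= pmodular f k + c'%:E * mu D.
Proof.
move=> Doo k0 mf; have c0 := young_coercive_gt0 yP; have c'0 := young_coercive_ge0 yP.
have mfa : measurable_fun D (fun x => ((`|f x| / k) `^ a)%:E).
  apply/measurable_EFinP; apply: (measurableT_comp (measurable_powR _)).
  by apply: measurable_funM => //; exact: measurableT_comp.
rewrite -ge0_integralZl//; last 2 first.
- by move=> x _; rewrite lee_fin powR_ge0.
- by rewrite lee_fin ltW.
rewrite -[X in _ <= _ + X]integral_cst// -ge0_integralD//; last 2 first.
- by move=> x _; rewrite lee_fin young_div_ge0.
- exact: measurable_young.
apply: ge0_le_integral => //.
- by move=> x _; rewrite -EFinM lee_fin mulr_ge0 ?powR_ge0// ltW.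
- by apply: emeasurable_funM.
- by apply: emeasurable_funD => //; exact: measurable_young.
- move=> x _; rewrite -EFinM -EFinD lee_fin -lerBlDr.
  by apply: (young_coercive yP); rewrite divr_ge0// ltW.
Qed.

Lemma pmodular_cvg0 (f : (T -> R)^nat) g k j : (0 < k)%R -> (0 < j)%R ->
  (forall n, measurable_fun D (f n)) -> measurable_fun D g -> pmodular g j < +oo ->
  (forall n x, D x -> (`|f n x| <= `|g x|)%R) ->
  {ae mu, forall x, D x -> (f n x @[n --> \oo] --> (0 : R))%R} ->
  pmodular (f n) k @[n --> \oo] --> 0.
Proof.
move=> k0 j0 mf mg gj fg f0.
have gk : pmodular g k < +oo by exact: (pmodular_rescale j0).
have gint : mu.-integrable D (fun x => (P (`|g x| / k))%:E).
  apply/integrableP; split; first exact: measurable_young.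
  by under eq_integral do rewrite gee0_abs ?lee_fin ?young_div_ge0//.
have f0' : {ae mu, forall x, D x -> (P (`|f n x| / k))%:E @[n --> \oo] --> (cst 0 x : \bar R)}.
  move: f0; apply: filterS => x H Dx; apply: cvg_EFin; first exact: nearW.
  have -> : (fine \o (fun n => (P (`|f n x| / k))%:E))%R = (fun n => P `|(f n x / k)%R|).
    by apply/funext => n /=; rewrite P_div.
  have H' : (f n x / k @[n --> \oo] --> (0 : R))%R.
    by rewrite -(mul0r k^-1)%R; apply: cvgM; [exact: (H Dx)|exact: cvg_cst].
  have := continuous_cvg _ (young_continuous yP (x := 0%R)) H'.
  rewrite normr0 (young0 yP) => K; exact: K.
have le n x : D x -> `|(P (`|f n x| / k))%:E| <= (P (`|g x| / k))%:E.
  move=> Dx; rewrite gee0_abs ?lee_fin ?young_div_ge0//.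
  apply: (young_nondecreasing yP); first by rewrite divr_ge0// ltW.
  by rewrite ler_pM2r ?invr_gt0//; exact: fg.
have [_ _] := @dominated_convergence _ _ _ mu D mD _ _ _
  (fun n => measurable_young k0 (mf n)) (measurable_cst _) f0' gint
  (aeW mu (fun x n Dx => le n x Dx)).
by rewrite integral0.
Qed.


(** Convergence to [0] in the Luxemburg norm, without mentioning the norm. *)
Definition modular_null (f : (T -> R)^nat) :=
  forall k, (0 < k)%R -> \forall n \near \oo, pmodular (f n) k <= 1.

Lemma modular_nullD (f g : (T -> R)^nat) : (forall n, measurable_fun D (f n)) ->
  (forall n, measurable_fun D (g n)) -> modular_null f -> modular_null g ->
  modular_null (fun n x => f n x + g n x)%R.
Proof.
move=> mf mg f0 g0 k k0; have k4 : (0 < k / 4)%R by rewrite divr_gt0.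
have k2 : (0 < 2 * (k / 4))%R by rewrite mulr_gt0.
near=> n.
have mfg : measurable_fun D (fun x => f n x + g n x)%R by exact: measurable_funD.
have fg2 : pmodular (fun x => f n x + g n x)%R (2 * (k / 4)) <= 1 + 1.
  apply: (le_trans (pmodularD k4 (mf n) (mg n))); apply: leeD.
    by near: n; exact: f0.
  by near: n; exact: g0.
have := pmodular_scale k2 (ler1n R 2 : (1 <= 2)%R) mfg.
have -> : (2 * (2 * (k / 4)) = k)%R by field.
move=> /le_trans/(_ fg2); rewrite -[in X in X -> _](_ : 2%:E = 1 + 1)//.
by rewrite -[X in _ <= X -> _]mule1 lee_pmul2l.
Unshelve. all: by end_near. Qed.

Lemma modular_null_le (f g : (T -> R)^nat) C : (0 <= C)%R ->
  (forall n, measurable_fun D (f n)) -> (forall n, measurable_fun D (g n)) ->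
  (forall n x, D x -> (`|f n x| <= C * `|g n x|)%R) ->
  modular_null g -> modular_null f.
Proof.
move=> C0 mf mg fg g0 k k0; have C1 : (0 < C + 1)%R by rewrite ltr_wpDl.
have j0 : (0 < k / (C + 1))%R by rewrite divr_gt0.
have := g0 _ j0; apply: filterS => n; apply: le_trans.
apply: le_pmodular => // x Dx; rewrite invf_div mulrCA mulrA ler_pM2r ?invr_gt0//.
by rewrite (le_trans (fg n x Dx))// ler_wpM2r// lerDl.
Qed.

(** Dominated convergence; by the [Delta_2] condition the modular of [g] is finite at
    all scales once it is at one. *)
Lemma modular_null_dominated (f : (T -> R)^nat) g j : (0 < j)%R ->
  (forall n, measurable_fun D (f n)) -> measurable_fun D g -> pmodular g j < +oo ->
  (forall n x, D x -> (`|f n x| <= `|g x|)%R) ->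
  {ae mu, forall x, D x -> (f n x @[n --> \oo] --> (0 : R))%R} ->
  modular_null f.
Proof.
move=> j0 mf mg gj fg f0 k k0.
have := pmodular_cvg0 k0 j0 mf mg gj fg f0.
move=> /fine_cvgP[fin] /cvgrPdist_le/(_ _ ltr01) H.
near=> n.
have F : pmodular (f n) k \is a fin_num by near: n.
rewrite -(fineK F) lee_fin.
have : (`|0 - (fine \o (fun n => pmodular (f n) k)) n| <= 1)%R by near: n.
by rewrite sub0r normrN /= ger0_norm// fine_ge0// pmodular_ge0.
Unshelve. all: by end_near. Qed.

Hypothesis Doo : mu D < +oo.

(** By coercivity, the unit ball of the Orlicz space is bounded in [L^a], hence in
    [L^1] since [D] has finite measure. *)
Lemma pmodular_le1_power : exists2 K, (0 <= K)%R & forall f k, (0 < k)%R ->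
  measurable_fun D f -> pmodular f k <= 1 ->
  \int[mu]_(x in D) ((`|f x| / k) `^ a)%:E <= K%:E.
Proof.
have c0 := young_coercive_gt0 yP; have c'0 := young_coercive_ge0 yP.
have mDfin : mu D \is a fin_num by rewrite ge0_fin_numE.
exists ((1 + c' * fine (mu D)) / c)%R.
  by rewrite divr_ge0 ?(ltW c0)// addr_ge0// mulr_ge0// fine_ge0.
move=> f k k0 mf f1.
have H := pmodular_power Doo k0 mf.
have {}H := le_trans H (leeD2r (c'%:E * mu D) f1).
rewrite -(fineK mDfin) -EFinM -EFinD in H.
rewrite -(@lee_pmul2l _ c%:E)// ?lte_fin// (le_trans H)// -EFinM lee_fin.
by rewrite mulrCA mulfV ?mulr1// gt_eqF.
Qed.

Let measurable_power f k : measurable_fun D f ->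
  measurable_fun D (fun x => ((`|f x| / k) `^ a)%:E).
Proof.
move=> mf; apply/measurable_EFinP; apply: (measurableT_comp (measurable_powR _)).
by apply: measurable_funM => //; exact: measurableT_comp.
Qed.

Lemma integral_norm_le_power f k : (0 < k)%R -> measurable_fun D f ->
  \int[mu]_(x in D) (`|f x|)%:E <=
  k%:E * (mu D + \int[mu]_(x in D) ((`|f x| / k) `^ a)%:E).
Proof.
move=> k0 mf; rewrite -[X in X + _]mul1e -integral_cst// -ge0_integralD//; last 2 first.
- by move=> x _; rewrite lee_fin powR_ge0.
- exact: measurable_power.
rewrite -ge0_integralZl//; last 3 first.
- by apply: emeasurable_funD => //; exact: measurable_power.
- by move=> x _; rewrite adde_ge0// lee_fin powR_ge0.
- by rewrite lee_fin ltW.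
apply: ge0_le_integral => //.
- by apply/measurable_EFinP; exact: measurableT_comp.
- apply: emeasurable_funM => //; apply: emeasurable_funD => //; exact: measurable_power.
- move=> x _; rewrite -EFinD -EFinM lee_fin mulrC -ler_pdivrMr//.
  set y := (`|f x| / k)%R.
  have y0 : (0 <= y)%R by rewrite divr_ge0// ltW.
  have [y1|/ltW y1] := leP y 1%R; first by rewrite (le_trans y1)// lerDl powR_ge0.
  rewrite ler_wpDl// -[leLHS]powRr1//; apply: ler_powR => //.
  exact: (young_exponent yP).
Qed.

Lemma pmodular_integrable f k : (0 < k)%R -> measurable_fun D f ->
  pmodular f k < +oo -> mu.-integrable D (EFin \o f).
Proof.
move=> k0 mf fk; have c0 := young_coercive_gt0 yP.
apply/integrableP; split; first exact/measurable_EFinP.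
apply: (le_lt_trans (integral_norm_le_power k0 mf)).
apply: lte_mul_pinfty; [by rewrite lee_fin ltW|by []|].
apply: lte_add_pinfty => //.
rewrite -(@lte_pmul2l _ c%:E)// ?lte_fin//.
rewrite [X in _ < X]gt0_muley ?lte_fin//.
apply: (le_lt_trans (pmodular_power Doo k0 mf)).
by rewrite lte_add_pinfty// lte_mul_pinfty// lee_fin (young_coercive_ge0 yP).
Qed.

Lemma pmodular_le1_norm : exists2 K, (0 <= K)%R & forall f k, (0 < k)%R ->
  measurable_fun D f -> pmodular f k <= 1 ->
  \int[mu]_(x in D) (`|f x|)%:E <= (k * K)%:E.
Proof.
have [K K0 HK] := pmodular_le1_power.
have mDfin : mu D \is a fin_num by rewrite ge0_fin_numE.
exists (fine (mu D) + K)%R; first by rewrite addr_ge0// fine_ge0.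
move=> f k k0 mf f1; apply: (le_trans (integral_norm_le_power k0 mf)).
rewrite EFinM lee_pmul2l ?lte_fin// EFinD fineK// leeD2l//.
exact: HK.
Qed.


End modular.

(** The sum of the [|f n|] has a finite integral, so that it is finite almost
    everywhere, and then its terms tend to [0]. *)
Lemma summable_ae_cvg0 d (T : measurableType d) (R : realType)
    (mu : {measure set T -> \bar R}) (D : set T) (f : (T -> R)^nat) (K : R) :
  measurable D -> (forall n, measurable_fun D (f n)) ->
  (forall n, \int[mu]_(x in D) (`|f n x|)%:E <= (2^-1 ^+ n * K)%:E)%E ->
  {ae mu, forall x, D x -> f n x @[n --> \oo] --> (0 : R)}.
Proof.
move=> mD mf fK.
have mnf n : measurable_fun D (fun x => (`|f n x|)%:E).
  by apply/measurable_EFinP; exact: measurableT_comp.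
pose S x := (\sum_(n <oo) (`|f n x|)%:E)%E.
have Soo : (\int[mu]_(x in D) S x < +oo)%E.
  rewrite integral_nneseries//.
  apply: (@le_lt_trans _ _ (\sum_(n <oo) (2^-1 ^+ n * K)%:E)%E).
    by apply: lee_nneseries => [n _ _|n _]; [apply: integral_ge0|exact: fK].
  have : cvgn (series (fun n => (2 : R)^-1 ^+ n * K)).
    under [X in cvgn (series X)]eq_fun do rewrite mulrC.
    apply: is_cvg_geometric_series.
    by rewrite ger0_norm ?invr_ge0// invf_lt1// ltr1n.
  move=> cv; rewrite (_ : limn _ = (limn (series (fun n => (2 : R)^-1 ^+ n * K)))%:E) ?ltry//.
  rewrite -EFin_lim//; congr (limn _); apply/funext => n.
  by rewrite /series /= sumEFin.
have mS : measurable_fun D S by apply: ge0_emeasurable_sum.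
have iS : mu.-integrable D S.
  apply/integrableP; split => //.
  rewrite (eq_integral S)// => x _; rewrite gee0_abs//.
  exact: nneseries_ge0.
have := integrable_ae mD iS; apply: filterS => x + Dx => /(_ Dx) Sfin.
apply/norm_cvg0P; apply: cvg_series_cvg_0.
apply: nondecreasing_is_cvgn.
  by apply/nondecreasing_series => n _ _; exact: normr_ge0.
exists (fine (S x)) => _ [n _ <-].
rewrite -lee_fin fineK// /series /= -sumEFin.
exact: nneseries_lim_ge.
Qed.

(** * The Luxemburg norm *)

Section luxemburg_norm.
Context d (T : measurableType d) (R : realType) (mu : {measure set T -> \bar R}).
Variables (D : set T) (P : R -> R) (m a c c' : R).
Hypothesis mD : measurable D.
Hypothesis yP : young_function P m a c c'.
Implicit Types f g : T -> R.
Local Open Scope ereal_scope.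
Local Notation pmodular := (pmodular mu D P).

Definition unit_scales f : set R := [set k : R | (0 < k)%R /\ pmodular f k <= 1].

Lemma has_lbound_unit_scales f : has_lbound (unit_scales f).
Proof. by exists 0%R => k [/ltW]. Qed.

Lemma inf_unit_scales_ge0 f : (0 <= inf (unit_scales f))%R.
Proof.
have [->|/set0P E0] := eqVneq (unit_scales f) set0; first by rewrite inf0.
by apply: lb_le_inf => // k [/ltW].
Qed.

Lemma inf_unit_scales_le f k : (0 < k)%R -> pmodular f k <= 1 ->
  (inf (unit_scales f) <= k)%R.
Proof. by move=> k0 fk; apply: (ge_inf (has_lbound_unit_scales f)); split. Qed.

Lemma pmodular_shrink f k j : (0 < k)%R -> (k <= j)%R -> measurable_fun D f ->
  pmodular f j <= pmodular f k.
Proof.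
move=> k0 kj mf; have j0 := lt_le_trans k0 kj.
apply: (le_pmodular mu mD yP) => // x _.
by rewrite ler_wpM2l// lef_pV2.
Qed.

(** By convexity the modular is at most [1] once the scale is multiplied by one plus
    its value. *)
Lemma unit_scales_neq0 f k : (0 < k)%R -> measurable_fun D f -> pmodular f k < +oo ->
  unit_scales f !=set0.
Proof.
move=> k0 mf fk; have fk0 : 0 <= pmodular f k by exact: (pmodular_ge0 mu D yP).
pose j := (1 + fine (pmodular f k))%R.
have j1 : (1 <= j)%R by rewrite lerDl fine_ge0.
have j0 : (0 < j)%R by exact: lt_le_trans j1.
exists (j * k)%R; split; first by rewrite mulr_gt0.
rewrite -(@lee_pmul2l _ j%:E)// ?lte_fin// mule1.
apply: (le_trans (pmodular_scale mu mD yP k0 j1 mf)).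
by rewrite -[leLHS]fineK ?ge0_fin_numE// lee_fin lerDr.
Qed.

Lemma pmodular_le1 f k e : (0 < k)%R -> measurable_fun D f -> pmodular f k < +oo ->
  (inf (unit_scales f) < e)%R -> pmodular f e <= 1.
Proof.
move=> k0 mf fk /(inf_lt (unit_scales_neq0 k0 mf fk))[j [j0 fj] /ltW je].
exact: le_trans (pmodular_shrink j0 je mf) fj.
Qed.

Lemma modular_null_rate (f : (T -> R)^nat) : (forall n, measurable_fun D (f n)) ->
  (forall n, pmodular (f n) (2^-1 ^+ n) <= 1) -> modular_null mu D P f.
Proof.
move=> mf f1 k k0.
have : ((2 : R)^-1 ^+ n @[n --> \oo] --> (0 : R))%R.
  by apply: cvg_expr; rewrite ger0_norm ?invr_ge0// invf_lt1// ltr1n.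
move=> /cvgrPdist_le/(_ _ k0); apply: filterS => n.
rewrite sub0r normrN ger0_norm ?exprn_ge0 ?invr_ge0// => nk.
by apply: le_trans (f1 n); apply: pmodular_shrink; rewrite ?exprn_gt0 ?invr_gt0.
Qed.

Lemma pmodularD_lty f g k j : (0 < k)%R -> (0 < j)%R ->
  measurable_fun D f -> measurable_fun D g ->
  pmodular f k < +oo -> pmodular g j < +oo ->
  pmodular (fun x => (f x + g x)%R) k < +oo.
Proof.
move=> k0 j0 mf mg fk gj; have k2 : (0 < 2 * k)%R by rewrite mulr_gt0.
apply: (pmodular_rescale mD yP k2 k0); first exact: measurable_funD.
apply: (le_lt_trans (pmodularD mu mD yP k0 mf mg)).
by rewrite lte_add_pinfty//; exact: (pmodular_rescale mD yP j0 k0).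
Qed.

Hypothesis Doo : mu D < +oo.

Lemma pmodular_bounded_lty f M k : (0 < k)%R -> measurable_fun D f ->
  (forall x, D x -> (`|f x| <= M)%R) -> pmodular f k < +oo.
Proof.
move=> k0 mf fM.
apply: (@le_lt_trans _ _ (pmodular (cst `|M|%R) k)).
  apply: (le_pmodular mu mD yP) => // x Dx.
  by rewrite ler_pM2r ?invr_gt0// normr_id (le_trans (fM x Dx))// ler_norm.
have -> : pmodular (cst `|M|%R) k = (P (`| `|M| | / k))%:E * mu D by exact: (integral_cst mu mD (P (`| `|M| | / k))%:E).
by rewrite lte_mul_pinfty// lee_fin (young_div_ge0 yP).
Qed.

(** The Luxemburg norm dominates the norm of [L^1]. *)
Lemma modular_null_integral (f : (T -> R)^nat) (h : T -> R) (M e : R) :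
  (forall n, measurable_fun D (f n)) -> measurable_fun D h ->
  (forall x, D x -> (`|h x| <= M)%R) -> modular_null mu D P f -> (0 < e)%R ->
  \forall n \near \oo, (`|\int[mu]_(x in D) (f n x * h x)| <= e)%R.
Proof.
move=> mf mh hM f0 e0; have [K K0 HK] := pmodular_le1_norm mD yP Doo.
pose M1 := (1 + `|M|)%R; have M10 : (0 < M1)%R by rewrite ltr_wpDr.
pose k := (e / (M1 * (1 + K)))%R.
have k0 : (0 < k)%R by rewrite divr_gt0// mulr_gt0// ltr_wpDr.
have := f0 k k0; apply: filterS => n fk.
have fint := HK (f n) k k0 (mf n) fk.
have iff : mu.-integrable D (EFin \o f n).
  by apply: (pmodular_integrable mD yP Doo k0 (mf n)); exact: le_lt_trans fk (ltry _).
have mfh : measurable_fun D (fun x => (f n x * h x)%R) by exact: measurable_funM.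
have HH : \int[mu]_(x in D) `|(f n x * h x)%R|%:E <= (M1 * (k * K))%:E.
  apply: (@le_trans _ _ (M1%:E * \int[mu]_(x in D) `|f n x|%:E)); last first.
    by rewrite EFinM lee_pmul2l.
  rewrite -ge0_integralZl//; last 2 first.
  - by apply/measurable_EFinP; exact: measurableT_comp.
  - by rewrite lee_fin ltW.
  apply: ge0_le_integral => //.
  - by apply/measurable_EFinP; exact: measurableT_comp.
  - by apply: emeasurable_funM => //; apply/measurable_EFinP; exact: measurableT_comp.
  move=> x Dx; rewrite -EFinM lee_fin normrM mulrC ler_wpM2r//.
  by rewrite (le_trans (hM x Dx))// (le_trans (ler_norm M))// lerDr.
have ifh : mu.-integrable D (EFin \o (fun x => f n x * h x)%R).
  apply/integrableP; split; first exact/measurable_EFinP.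
  exact: le_lt_trans HH (ltry _).
apply: (le_trans (le_normr_Rintegral mD ifh)).
rewrite -lee_fin /Rintegral fineK; last first.
  rewrite ge0_fin_numE; first exact: le_lt_trans HH (ltry _).
  by apply: integral_ge0.
apply: (le_trans HH); rewrite lee_fin /k.
have -> : (M1 * (e / (M1 * (1 + K)) * K) = e * (K / (1 + K)))%R.
  by field; rewrite !gt_eqF// ltr_wpDr.
rewrite ler_piMr ?(ltW e0)// ler_pdivrMr ?mul1r ?lerDr//.
by rewrite ltr_wpDr.
Qed.

End luxemburg_norm.

(** * Approximation in the Orlicz-Sobolev space *)

Section orlicz_sobolev_approximation.
Context {R : realType} {n : nat}.
Local Notation L := (lebesgue_space R n).
Local Notation mu := (@lebesgue R n).
Variables (Omega : set 'rV[R]_n) (Phi : R -> R) (m a c c' : R).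
Hypothesis oOmega : open Omega.
Hypothesis Omega_lty : (mu Omega < +oo)%E.
Hypothesis yP : young_function Phi m a c c'.
Implicit Types (u v w psi eta : 'rV[R]_n -> R).
Local Notation OL := (Omega : set L).
Local Notation pmod := (pmodular mu OL Phi).
Local Notation null := (modular_null mu OL Phi).
Local Notation wpartial := (is_weak_partial Omega).

Let mOmega : measurable OL.
Proof. exact: (borel_measurable_lebesgue (open_measurable_rV oOmega)). Qed.

(** Weak partial derivatives are arbitrary representatives of their class; they are
    measurable because Lebesgue measure is complete. *)
Lemma ae_eq_measurable (f g : 'rV[R]_n -> R) : {ae mu, forall x : L, Omega x -> f x = g x} ->
  measurable_fun OL g -> measurable_fun OL f.
Proof.
move=> fg mg; apply/measurable_EFinP.
apply: (@ae_measurable_fun _ _ _ mu _ OL (EFin \o g) (EFin \o f)).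
- exact: measure_is_complete_caratheodory.
- by move: fg; apply: filterS => x H Ox /=; rewrite H.
- exact/measurable_EFinP.
Qed.

Lemma smooth_measurable psi : smooth psi -> measurable_fun OL psi.
Proof.
by move=> sp; apply: measurable_funTS; apply: continuous_lebesgue; exact: smooth_continuous.
Qed.

Lemma test_measurable psi : test_function Omega psi -> measurable_fun OL psi.
Proof. by case=> sp _ _; exact: smooth_measurable. Qed.

Lemma test_bounded psi : test_function Omega psi -> exists M, forall x, `|psi x| <= M.
Proof. by move=> /test_bounded_bsupp[_ [M HM]]; exists M => x; have [] := HM x. Qed.

Lemma test_pmodular_lty psi : test_function Omega psi -> (pmod psi 1 < +oo)%E.
Proof.
move=> tp; have [M HM] := test_bounded tp.
by apply: (pmodular_bounded_lty mOmega yP Omega_lty (M := M)) => //; exact: test_measurable.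
Qed.

Lemma finite_modular_locally_L1 w : measurable_fun OL w -> (pmod w 1 < +oo)%E ->
  locally_L1 Omega w.
Proof.
move=> mw w1 K cK KO.
have iw := pmodular_integrable mOmega yP Omega_lty ltr01 mw w1.
exact: (integrableS mOmega (compact_measurable cK) KO iw).
Qed.

Lemma test_integral_partial_eq0 i psi : test_function Omega psi ->
  \int[mu]_(x in Omega) partial i psi x = 0.
Proof.
move=> tp; have tpi := test_partial i tp.
have [spi _ SO] := tpi.
have ib := bounded_bsupp_integrable (test_bounded_bsupp tpi).
have mb : measurable_fun setT (partial i psi).
  by apply: continuous_measurable_rV; exact: smooth_continuous.
have [_ E] := integral_lebesgueE mb ib.
transitivity (fine (0%E : \bar R)); last by [].
congr fine.
rewrite -(test_integral_partial0 i tp) -E.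
rewrite integral_mkcond; congr integral; apply/funext => x; rewrite patchE.
case: ifPn => //; rewrite notin_setE => Ox.
have [->//|px] := eqVneq (partial i psi x) 0.
by exfalso; apply/Ox/SO; exact: subset_closure.
Qed.

(** The derivative of the product with another test function has integral [0]. *)
Lemma is_weak_partial_test i psi : test_function Omega psi -> wpartial i psi (partial i psi).
Proof.
move=> tp; have tpi := test_partial i tp; have [sp _ _] := tp.
have lp : locally_L1 Omega psi.
  exact: (finite_modular_locally_L1 (test_measurable tp) (test_pmodular_lty tp)).
have lpi : locally_L1 Omega (partial i psi).
  exact: (finite_modular_locally_L1 (test_measurable tpi) (test_pmodular_lty tpi)).
split => // eta te; have [se _ _] := te.
have I1 := integrable_test oOmega lp (test_partial i te).
have I2 := integrable_test oOmega lpi te.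
apply/eqP; rewrite -addr_eq0 -(RintegralD mOmega I1 I2).
rewrite -[X in _ == X](test_integral_partial_eq0 i (testM sp te)); apply/eqP.
by apply: eq_Rintegral => x _; rewrite partialM// [eta x * _]mulrC.
Qed.

Lemma is_weak_partialB i u v w z : wpartial i u w -> wpartial i v z ->
  wpartial i (u \- v) (w \- z).
Proof.
have lB f g : locally_L1 Omega f -> locally_L1 Omega g -> locally_L1 Omega (f \- g).
  move=> lf lg K cK KO.
  exact: (integrableB (compact_measurable cK) (lf _ cK KO) (lg _ cK KO)).
move=> [lu lw uw] [lv lz vz]; split; [exact: lB|exact: lB|].
move=> psi tp; have tpi := test_partial i tp.
under eq_Rintegral do rewrite mulrBl.
under [in RHS]eq_Rintegral do rewrite mulrBl.
rewrite !RintegralB//; try exact: integrable_test.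
by rewrite uw// vz//; ring.
Qed.


Lemma orlicz_lty f : orlicz Omega Phi f <-> measurable_fun OL f /\ (pmod f 1 < +oo)%E.
Proof.
split=> [[mf [k k0 fk]]|[mf f1]]; split => //; last by exists 1.
exact: (pmodular_rescale mOmega yP k0 ltr01 mf fk).
Qed.

Lemma orliczB f g : orlicz Omega Phi f -> orlicz Omega Phi g -> orlicz Omega Phi (f \- g).
Proof.
move=> /orlicz_lty[mf f1] /orlicz_lty[mg g1]; apply/orlicz_lty; split.
  exact: measurable_funB.
have mNg : measurable_fun OL (fun x => - g x) by exact: measurableT_comp.
have Ng1 : (pmod (fun x => - g x)%R 1 < +oo)%E.
  by rewrite /pmodular; under eq_integral do rewrite normrN.
exact: (pmodularD_lty mOmega yP ltr01 ltr01 mf mNg f1 Ng1).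
Qed.

Lemma test_orlicz psi : test_function Omega psi -> orlicz Omega Phi psi.
Proof.
by move=> tp; apply/orlicz_lty; split; [exact: test_measurable|exact: test_pmodular_lty].
Qed.

Lemma orlicz_locally_L1 f : orlicz Omega Phi f -> locally_L1 Omega f.
Proof. by move=> /orlicz_lty[mf f1]; exact: finite_modular_locally_L1. Qed.

Lemma orlicz_ae_eq f g : {ae mu, forall x : L, Omega x -> f x = g x} ->
  orlicz Omega Phi g -> orlicz Omega Phi f.
Proof.
move=> fg /orlicz_lty[mg g1]; have mf := ae_eq_measurable fg mg.
by apply/orlicz_lty; split => //; rewrite (ae_eq_pmodular mOmega yP ltr01 mf mg fg).
Qed.

Lemma W1_weak_partial u i : W1 Omega Phi u ->
  wpartial i u (weak_partial Omega i u) /\ orlicz Omega Phi (weak_partial Omega i u).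
Proof.
move=> [_ /(_ i)[w uw ow]]; split; first exact: is_weak_partial_weak_partial uw.
exact: (orlicz_ae_eq (weak_partial_aeE oOmega uw) ow).
Qed.

(** Convergence in the norm of the Orlicz-Sobolev space, with a candidate [w] in
    place of the weak gradient. *)
Definition approximated u (w : 'I_n -> 'rV[R]_n -> R) (psi : ('rV[R]_n -> R)^nat) :=
  [/\ forall k, test_function Omega (psi k), null (fun k => u \- psi k)
    & forall i, null (fun k => w i \- partial i (psi k))].

(** Approximating at the rate [2^-k] yields almost everywhere convergence as well. *)
Lemma W10_approximated u : W10 Omega Phi u -> exists psi : ('rV[R]_n -> R)^nat,
  [/\ approximated u (weak_partial Omega ^~ u) psi,
    {ae mu, forall x : L, Omega x -> psi k x @[k --> \oo] --> u x}
  & forall i, {ae mu, forall x : L, Omega x ->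
      partial i (psi k) x @[k --> \oo] --> weak_partial Omega i u x}].
Proof.
move=> [W1u Hu]; have [ou _] := W1u.
have Hk (k : nat) : exists psi, [/\ test_function Omega psi,
    (pmod (u \- psi)%R (2^-1 ^+ k) <= 1)%E
  & forall i, (pmod (weak_partial Omega i u \- partial i psi)%R (2^-1 ^+ k) <= 1)%E].
  have e0 : 0 < (2 : R)^-1 ^+ k by rewrite exprn_gt0// invr_gt0.
  have [psi tp] := Hu _ e0; rewrite /W1_norm => lt.
  have lu0 f : 0 <= luxemburg Omega Phi f by exact: inf_unit_scales_ge0.
  have ol := orliczB ou (test_orlicz tp).
  exists psi; split => //.
    have /orlicz_lty[mf f1] := ol.
    apply: (pmodular_le1 mOmega yP ltr01 mf f1); apply: le_lt_trans lt.
    by rewrite lerDl; apply: sumr_ge0.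
  move=> i; have [wu owu] := W1_weak_partial i W1u.
  have owi := orliczB owu (test_orlicz (test_partial i tp)).
  have fg := weak_partial_aeE oOmega (is_weak_partialB wu (is_weak_partial_test i tp)).
  have /orlicz_lty[mg _] := owi.
  have /orlicz_lty[mf f1] := orlicz_ae_eq fg owi.
  rewrite -(ae_eq_pmodular mOmega yP e0 mf mg fg).
  apply: (pmodular_le1 mOmega yP ltr01 mf f1); apply: le_lt_trans lt.
  rewrite (bigD1 i)//= addrCA lerDl addr_ge0//.
  by apply: sumr_ge0.
have [psi Hpsi] := choice Hk; exists psi.
have tpsi k : test_function Omega (psi k) by have [] := Hpsi k.
have mu' k : measurable_fun OL (u \- psi k).
  by have /orlicz_lty[] := orliczB ou (test_orlicz (tpsi k)).
have mw i k : measurable_fun OL (weak_partial Omega i u \- partial i (psi k)).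
  by have /orlicz_lty[] := orliczB (W1_weak_partial i W1u).2 (test_orlicz (test_partial i (tpsi k))).
have [K K0 HK] := pmodular_le1_norm mOmega yP Omega_lty.
have ae (f : 'rV[R]_n -> R) (g : ('rV[R]_n -> R)^nat) :
    (forall k, measurable_fun OL (f \- g k)) ->
    (forall k, (pmod (f \- g k)%R (2^-1 ^+ k) <= 1)%E) ->
    {ae mu, forall x : L, Omega x -> g k x @[k --> \oo] --> f x}.
  move=> mfg fg; have := @summable_ae_cvg0 _ _ _ mu OL (fun k => f \- g k) K mOmega mfg.
  have e0 k : 0 < (2 : R)^-1 ^+ k by rewrite exprn_gt0// invr_gt0.
  move=> /(_ (fun k => HK _ _ (e0 k) (mfg k) (fg k))).
  apply: filterS => x H Ox; have /= {}H := H Ox.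
  rewrite -[X in _ --> X]subr0.
  rewrite (_ : (fun k => g k x) = (fun k => f x - (f x - g k x))).
    by apply: cvgB; [exact: cvg_cst|exact: H].
  by apply/funext => k; rewrite opprB addrC subrK.
split; [split => //|by apply: ae => // k; have [] := Hpsi k|].
- by apply: (modular_null_rate mOmega yP) => // k; have [] := Hpsi k.
- by move=> i; apply: (modular_null_rate mOmega yP) => // k; have [_ _ ->] := Hpsi k.
- by move=> i; apply: ae => // k; have [_ _ ->] := Hpsi k.
Qed.

(** Integration by parts passes to the limit, so that the candidate gradient is the
    weak one; membership in the space thus reduces to estimates on smooth functions. *)
Lemma approximated_W10 u (w : 'I_n -> 'rV[R]_n -> R) (psi : ('rV[R]_n -> R)^nat) : measurable_fun OL u -> (forall i, measurable_fun OL (w i)) ->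
  approximated u w psi ->
  W10 Omega Phi u /\ forall i, wpartial i u (w i) /\ orlicz Omega Phi (w i).
Proof.
move=> mU mw [tpsi nu nw].
have orl (f : 'rV[R]_n -> R) (g : ('rV[R]_n -> R)^nat) : measurable_fun OL f -> (forall k, test_function Omega (g k)) ->
    null (fun k => f \- g k) -> orlicz Omega Phi f.
  move=> mf tg /(_ 1 ltr01)[k _ /(_ k (leqnn k))] /= fg.
  have [mg g1] := (orlicz_lty (g k)).1 (test_orlicz (tg k)).
  apply/orlicz_lty; split => //.
  have -> : f = (fun x => (f \- g k) x + g k x) by apply/funext => x /=; rewrite subrK.
  apply: (pmodularD_lty mOmega yP ltr01 ltr01 _ mg _ g1); first exact: measurable_funB.
  exact: le_lt_trans fg (ltry _).
have ou : orlicz Omega Phi u by exact: orl nu.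
have tpi i k : test_function Omega (partial i (psi k)) by exact: test_partial.
have ow i : orlicz Omega Phi (w i) by exact: orl (nw i).
have mud k : measurable_fun OL (u \- psi k).
  by apply: measurable_funB => //; exact: test_measurable.
have mwd i k : measurable_fun OL (w i \- partial i (psi k)).
  by apply: measurable_funB => //; exact: test_measurable.
have uw i : wpartial i u (w i).
  split; [exact: orlicz_locally_L1|exact: orlicz_locally_L1|move=> eta te].
  have tei := test_partial i te.
  have [M HM] := test_bounded te; have [M' HM'] := test_bounded tei.
  apply/eqP; rewrite -addr_eq0 -normr_le0; apply/ler_addgt0Pl => e e0; rewrite addr0.
  have e2 : 0 < e / 2 by rewrite divr_gt0.
  have N1 := modular_null_integral mOmega yP Omega_lty mud (test_measurable tei)
    (fun x _ => HM' x) nu e2.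
  have N2 := modular_null_integral mOmega yP Omega_lty (mwd i) (test_measurable te)
    (fun x _ => HM x) (nw i) e2.
  have [k _ /(_ k (leqnn k))[K1 K2]] := filterI N1 N2.
  have [lp lpi Ek] := is_weak_partial_test i (tpsi k).
  have lu := orlicz_locally_L1 ou; have lw := orlicz_locally_L1 (ow i).
  rewrite (splitr e); apply: le_trans (lerD K1 K2).
  apply: le_trans (ler_normD _ _); rewrite le_eqVlt; apply/predU1P; left; congr `|_|.
  under [X in _ = X + _]eq_Rintegral do rewrite mulrBl.
  under [X in _ = _ + X]eq_Rintegral do rewrite mulrBl.
  rewrite (RintegralB mOmega (integrable_test oOmega lu tei) (integrable_test oOmega lp tei)).
  rewrite (RintegralB mOmega (integrable_test oOmega lw te) (integrable_test oOmega lpi te)).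
  by rewrite (Ek _ te); ring.
split; last by move=> i; split.
split; first by split => // i; exists (w i).
move=> e e0; pose d := e / (2 * (n.+1)%:R).
have d0 : 0 < d by rewrite divr_gt0// mulr_gt0.
have NW : \forall k \near \oo, forall i, (pmod (w i \- partial i (psi k))%R d <= 1)%E.
  by apply: filter_forall => i; exact: nw.
have [k _ /(_ k (leqnn k))[K1 K2]] := filterI (nu d d0) NW.
exists (psi k) => //; rewrite /W1_norm.
apply: (@le_lt_trans _ _ (d + \sum_(i < n) d)); last first.
  rewrite sumr_const card_ord -[X in X + _]mulr1n -mulrnDr -mulr_natr /d add1n.
  by rewrite invfM mulrA divfK// gtr_pMr// invf_lt1// ltr1n.
apply: lerD; first exact: inf_unit_scales_le K1.
apply: ler_sum => i _; apply: inf_unit_scales_le => //.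
have fg := weak_partial_aeE oOmega (is_weak_partialB (uw i) (is_weak_partial_test i (tpsi k))).
have mf := ae_eq_measurable fg (mwd i k).
by rewrite (ae_eq_pmodular mOmega yP d0 mf (mwd i k) fg).
Qed.

End orlicz_sobolev_approximation.

(** * Limits of integrals and elementary inequalities *)

(** Fatou's lemma for almost everywhere limits. *)
Lemma ae_cvg_integral_le d (T : measurableType d) (R : realType)
    (mu : {measure set T -> \bar R}) (D : set T) (f : (T -> R)^nat) (g : T -> R) (B : \bar R) :
  measurable D -> (forall n, measurable_fun D (f n)) -> measurable_fun D g ->
  (forall n x, 0 <= f n x) -> (forall x, 0 <= g x) ->
  {ae mu, forall x, D x -> f n x @[n --> \oo] --> g x} ->
  (forall n, \int[mu]_(x in D) (f n x)%:E <= B)%E -> (\int[mu]_(x in D) (g x)%:E <= B)%E.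
Proof.
move=> mD mf mg f0 g0 fg fB; pose h n x := (f n x)%:E.
have mh n : measurable_fun D (h n) by exact/measurable_EFinP.
have mlim : measurable_fun D (fun x => limn_einf (h ^~ x)).
  apply: (@emeasurable_fun_cvg _ _ _ _ (fun n x => einfs (h ^~ x) n)).
    by move=> n; exact: measurable_fun_einfs.
  by move=> x _; rewrite limn_einf_lim; exact: is_cvg_einfs.
have lim0 x : (0 <= limn_einf (h ^~ x))%E.
  rewrite limn_einf_lim; apply: lime_ge; first exact: is_cvg_einfs.
  by apply: nearW => n; apply: le_ereal_inf_tmp => _ [k _ <-]; rewrite lee_fin.
have -> : (\int[mu]_(x in D) (g x)%:E = \int[mu]_(x in D) limn_einf (h ^~ x))%E.
  apply: ge0_ae_eq_integral => //.
  - exact/measurable_EFinP.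
  - by move=> x _; rewrite lee_fin.
  - move: fg; apply: filterS => x H Dx.
    have hg : h n x @[n --> \oo] --> (g x)%:E by apply: cvg_EFin; [exact: nearW|exact: H].
    by have [-> _] := cvg_limn_einf_sup hg.
apply: (@le_trans _ _ (limn_einf (fun n => \int[mu]_(x in D) h n x))%E).
  by apply: fatou => // n x _; rewrite lee_fin.
rewrite limn_einf_lim; apply: lime_le; first exact: is_cvg_einfs.
apply: nearW => n; apply: le_trans (fB n).
by apply: ereal_inf_lbound; exists n => /=.
Qed.

Lemma bounded_derivative_lipschitz (R : realType) (G : R -> R) (K : R) : smooth1 G ->
  (forall t, `|derive1 G t| <= K) -> forall x y, `|G x - G y| <= K * `|x - y|.
Proof.
move=> sG GK.
have main (x y : R) : x <= y -> `|G y - G x| <= K * `|y - x|.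
  move=> xy; have dG z : z \in `]x, y[ -> is_derive z (1 : R) G (derive1 G z).
    by move=> _; exact: smooth1_is_derive.
  have cG : {within `[x, y], continuous G}.
    exact/continuous_subspaceT/smooth1_continuous.
  by have [z _ ->] := MVT_segment xy dG cG; rewrite normrM ler_wpM2r.
move=> x y; have [/main|/ltW/main//] := leP x y.
by rewrite distrC [`|y - x|]distrC.
Qed.

(** Each term is at most [Y], the norm of [F] in [l^a]. *)
Lemma sum_powR_le (R : realType) (a : R) (I : finType) (F : I -> R) : 0 < a ->
  (forall i, 0 <= F i) ->
  (\sum_i F i) `^ a <= #|I|%:R `^ a * \sum_i F i `^ a.
Proof.
move=> a0 F0; have P0 i : 0 <= F i `^ a by exact: powR_ge0.
have S0 : 0 <= \sum_i F i `^ a by apply: sumr_ge0.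
pose Y := (\sum_i F i `^ a) `^ a^-1.
have a1 : a^-1 * a = 1 by rewrite mulVf// gt_eqF.
have -> : \sum_i F i `^ a = Y `^ a by rewrite /Y -powRrM a1 powRr1.
rewrite -powRM ?powR_ge0//; apply: ler_powR2; [exact: ltW|by apply: sumr_ge0|].
have -> : #|I|%:R * Y = \sum_(i : I) Y by rewrite sumr_const mulr_natl.
apply: ler_sum => i _; have -> : F i = (F i `^ a) `^ a^-1.
  by rewrite -powRrM mulrC a1 powRr1.
apply: ler_powR2 => //; first by rewrite invr_ge0 ltW.
by rewrite (bigD1 i)//= lerDl; apply: sumr_ge0.
Qed.

(** * The chain rule *)

Section chain_rule.
Context {R : realType} {n : nat}.
Local Notation L := (lebesgue_space R n).
Local Notation mu := (@lebesgue R n).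
Variables (Omega : set 'rV[R]_n) (Phi : R -> R) (m a c c' : R).
Hypothesis oOmega : open Omega.
Hypothesis Omega_lty : (mu Omega < +oo)%E.
Hypothesis yP : young_function Phi m a c c'.
Implicit Types (u v w psi eta : 'rV[R]_n -> R).
Local Notation OL := (Omega : set L).
Local Notation pmod := (pmodular mu OL Phi).
Local Notation null := (modular_null mu OL Phi).

Let mOmega : measurable OL.
Proof. exact: (borel_measurable_lebesgue (open_measurable_rV oOmega)). Qed.

Let measurable_comp (G : R -> R) u : continuous G -> measurable_fun OL u ->
  measurable_fun OL (G \o u).
Proof. by move=> cG mu_; apply: measurableT_comp => //; exact: continuous_measurable_fun. Qed.

(** The chain rule holds for the approximating test functions [psi k]. The difference
    of the gradients of [G o u] and [G o psi k] is [G'(psi k)] times the difference of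
    those of [u] and [psi k], plus [G'(u) - G'(psi k)] times the gradient of [u]; the
    last term tends to [0] by dominated convergence. *)
Lemma W10_chain_rule (G : R -> R) (K : R) u : smooth1 G -> G 0 = 0 ->
  (forall t, `|derive1 G t| <= K) -> W10 Omega Phi u ->
  W10 Omega Phi (G \o u) /\ forall i,
    {ae mu, forall x : L, Omega x ->
      weak_partial Omega i (G \o u) x = derive1 G (u x) * weak_partial Omega i u x}.
Proof.
move=> sG G0 GK Wu; have K0 : 0 <= K by exact: le_trans (GK 0).
have [W1u _] := Wu; have [ou _] := W1u.
have [mU _] := (orlicz_lty oOmega yP u).1 ou.
pose w i := weak_partial Omega i u.
have ow i : orlicz Omega Phi (w i).
  by have [] := W1_weak_partial oOmega yP i W1u.
have [psi [[tpsi nu nw] upsi wpsi]] := W10_approximated oOmega Omega_lty yP Wu.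
have mw i : measurable_fun OL (w i) by have [] := (orlicz_lty oOmega yP (w i)).1 (ow i).
have w1 i : (pmod (w i) 1 < +oo)%E by have [] := (orlicz_lty oOmega yP (w i)).1 (ow i).
have sG' : smooth1 (derive1 G) by exact: smooth1_deriv.
have mG'u : measurable_fun OL (derive1 G \o u).
  by apply: measurable_comp => //; exact: smooth1_continuous.
have mpsi k : measurable_fun OL (psi k) by exact: test_measurable.
have mG'psi k : measurable_fun OL (derive1 G \o psi k).
  by apply: measurable_comp => //; exact: smooth1_continuous.
have mpart i k : measurable_fun OL (partial i (psi k)).
  by apply: test_measurable; exact: test_partial.
have mGu : measurable_fun OL (G \o u).
  by apply: measurable_comp => //; exact: smooth1_continuous.
have mw' i : measurable_fun OL (fun x => derive1 G (u x) * w i x) by exact: measurable_funM.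
have tGpsi k : test_function Omega (G \o psi k) by exact: test_comp.
have appr : approximated Omega Phi (G \o u) (fun i x => derive1 G (u x) * w i x)
    (fun k => G \o psi k).
  split; [exact: tGpsi| |move=> i].
    apply: (modular_null_le mOmega yP K0 _ _ _ nu).
    - move=> k; exact: (measurable_funB mGu (test_measurable (tGpsi k))).
    - move=> k; exact: (measurable_funB mU (mpsi k)).
    - move=> k x _; exact: bounded_derivative_lipschitz.
  have md k : measurable_fun OL (fun x => derive1 G (psi k x) * (w i x - partial i (psi k) x)).
    exact: (measurable_funM (mG'psi k) (measurable_funB (mw i) (mpart i k))).
  have mr k : measurable_fun OL (fun x => (derive1 G (u x) - derive1 G (psi k x)) * w i x).
    exact: (measurable_funM (measurable_funB mG'u (mG'psi k)) (mw i)).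
  have -> : (fun k => (fun x => derive1 G (u x) * w i x) \- partial i (G \o psi k)) =
      (fun k x => derive1 G (psi k x) * (w i x - partial i (psi k) x) +
                  (derive1 G (u x) - derive1 G (psi k x)) * w i x).
    apply/funext => k; apply/funext => x /=.
    by rewrite partial_comp//; [ring|by have [] := tpsi k].
  apply: (modular_nullD mOmega yP md mr).
    apply: (modular_null_le mOmega yP K0 md _ _ (nw i)).
    - move=> k; exact: (measurable_funB (mw i) (mpart i k)).
    - by move=> k x _; rewrite normrM; apply: ler_wpM2r.
  pose j := 1 + (K + K); have KK : 0 <= K + K by rewrite addr_ge0.
  have j0 : 0 < j by rewrite ltr_pwDl.
  have mg : measurable_fun OL (fun x => (K + K) * w i x) by exact: measurable_funM.
  apply: (modular_null_dominated mOmega yP j0 mr mg).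
  - apply: le_lt_trans (w1 i); apply: (le_pmodular mu mOmega yP) => // x _.
    rewrite divr1 ler_pdivrMr// mulrC normrM ler_wpM2l// ger0_norm//.
    by rewrite lerDr.
  - move=> k x _; rewrite !normrM ler_wpM2r// [leRHS]ger0_norm//.
    by rewrite (le_trans (ler_normB _ _))// lerD.
  - move: upsi; apply: filterS => x H Ox; have {}H := H Ox.
    rewrite -[X in _ --> X](mul0r (w i x)); apply: cvgM; last exact: cvg_cst.
    rewrite -[X in _ --> X](subrr (derive1 G (u x))); apply: cvgB; first exact: cvg_cst.
    exact: (continuous_cvg _ (smooth1_continuous sG' (x := u x)) H).
have [WG wG] := approximated_W10 oOmega Omega_lty yP mGu mw' appr.
split; [exact: WG|move=> i]; by have [/(weak_partial_aeE oOmega)] := wG i.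
Qed.

End chain_rule.

(** * The Sobolev inequality in the Orlicz-Sobolev space *)

Lemma le_poweR2 (R : realType) (r : R) (x y : \bar R) : 0 <= r -> (0 <= x)%E -> (x <= y)%E ->
  (x `^ r <= y `^ r)%E.
Proof.
move=> r0 x0 xy; apply: gt0_ler_poweR => //; rewrite in_itv/= leey andbT//.
exact: le_trans xy.
Qed.

Lemma powRD_le (R : realType) (a x y : R) : 0 < a -> 0 <= x -> 0 <= y ->
  (x + y) `^ a <= 2 `^ a * (x `^ a + y `^ a).
Proof.
move=> a0 x0 y0.
have := @sum_powR_le R a bool (fun b => if b then x else y) a0.
by rewrite !big_bool card_bool; apply=> -[].
Qed.

Section power_integrals.
Context d (T : measurableType d) (R : realType) (mu : {measure set T -> \bar R}).
Variables (D : set T) (a : R).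
Hypotheses (mD : measurable D) (a0 : 0 < a).
Local Open Scope ereal_scope.

Lemma measurable_norm_power (f : T -> R) r : measurable_fun D f ->
  measurable_fun D (fun x => (`|f x| `^ r)%:E).
Proof.
move=> mf; apply/measurable_EFinP; apply: (measurableT_comp (measurable_powR _)).
exact: measurableT_comp.
Qed.

Lemma integral_sum_power_le (I : finType) (F : I -> T -> R) :
  (forall i, measurable_fun D (F i)) ->
  \int[mu]_(x in D) ((\sum_i `|F i x|)%R `^ a)%:E <=
    (#|I|%:R `^ a)%:E * \sum_i \int[mu]_(x in D) (`|F i x| `^ a)%:E.
Proof.
move=> mF; rewrite -ge0_integral_sum//; last by move=> i; exact: measurable_norm_power.
rewrite -ge0_integralZl//; last 2 first.
- by apply: emeasurable_sum => i _; exact: measurable_norm_power.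
- by move=> x _; apply: sume_ge0 => i _; rewrite lee_fin powR_ge0.
apply: ge0_le_integral => //.
- by move=> x _; rewrite lee_fin powR_ge0.
- apply/measurable_EFinP; apply: (measurableT_comp (measurable_powR _)).
  by apply: measurable_sum => i; exact: measurableT_comp.
- apply: emeasurable_funM => //.
  by apply: emeasurable_sum => i _; exact: measurable_norm_power.
move=> x _; rewrite sumEFin -EFinM lee_fin.
exact: (sum_powR_le a0).
Qed.

Lemma integralD_power_le (f g : T -> R) : measurable_fun D f -> measurable_fun D g ->
  \int[mu]_(x in D) (`|(f x + g x)%R| `^ a)%:E <=
    (2 `^ a)%:E * (\int[mu]_(x in D) (`|f x| `^ a)%:E + \int[mu]_(x in D) (`|g x| `^ a)%:E).
Proof.
move=> mf mg; rewrite -ge0_integralD//; try exact: measurable_norm_power.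
rewrite -ge0_integralZl//; last 2 first.
- by apply: emeasurable_funD; exact: measurable_norm_power.
- by move=> x _; rewrite -EFinD lee_fin addr_ge0// powR_ge0.
apply: ge0_le_integral => //.
- by apply: measurable_norm_power; exact: measurable_funD.
- by apply: emeasurable_funM => //; apply: emeasurable_funD; exact: measurable_norm_power.
move=> x _; rewrite -EFinD -EFinM lee_fin.
apply: (le_trans (ler_powR2 (ltW a0) (normr_ge0 _) (ler_normD _ _))).
exact: powRD_le.
Qed.

Lemma ae_cvg_norm_power_le (f : (T -> R)^nat) (g : T -> R) q B : (1 < q)%R ->
  (forall n, measurable_fun D (f n)) -> measurable_fun D g ->
  {ae mu, forall x, D x -> (f n x @[n --> \oo] --> g x)%R} ->
  (forall n, \int[mu]_(x in D) (`|f n x| `^ q)%:E <= B) ->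
  \int[mu]_(x in D) (`|g x| `^ q)%:E <= B.
Proof.
move=> q1 mf mg fg fB.
apply: (@ae_cvg_integral_le _ _ _ mu D (fun n x => `|f n x| `^ q)%R) => //.
- by move=> n; apply/measurable_EFinP; exact: measurable_norm_power.
- by apply/measurable_EFinP; exact: measurable_norm_power.
- move: fg; apply: filterS => x H Dx; have {}H := H Dx.
  have cq : continuous (fun y : R => `|y| `^ q)%R.
    apply: derivable_continuous => y.
    exact: (@ex_derive _ _ _ _ _ _ _ (is_derive_power y q1)).
  exact: (continuous_cvg _ (cq (g x)) H).
Qed.

End power_integrals.

(** Keeps the arithmetic of infinite values out of the proof of the Sobolev
    inequality. *)
Lemma sum_le_affine (R : realType) (I : finType) (V W : I -> \bar R) (t K : R) :
  0 <= t -> 0 <= K -> (forall i, 0 <= W i)%E ->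
  (forall i, V i <= t%:E * (W i + K%:E))%E ->
  (\sum_i V i <= (t * (1 + #|I|%:R * K))%:E * (1 + \sum_i W i))%E.
Proof.
move=> t0 K0 W0 VW; apply: (le_trans (lee_sum _ (fun i _ => VW i))).
rewrite -ge0_sume_distrr; last by move=> i _; rewrite adde_ge0 ?lee_fin.
rewrite EFinM -muleA lee_wpmul2l ?lee_fin// big_split/= sumEFin.
have -> : \sum_(i : I) K = #|I|%:R * K by rewrite sumr_const mulr_natl.
have : (0 <= \sum_i W i)%E by apply: sume_ge0.
have : 0 <= #|I|%:R * K by rewrite mulr_ge0.
move: (\sum_i W i)%E (#|I|%:R * K) => [X| |] k k0; rewrite ?lee_fin// => X0.
  nra.
by rewrite addye// addey// gt0_muley ?leey// lte_fin ltr_wpDr.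
Qed.

Section sobolev_W10.
Context {R : realType} {n : nat}.
Local Notation N := n.+2.
Local Notation L := (lebesgue_space R N).
Local Notation mu := (@lebesgue R N).
Variables (Omega : set 'rV[R]_N) (Phi : R -> R) (m a c c' : R).
Hypothesis oOmega : open Omega.
Hypothesis Omega_lty : (mu Omega < +oo)%E.
Hypothesis yP : young_function Phi m a c c'.
Hypothesis aN : a < N%:R.
Local Notation OL := (Omega : set L).
Local Notation pmod := (pmodular mu OL Phi).

Let mOmega : measurable OL.
Proof. exact: (borel_measurable_lebesgue (open_measurable_rV oOmega)). Qed.

Let a0 : 0 < a. Proof. by apply: lt_le_trans (young_exponent yP). Qed.

Lemma test_gradient_integral psi : test_function Omega psi ->
  (\int[mu]_x (gradient_l1 psi x `^ a)%:E <=
    (N%:R `^ a)%:E * \sum_(i < N) \int[mu]_(x in Omega) (`|partial i psi x| `^ a)%:E)%E.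
Proof.
move=> tp; have [_ _ SO] := tp.
have mpart i : measurable_fun OL (partial i psi).
  by apply: test_measurable; exact: test_partial.
have E : (\int[mu]_x (gradient_l1 psi x `^ a)%:E =
    \int[mu]_(x in Omega) (gradient_l1 psi x `^ a)%:E)%E.
  rewrite [RHS]integral_mkcond; congr integral; apply/funext => x; rewrite patchE.
  case: ifPn => //; rewrite notin_setE => Ox.
  rewrite /gradient_l1 big1 ?powR0 ?gt_eqF// => i _.
  by rewrite (@partial_out _ _ psi i x) ?normr0// => /SO.
rewrite E; have := integral_sum_power_le mu mOmega a0 mpart.
by rewrite card_ord; apply.
Qed.

(** The Sobolev inequality passes to the limit along approximating test functions by
    Fatou's lemma; the added [1] absorbs the error made on the gradients. *)
Theorem W10_sobolev : exists2 C : R, 0 <= C & forall u, W10 Omega Phi u ->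
  (\int[mu]_(x in Omega) (`|u x| `^ sobolev_exponent N a)%:E <=
    (C%:E * (1 + \sum_(i < N) \int[mu]_(x in Omega) (`|weak_partial Omega i u x| `^ a)%:E))
      `^ (sobolev_exponent N a / a))%E.
Proof.
have aN' : 1 <= a < N%:R by rewrite aN (young_exponent yP).
have [C0 C00 HC0] := sobolev_inequality Omega aN'.
have [K K0 HK] := pmodular_le1_power mOmega yP Omega_lty.
pose C1 : R := N%:R `^ a * (2 `^ a * (1 + N%:R * K)).
have C10 : 0 <= C1.
  by rewrite mulr_ge0 ?powR_ge0// mulr_ge0 ?powR_ge0// addr_ge0// mulr_ge0.
exists (C0 * C1); first by rewrite mulr_ge0.
move=> u Wu; have [W1u _] := Wu; have [ou _] := W1u.
have [mU _] := (orlicz_lty oOmega yP u).1 ou.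
pose w i := weak_partial Omega i u.
have ow i : orlicz Omega Phi (w i) by have [] := W1_weak_partial oOmega yP i W1u.
have mw i : measurable_fun OL (w i) by have [] := (orlicz_lty oOmega yP (w i)).1 (ow i).
have [psi [[tpsi nu nw] upsi wpsi]] := W10_approximated oOmega Omega_lty yP Wu.
have NW : \forall k \near \oo, forall i, (pmod (w i \- partial i (psi k))%R 1 <= 1)%E.
  by apply: filter_forall => i; exact: nw.
have [k0 _ Hk0] := NW.
pose X : \bar R := (\sum_(i < N) \int[mu]_(x in Omega) (`|w i x| `^ a)%:E)%E.
have X0 : (0 <= X)%E by apply: sume_ge0 => i _; apply: integral_ge0 => x _; rewrite lee_fin powR_ge0.
rewrite -[X in (_ * (1 + X))%E]/X.
have ap0 : 0 <= sobolev_exponent N a / a.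
  rewrite divr_ge0 ?(ltW a0)// /sobolev_exponent divr_ge0 ?subr_ge0 ?(ltW aN)//.
  by rewrite mulr_ge0 ?(ltW a0).
have mpsi k : measurable_fun OL (psi k) by exact: test_measurable.
have mpart i k : measurable_fun OL (partial i (psi k)).
  by apply: test_measurable; exact: test_partial.
have q1 : 1 < sobolev_exponent N a.
  rewrite /sobolev_exponent ltr_pdivlMr ?subr_gt0// mul1r.
  have a1 := young_exponent yP; have N0 : 0 < N%:R :> R by [].
  rewrite ltrBlDr (le_lt_trans (ler_peMl (ltW N0) a1))// ltrDl.
  exact: a0.
have bound k : (k0 <= k)%N ->
    (\sum_(i < N) \int[mu]_(x in Omega) (`|partial i (psi k) x| `^ a)%:E <=
      (2 `^ a * (1 + N%:R * K))%:E * (1 + X))%E.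
  move=> kk; have Hk := Hk0 k kk.
  have md i : measurable_fun OL (partial i (psi k) \- w i) by exact: measurable_funB.
  have le i : (\int[mu]_(x in Omega) (`|partial i (psi k) x| `^ a)%:E <=
      (2 `^ a)%:E * (\int[mu]_(x in Omega) (`|w i x| `^ a)%:E + K%:E))%E.
    have := integralD_power_le mu mOmega a0 (mw i) (md i).
    under eq_integral do rewrite addrC subrK.
    move=> /le_trans; apply; rewrite lee_wpmul2l ?lee_fin ?powR_ge0// leeD2l//.
    have mwd : measurable_fun OL (w i \- partial i (psi k)) by exact: measurable_funB.
    apply: le_trans (HK _ _ ltr01 mwd (Hk i)).
    by under [X in (_ <= X)%E]eq_integral do rewrite divr1 distrC.
  have W0 (i : 'I_N) : (0 <= \int[mu]_(x in Omega) (`|w i x| `^ a)%:E)%E.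
    by apply: integral_ge0 => x _; rewrite lee_fin powR_ge0.
  have := sum_le_affine (powR_ge0 _ _) K0 W0 le; rewrite card_ord; exact.
apply: (@ae_cvg_norm_power_le _ _ _ mu OL mOmega (fun k x => psi (k + k0)%N x) u _ _ q1
  (fun k => mpsi _) mU).
  move: upsi; apply: filterS => x H Ox; have {}H := H Ox.
  exact: (cvg_comp _ _ (cvg_addnr k0) H).
move=> k; have Hk := bound (k + k0)%N (leq_addl k k0).
move: (psi (k + k0)%N) (tpsi (k + k0)%N) (mpsi (k + k0)%N) Hk => p tp mp Hp.
have mp' : measurable_fun [set: L] (fun x => (`|p x| `^ sobolev_exponent N a)%:E).
  apply: measurable_norm_power; apply: continuous_lebesgue.
  by have [sp _ _] := tp; exact: smooth_continuous.
have p0 (x : L) : [set: L] x -> (0 <= (`|p x| `^ sobolev_exponent N a)%:E)%E.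
  by move=> _; rewrite lee_fin powR_ge0.
apply: (le_trans (ge0_subset_integral mu mOmega measurableT mp' p0 (@subsetT _ _))).
apply: (le_trans (HC0 _ tp)); apply: le_poweR2 => //.
  by rewrite mule_ge0 ?lee_fin//; apply: integral_ge0 => x _; rewrite lee_fin powR_ge0.
rewrite EFinM -muleA lee_wpmul2l ?lee_fin//.
apply: (le_trans (test_gradient_integral tp)).
by rewrite /C1 EFinM -muleA lee_wpmul2l ?lee_fin ?powR_ge0.
Qed.

End sobolev_W10.

(** * The absorption argument *)

Section absorption.
Context d (T : measurableType d) (R : realType) (mu : {measure set T -> \bar R}).
Variables (D : set T) (u : T -> R) (a q : R).
Hypotheses (mD : measurable D) (Doo : (mu D < +oo)%E) (mu_ : measurable_fun D u).
Hypotheses (a1 : 1 <= a) (aq : a < q).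

(** Functions extended by [0] outside [D]. *)
Lemma hoelder_ge0_on (f g : T -> R) (p p' : R) :
  measurable_fun D f -> measurable_fun D g ->
  (forall x, 0 <= f x) -> (forall x, 0 <= g x) ->
  0 < p -> 0 < p' -> p^-1 + p'^-1 = 1 ->
  (\int[mu]_(x in D) (f x * g x)%:E <=
    (\int[mu]_(x in D) (f x `^ p)%:E) `^ p^-1 * (\int[mu]_(x in D) (g x `^ p')%:E) `^ p'^-1)%E.
Proof.
move=> mf mg f0 g0 p0 p'0 pp'.
have patch0 (h : T -> R) : (forall x, 0 <= h x) -> forall x, 0 <= (h \_ D) x.
  by move=> h0 x; rewrite patchE; case: ifP.
have powE (h : T -> R) r : 0 < r ->
    (\int[mu]_(x in D) (h x `^ r)%:E = \int[mu]_x ((h \_ D) x `^ r)%:E)%E.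
  move=> r0; rewrite integral_mkcond; congr integral; apply/funext => x.
  by rewrite !patchE; case: ifP => // _; rewrite powR0// gt_eqF.
rewrite (powE f)// (powE g)//.
have -> : (\int[mu]_(x in D) (f x * g x)%:E = \int[mu]_x ((f \_ D) x * (g \_ D) x)%:E)%E.
  rewrite integral_mkcond; congr integral; apply/funext => x.
  by rewrite !patchE; case: ifP => // _; rewrite mul0r.
apply: hoelder_ge0 => //; try exact: patch0.
- by apply/(measurable_restrictT _ mD).
- by apply/(measurable_restrictT _ mD).
Qed.

Definition tail (M t : R) : R := if M < `|t| then `|t| else 0.

Lemma tail_ge0 M t : 0 <= tail M t.
Proof. by rewrite /tail; case: ifP. Qed.

Lemma tail_le M t : tail M t <= `|t|.
Proof. by rewrite /tail; case: ifP. Qed.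

Lemma measurable_tail M : measurable_fun D (fun x => tail M (u x)).
Proof.
apply: (measurableT_comp _ mu_); rewrite /tail; apply: measurable_fun_ifT => //.
by apply: measurable_fun_ltr => //; exact: normr_measurable.
Qed.

Let q0 : 0 < q. Proof. by apply: lt_trans aq; exact: lt_le_trans a1. Qed.
Let a0 : 0 < a. Proof. exact: lt_le_trans a1. Qed.

Hypothesis uq : (\int[mu]_(x in D) (`|u x| `^ q)%:E < +oo)%E.

(** Absolute continuity of the integral of [|u|^q], by dominated convergence. *)
Lemma integral_tail_small e : 0 < e ->
  exists2 M, 1 <= M & (\int[mu]_(x in D) (tail M (u x) `^ q)%:E <= e%:E)%E.
Proof.
move=> e0.
pose F k x := (tail k.+1%:R (u x) `^ q)%:E.
have mF k : measurable_fun D (F k).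
  apply/measurable_EFinP; apply: (measurableT_comp (measurable_powR _)).
  exact: measurable_tail.
have F0 : {ae mu, forall x, D x -> F k x @[k --> \oo] --> (cst 0%E x : \bar R)}.
  apply: aeW => x _; apply: cvg_near_cst.
  exists (Num.truncn `|u x|) => // k /= kk.
  rewrite /F /tail ifF ?powR0 ?gt_eqF//.
  apply/negbTE; rewrite -leNgt (le_trans (ltW (truncnS_gt _)))// ler_nat ltnS.
  exact: kk.
have iu : mu.-integrable D (fun x => (`|u x| `^ q)%:E).
  apply/integrableP; split; first exact: measurable_norm_power.
  by under eq_integral do rewrite gee0_abs ?lee_fin ?powR_ge0//.
have Fle : {ae mu, forall x k, D x -> (`|F k x| <= (`|u x| `^ q)%:E)%E}.
  apply: aeW => x k _; rewrite /F gee0_abs ?lee_fin ?powR_ge0//.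
  by apply: ler_powR2; rewrite ?tail_ge0 ?tail_le// ltW.
have [_ _] := @dominated_convergence _ _ _ mu D mD _ _ _ mF (measurable_cst _) F0 iu Fle.
rewrite integral0 => /fine_cvgP[fin] /cvgrPdist_le/(_ _ e0) H.
have [k _ /(_ k (leqnn k))[Hk finK]] := filterI H fin.
exists k.+1%:R; first by rewrite ler1n.
move: Hk; rewrite sub0r normrN /= ger0_norm; last first.
  by apply: fine_ge0; apply: integral_ge0 => x _; rewrite lee_fin powR_ge0.
by rewrite -lee_fin fineK.
Qed.

(* At most a constant multiple of [t] for each [e], and growing in modulus to
   [t (1 + t^2)^(s/a)] as [e] tends to [0]. *)
Let H e s t := t * weight e (s / a) t.

Let norm_H e s t : 0 < e -> e <= 1 -> 0 <= s -> `|H e s t| `^ a = `|t| `^ a * weight e s t.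
Proof.
move=> e0 e1 s0; have w1 := weight_ge1 t (ltW e0) e1 (divr_ge0 s0 (ltW a0)).
rewrite normrM (ger0_norm (le_trans ler01 w1)) powRM//; last exact: le_trans w1.
by rewrite weight_powR ?ltW// divfK// gt_eqF.
Qed.

(* Below the level [M] everything is bounded. Above it [|t| >= 1], so that the three
   terms are at most [|t|^q = |t|^(q-a) |t|^a], and [|t|^a] joins with the weight. *)
Let weight_split e s M t : 0 < e -> e <= 1 -> 0 <= s -> 1 <= M ->
  weight e s t * (1 + `|t| `^ a + `|t| `^ q) <=
  (1 + M ^+ 2) `^ s * (3 * M `^ q) + 3 * (tail M t `^ (q - a) * `|H e s t| `^ a).
Proof.
move=> e0 e1 s0 M1; have M0 : 0 < M by exact: lt_le_trans M1.
have w1 := weight_ge1 t (ltW e0) e1 s0; have w0 := le_trans ler01 w1.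
have Mq1 r : 0 <= r -> r <= q -> M `^ r <= M `^ q by move=> r0 rq; exact: ler_powR.
have [tM|Mt] := leP `|t| M.
  rewrite /tail ltNge tM/= powR0 ?subr_eq0 ?gt_eqF// mul0r mulr0 addr0.
  apply: ler_pM => //.
  - apply: (le_trans (weight_le _ (ltW e0) s0)).
    apply: (ler_powR2 s0); [by rewrite addr_ge0// sqr_ge0|rewrite lerD2l].
    by rewrite -(real_normK (num_real t)) lerXn2r ?nnegrE ?(ltW M0).
  - have -> : 3 * M `^ q = M `^ q + M `^ q + M `^ q by ring.
  rewrite !lerD//.
  + by rewrite -(powRr0 M) Mq1// ltW.
  + by apply: (le_trans (ler_powR2 (ltW a0) _ tM)) => //; rewrite Mq1// ltW.
  + exact: (ler_powR2 (ltW q0) _ tM).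
have E : `|t| `^ q = `|t| `^ (q - a) * `|t| `^ a.
  by rewrite -powRD ?subrK//; apply/implyP => /eqP q00; move: q0; rewrite q00 ltxx.
rewrite /tail Mt norm_H//.
have -> : 3 * (`|t| `^ (q - a) * (`|t| `^ a * weight e s t)) = weight e s t * (3 * `|t| `^ q).
  by rewrite E; ring.
rewrite -[leLHS]add0r lerD//; first by rewrite !mulr_ge0 ?powR_ge0.
rewrite ler_wpM2l//.
have t1 : 1 <= `|t| by rewrite (le_trans M1)// ltW.
have -> : 3 * `|t| `^ q = `|t| `^ q + `|t| `^ q + `|t| `^ q by ring.
rewrite !lerD//.
- by rewrite -(powRr0 `|t|); apply: ler_powR => //; exact: ltW.
- by apply: ler_powR => //; exact: ltW.
Qed.


Let measurable_H e s : 0 < e -> measurable_fun D (fun x => H e s (u x)).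
Proof.
move=> e0; apply: (measurableT_comp (f := H e s)) => //.
apply: continuous_measurable_fun; apply: smooth1_continuous.
by apply: smooth1_mul_weight; exact: ltW.
Qed.

Lemma measurable_weight e s : 0 < e -> measurable_fun D (fun x => weight e s (u x)).
Proof.
move=> e0; apply: (measurableT_comp (f := weight e s)) => //.
rewrite /weight; apply: measurable_funM.
- apply: (measurableT_comp (measurable_powR _)).
  by apply: measurable_funD => //; exact: exprn_measurable.
- apply: (measurableT_comp (measurable_powR _)).
  by apply: measurable_funD => //; apply: measurable_funM => //; exact: exprn_measurable.
Qed.

Let J e s := (\int[mu]_(x in D) (`|H e s (u x)| `^ q)%:E)%E.
Let Y e s := (\int[mu]_(x in D)
  (weight e s (u x) * (1 + `|u x| `^ a + `|u x| `^ q))%:E)%E.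

Let J_ge0 e s : (0 <= J e s)%E.
Proof. by apply: integral_ge0 => x _; rewrite lee_fin powR_ge0. Qed.

Let J_lty e s : 0 < e -> e <= 1 -> 0 <= s -> (J e s < +oo)%E.
Proof.
move=> e0 e1 s0; have sa : 0 <= s / a by rewrite divr_ge0// ltW.
pose B := (e `^ (- (s / a))) `^ q.
apply: (@le_lt_trans _ _ (B%:E * \int[mu]_(x in D) (`|u x| `^ q)%:E)%E); last first.
  by rewrite lte_mul_pinfty// lee_fin powR_ge0.
rewrite -ge0_integralZl//; last 2 first.
- exact: measurable_norm_power.
- by rewrite lee_fin powR_ge0.
apply: ge0_le_integral => //.
- by apply: measurable_norm_power; exact: measurable_H.
- by apply: emeasurable_funM => //; exact: measurable_norm_power.
move=> x _; rewrite -EFinM lee_fin /B -powRM ?powR_ge0//.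
apply: ler_powR2 => //; first exact: ltW.
have w1 := weight_ge1 (u x) (ltW e0) e1 sa.
rewrite /H normrM mulrC (ger0_norm (le_trans ler01 w1)) ler_wpM2r//.
exact: weight_bounded.
Qed.

(* Hoelder's inequality with the exponents [q/(q-a)] and [q/a]. *)
Let Y_split e s M : 0 < e -> e <= 1 -> 0 <= s -> 1 <= M ->
  (Y e s <= ((1 + M ^+ 2) `^ s * (3 * M `^ q))%:E * mu D +
    3%:E * ((\int[mu]_(x in D) (tail M (u x) `^ q)%:E) `^ ((q - a) / q) *
            J e s `^ (a / q)))%E.
Proof.
move=> e0 e1 s0 M1; have qa : 0 < q - a by rewrite subr_gt0.
set KM := (1 + M ^+ 2) `^ s * (3 * M `^ q).
have KM0 : 0 <= KM by rewrite mulr_ge0 ?powR_ge0// mulr_ge0 ?powR_ge0.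
have mt r : measurable_fun D (fun x => tail M (u x) `^ r).
  by apply: (measurableT_comp (measurable_powR _)); exact: measurable_tail.
have mh r : measurable_fun D (fun x => `|H e s (u x)| `^ r).
  by apply/measurable_EFinP; apply: measurable_norm_power; exact: measurable_H.
have mth : measurable_fun D (fun x => tail M (u x) `^ (q - a) * `|H e s (u x)| `^ a).
  exact: measurable_funM.
have pq : (q / (q - a))^-1 + (q / a)^-1 = 1 by field; rewrite !gt_eqF.
have := hoelder_ge0_on (mt (q - a)) (mh a) (fun x => powR_ge0 _ _) (fun x => powR_ge0 _ _)
  (divr_gt0 q0 qa) (divr_gt0 q0 a0) pq.
rewrite !invf_div.
under [X in (_ <= X `^ _ * _)%E -> _]eq_integral do
  rewrite -powRrM mulrCA mulfV ?gt_eqF// mulr1.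
under [X in (_ <= _ * X `^ _)%E -> _]eq_integral do
  rewrite -powRrM mulrCA mulfV ?gt_eqF// mulr1.
move=> Hold.
apply: (@le_trans _ _ (KM%:E * mu D +
  3%:E * \int[mu]_(x in D) (tail M (u x) `^ (q - a) * `|H e s (u x)| `^ a)%:E)%E); last first.
  by rewrite leeD2l// lee_wpmul2l.
rewrite -integral_cst// -ge0_integralZl//; last 2 first.
- exact/measurable_EFinP.
- by move=> x _; rewrite lee_fin mulr_ge0 ?powR_ge0.
rewrite -ge0_integralD//; last 2 first.
- by move=> x _; rewrite -EFinM lee_fin !mulr_ge0 ?powR_ge0.
- by apply: emeasurable_funM => //; exact/measurable_EFinP.
have wx0 x : 0 <= weight e s (u x) by exact: le_trans (weight_ge1 _ (ltW e0) e1 s0).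
apply: ge0_le_integral => //.
- by move=> x _; rewrite lee_fin mulr_ge0// !addr_ge0 ?powR_ge0.
- apply/measurable_EFinP; apply: measurable_funM; first exact: measurable_weight.
  apply: measurable_funD; first apply: measurable_funD => //.
    by apply/measurable_EFinP; exact: measurable_norm_power.
  by apply/measurable_EFinP; exact: measurable_norm_power.
- apply: emeasurable_funD => //; apply: emeasurable_funM => //; exact/measurable_EFinP.
by move=> x _; rewrite -EFinM -EFinD lee_fin; exact: weight_split.
Qed.

Let J_bounded s C1 C2 : 0 <= s -> 0 <= C1 -> 0 <= C2 ->
  (forall e, 0 < e -> e <= 1 -> (J e s <= (C1%:E + C2%:E * Y e s) `^ (q / a))%E) ->
  exists B, forall e, 0 < e -> e <= 1 -> (J e s <= B%:E)%E.
Proof.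
move=> s0 C10 C20 HJ; have qa : 0 < q - a by rewrite subr_gt0.
have r0 : 0 < (q - a) / q by exact: divr_gt0.
(* This makes the coefficient [3 * C2 * eta] of [J^(a/q)] at most one half. *)
pose eta := (6 * (C2 + 1))^-1.
have eta0 : 0 < eta by rewrite invr_gt0 mulr_gt0// ltr_wpDl.
have [M M1 HM] := integral_tail_small (powR_gt0 ((q - a) / q)^-1 eta0).
pose KM := (1 + M ^+ 2) `^ s * (3 * M `^ q).
have KM0 : 0 <= KM by rewrite mulr_ge0 ?powR_ge0// mulr_ge0 ?powR_ge0.
have mDfin : mu D \is a fin_num by rewrite ge0_fin_numE.
have mD0 : 0 <= fine (mu D) by exact: fine_ge0.
pose A := C1 + C2 * (KM * fine (mu D)).
have A0 : 0 <= A by rewrite addr_ge0// mulr_ge0// mulr_ge0.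
exists ((2 * A) `^ (q / a)) => e e0 e1.
have Jfin : J e s \is a fin_num.
  by rewrite (ge0_fin_numE (J_ge0 e s)); exact: J_lty.
pose j := fine (J e s); have j0 : 0 <= j by exact: fine_ge0.
have JE : J e s = j%:E by rewrite /j fineK.
have HT : ((\int[mu]_(x in D) (tail M (u x) `^ q)%:E) `^ ((q - a) / q) <= eta%:E)%E.
  have T0 : (0 <= \int[mu]_(x in D) (tail M (u x) `^ q)%:E)%E.
    by apply: integral_ge0 => x _; rewrite lee_fin powR_ge0.
  apply: (le_trans (le_poweR2 (ltW r0) T0 HM)).
  by rewrite poweR_EFin -powRrM mulVf ?gt_eqF// powRr1// ltW.
have HY : (Y e s <= (KM * fine (mu D) + 3 * (eta * j `^ (a / q)))%:E)%E.
  apply: (le_trans (Y_split e0 e1 s0 M1)); rewrite -/KM JE poweR_EFin.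
  have -> x y : (x + 3 * y)%:E = (x%:E + 3%:E * y%:E)%E by rewrite -EFinM -EFinD.
  apply: leeD; first by rewrite -[X in (_ * X <= _)%E](fineK mDfin) -EFinM.
  rewrite lee_wpmul2l// EFinM lee_wpmul2r// lee_fin; exact: powR_ge0.
have YE0 : (0 <= Y e s)%E.
  apply: integral_ge0 => x _; have := weight_ge1 (u x) (ltW e0) e1 s0 => w1.
  by rewrite lee_fin mulr_ge0 ?(le_trans ler01 w1)// !addr_ge0 ?powR_ge0.
have aq0 : 0 <= q / a by rewrite divr_ge0 ?ltW.
have HJj : j <= (A + 2^-1 * j `^ (a / q)) `^ (q / a).
  rewrite -lee_fin -JE; apply: (le_trans (HJ e e0 e1)); rewrite -poweR_EFin.
  apply: le_poweR2 => //; first by rewrite adde_ge0 ?lee_fin// mule_ge0.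
  apply: (@le_trans _ _ (C1%:E + C2%:E * (KM * fine (mu D) + 3 * (eta * j `^ (a / q)))%:E)%E).
    by rewrite leeD2l// lee_wpmul2l.
  rewrite -EFinM -EFinD lee_fin /A mulrDr addrA lerD2l.
  have -> y : C2 * (3 * (eta * y)) = 2^-1 * (C2 / (C2 + 1)) * y.
    by rewrite /eta; field; rewrite gt_eqF// ltr_wpDl.
  rewrite ler_wpM2r ?powR_ge0//.
  by rewrite ler_piMr// ler_pdivrMr ?ltr_wpDl// mul1r lerDl.
set z := j `^ (a / q); have zj : j = z `^ (q / a).
  by rewrite /z -powRrM mulrA divfK ?gt_eqF// mulfV ?gt_eqF// powRr1.
have z0 : 0 <= z by exact: powR_ge0.
have aq1 : 0 <= a / q by rewrite divr_ge0 ?ltW.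
have : z <= A + 2^-1 * z.
  have := ler_powR2 aq1 j0 HJj; rewrite -powRrM mulrA divfK ?gt_eqF// mulfV ?gt_eqF// powRr1//.
  by rewrite addr_ge0// mulr_ge0.
move=> zA; rewrite JE lee_fin zj; apply: (ler_powR2 aq0 z0); lra.
Qed.

(** An estimate that is linear in [J] up to integrals of [u] itself improves the
    integrability of [u] to every power: [Y] is split at a level [M] above which
    [|u|^q] has small integral, and there it is absorbed into the left-hand side,
    uniformly in [e]. *)
Lemma absorption_powers :
  (forall s, 0 <= s -> exists C1 C2, [/\ 0 <= C1, 0 <= C2 & forall e, 0 < e -> e <= 1 ->
    (\int[mu]_(x in D) (`|u x * weight e (s / a) (u x)| `^ q)%:E <=
    (C1%:E + C2%:E * \int[mu]_(x in D)
      (weight e s (u x) * (1 + `|u x| `^ a + `|u x| `^ q))%:E) `^ (q / a))%E]) ->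
  forall p, 0 <= p -> (\int[mu]_(x in D) (`|u x| `^ p)%:E < +oo)%E.
Proof.
(* With this [s] the limit of the test quantities is [|u|^q (1 + u^2)^p]. *)
move=> HJ p p0; pose s := p * a / q.
have s0 : 0 <= s by rewrite divr_ge0 ?(ltW q0)// mulr_ge0 ?(ltW a0).
have [C1 [C2 [C10 C20 HC]]] := HJ s s0.
have [B HB] := J_bounded s0 C10 C20 HC.
pose g x := (`|u x| * (1 + u x ^+ 2) `^ (s / a)) `^ q.
have mg : measurable_fun D g.
  apply: (measurableT_comp (measurable_powR _)); apply: measurable_funM.
    exact: measurableT_comp.
  apply: (measurableT_comp (measurable_powR _)); apply: measurable_funD => //.
  exact: measurable_funX.
have gB : (\int[mu]_(x in D) (g x)%:E <= B%:E)%E.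
  have e0 k : 0 < k.+1%:R^-1 :> R by rewrite invr_gt0.
  have e1 k : k.+1%:R^-1 <= 1 :> R by rewrite invf_le1// ler1n.
  apply: (@ae_cvg_integral_le _ _ _ mu D (fun k x => `|H k.+1%:R^-1 s (u x)| `^ q)) => //.
  - by move=> k; apply/measurable_EFinP; apply: measurable_norm_power; exact: measurable_H.
  - by move=> x; exact: powR_ge0.
  - apply: aeW => x _.
    have -> : g x = `|u x * (1 + u x ^+ 2) `^ (s / a)| `^ q.
      by rewrite normrM [in RHS](ger0_norm (powR_ge0 _ _)).
    have q1 : 1 < q by exact: le_lt_trans aq.
    have cq : continuous (fun y : R => `|y| `^ q).
      apply: derivable_continuous => y.
      exact: (@ex_derive _ _ _ _ _ _ _ (is_derive_power y q1)).
    apply: (continuous_cvg _ (cq _)).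
    by apply: cvgM; [exact: cvg_cst|exact: weight_cvg].
  - by move=> k; exact: HB.
apply: (@le_lt_trans _ _ (mu D + B%:E)%E); last by rewrite lte_add_pinfty// ltry.
apply: (@le_trans _ _ (mu D + \int[mu]_(x in D) (g x)%:E)%E); last by rewrite leeD2l.
rewrite -[X in (X + _)%E]mul1e -integral_cst// -ge0_integralD//; last 2 first.
- by move=> x _; rewrite lee_fin powR_ge0.
- exact/measurable_EFinP.
apply: ge0_le_integral => //.
- exact: measurable_norm_power.
- by apply: emeasurable_funD => //; exact/measurable_EFinP.
move=> x _; rewrite -EFinD lee_fin /g; have [u1|/ltW u1] := leP `|u x| 1.
  rewrite -[leLHS]addr0 lerD ?powR_ge0//.
  by have := ler_powR2 p0 (normr_ge0 _) u1; rewrite powR1.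
rewrite ler_wpDl// powRM ?powR_ge0// -powRrM.
have -> : s / a * q = p by rewrite /s; field; rewrite !gt_eqF.
rewrite -[leLHS]mul1r ler_pM ?powR_ge0//.
  by have := ler_powR2 (ltW q0) ler01 u1; rewrite powR1.
apply: ler_powR2 => //; rewrite -(real_normK (num_real (u x))).
by nra.
Qed.

End absorption.

(** * Energy comparison *)

(** [E] is the energy density of an equation tested with some function and [F] its
    right-hand side. Only almost everywhere equal to [E], but nonnegative everywhere,
    [E'] is what the integral of [A] is compared with. *)
Lemma energy_le d (T : measurableType d) (R : realType) (mu : {measure set T -> \bar R})
    (D : set T) (A E E' F Y : T -> R) (k K : R) :
  measurable D -> measurable_fun D A -> measurable_fun D E' -> measurable_fun D Y ->
  mu.-integrable D (EFin \o E) -> mu.-integrable D (EFin \o F) ->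
  (forall x, 0 <= A x) -> (forall x, 0 <= E' x) -> (forall x, 0 <= Y x) -> 0 <= k -> 0 <= K ->
  {ae mu, forall x, D x -> E x = E' x} ->
  (forall x, A x <= E' x + k * Y x) -> (forall x, D x -> `|F x| <= K * Y x) ->
  \int[mu]_(x in D) E x = \int[mu]_(x in D) F x ->
  (\int[mu]_(x in D) (A x)%:E <= (k + K)%:E * \int[mu]_(x in D) (Y x)%:E)%E.
Proof.
move=> mD mA mE' mY iE iF A0 E'0 Y0 k0 K0 EE' AE' FY EF.
have mYe : measurable_fun D (fun x => (Y x)%:E) by exact/measurable_EFinP.
have mE'e : measurable_fun D (fun x => (E' x)%:E) by exact/measurable_EFinP.
have mkY r : measurable_fun D (fun x => (r%:E * (Y x)%:E)%E) by exact: emeasurable_funM.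
have Ye0 x : D x -> (0 <= (Y x)%:E)%E by rewrite lee_fin.
have YI0 : (0 <= \int[mu]_(x in D) (Y x)%:E)%E by exact: integral_ge0.
have HF : (\int[mu]_(x in D) (E' x)%:E <= K%:E * \int[mu]_(x in D) (Y x)%:E)%E.
  have -> : (\int[mu]_(x in D) (E' x)%:E = \int[mu]_(x in D) (E x)%:E)%E.
    apply: ae_eq_integral => //; first exact: measurable_int iE.
    by move: EE'; apply: filterS => x H Dx; rewrite H.
  have -> : (\int[mu]_(x in D) (E x)%:E = \int[mu]_(x in D) (F x)%:E)%E.
    rewrite -(fineK (integrable_fin_num mD iE)) -(fineK (integrable_fin_num mD iF)).
    by congr EFin.
  rewrite -ge0_integralZl//.
  apply: (@le_trans _ _ (\int[mu]_(x in D) `|(F x)%:E|)%E).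
    apply: (le_trans (lee_abs _)); apply: le_abse_integral => //.
    exact: measurable_int iF.
  apply: ge0_le_integral => //.
  by apply: measurableT_comp => //; exact: measurable_int iF.
rewrite EFinD ge0_muleDl ?lee_fin//.
apply: (@le_trans _ _ (k%:E * \int[mu]_(x in D) (Y x)%:E + \int[mu]_(x in D) (E' x)%:E)%E);
  last by rewrite leeD2l.
rewrite -ge0_integralZl// -ge0_integralD//; last 2 first.
- by move=> x _; rewrite -EFinM lee_fin mulr_ge0.
- by move=> x _; rewrite lee_fin.
apply: ge0_le_integral => //.
- by move=> x _; rewrite lee_fin.
- exact/measurable_EFinP.
- exact: emeasurable_funD.
- by move=> x _; rewrite -EFinM -EFinD lee_fin addrC.
Qed.

Lemma ae_power_integral_le d (T : measurableType d) (R : realType)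
    (mu : {measure set T -> \bar R}) (D : set T) (f h A : T -> R) (a B : R) :
  measurable D -> measurable_fun D f -> measurable_fun D h -> measurable_fun D A ->
  {ae mu, forall x, D x -> f x = h x} -> 0 <= B -> (forall x, 0 <= A x) ->
  (forall x, `|h x| `^ a <= B * A x) ->
  (\int[mu]_(x in D) (`|f x| `^ a)%:E <= B%:E * \int[mu]_(x in D) (A x)%:E)%E.
Proof.
move=> mD mf mh mA fh B0 A0 hA.
have -> : (\int[mu]_(x in D) (`|f x| `^ a)%:E = \int[mu]_(x in D) (`|h x| `^ a)%:E)%E.
  apply: ge0_ae_eq_integral => //.
  - exact: measurable_norm_power.
  - exact: measurable_norm_power.
  - by move: fh; apply: filterS => x H Dx; rewrite H.
rewrite -ge0_integralZl//; last 2 first.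
- exact/measurable_EFinP.
- by move=> x _; rewrite lee_fin.
apply: ge0_le_integral => //.
- exact: measurable_norm_power.
- by apply: emeasurable_funM => //; exact/measurable_EFinP.
- by move=> x _; rewrite -EFinM lee_fin.
Qed.

Section euclidean_norm.
Context {R : realType} {n : nat}.
Implicit Types x y : 'rV[R]_n.

Lemma dot_ge0 x : 0 <= dot x x.
Proof. by apply: sumr_ge0 => i _; rewrite -expr2 sqr_ge0. Qed.

Lemma enorm_ge0 x : 0 <= enorm x. Proof. exact: sqrtr_ge0. Qed.

Lemma sqr_enorm x : enorm x ^+ 2 = dot x x.
Proof. by rewrite sqr_sqrtr// dot_ge0. Qed.

Lemma coord_le_enorm x i : `|x ord0 i| <= enorm x.
Proof.
rewrite -sqrtr_sqr; apply: ler_wsqrtr; rewrite /dot (bigD1 i)//= -expr2 lerDl.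
by apply: sumr_ge0 => j _; rewrite -expr2 sqr_ge0.
Qed.

Lemma dotZr x y (k : R) : (forall i, y ord0 i = k * x ord0 i) -> dot x y = k * dot x x.
Proof.
move=> yx; rewrite /dot mulr_sumr; apply: eq_bigr => i _; rewrite yx.
by rewrite mulrCA.
Qed.

End euclidean_norm.

(** * Higher integrability of weak solutions *)

Section moser.
Context {R : realType} {n : nat}.
Local Notation N := n.+2.
Local Notation L := (lebesgue_space R N).
Local Notation mu := (@lebesgue R N).
Variables (Omega : set 'rV[R]_N) (phi : R -> R) (m a c c' C0 : R).
Variables (g : 'rV[R]_N -> R -> R) (u : 'rV[R]_N -> R).
Local Notation Phi := (Phi_of phi).
Local Notation q := (sobolev_exponent N a).
Hypothesis oOmega : open Omega.
Hypothesis Omega_lty : (mu Omega < +oo)%E.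
Hypothesis yP : young_function Phi m a c c'.
Hypothesis aN : a < N%:R.
Hypothesis Phi_le_phi : forall t, 0 <= t -> Phi t <= t * (t * phi t).
Hypothesis C00 : 0 <= C0.
Hypothesis g_growth : forall x t, Omega x ->
  `|g x t| * `|t| <= C0 * (1 + `|t| `^ a + `|t| `^ q).
Hypothesis weak_u : weak_solution Omega phi g u.
Local Notation OL := (Omega : set L).

Let mOmega : measurable OL.
Proof. exact: (borel_measurable_lebesgue (open_measurable_rV oOmega)). Qed.

Let a1 : 1 <= a. Proof. exact: young_exponent yP. Qed.
Let a0 : 0 < a. Proof. exact: lt_le_trans a1. Qed.
Let c0 : 0 < c. Proof. exact: young_coercive_gt0 yP. Qed.
Let c'0 : 0 <= c'. Proof. exact: young_coercive_ge0 yP. Qed.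

Let aq : a < q.
Proof.
rewrite /sobolev_exponent ltr_pdivlMr ?subr_gt0// mulrBr ltrBlDr ltrDl.
by rewrite mulr_gt0.
Qed.

Let Wu : W10 Omega Phi u. Proof. by case: weak_u. Qed.

Let w i := weak_partial Omega i u.
Let grad := weak_gradient Omega u.

Let ow i : orlicz Omega Phi (w i).
Proof. by have [W1u _] := Wu; have [] := W1_weak_partial oOmega yP i W1u. Qed.

Let mw i : measurable_fun OL (w i).
Proof. by have [] := (orlicz_lty oOmega yP (w i)).1 (ow i). Qed.

Let mU : measurable_fun OL u.
Proof. by have [[/(orlicz_lty oOmega yP u)[mU _] _] _] := Wu. Qed.

Let w_power_lty i : (\int[mu]_(x in Omega) (`|w i x| `^ a)%:E < +oo)%E.
Proof.
have [_ w1] := (orlicz_lty oOmega yP (w i)).1 (ow i).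
have H := pmodular_power mOmega yP Omega_lty ltr01 (mw i).
have {}H : (c%:E * \int[mu]_(x in Omega) (`|w i x| `^ a)%:E < +oo)%E.
  under eq_integral do rewrite -[`|w i _|]divr1.
  apply: (le_lt_trans H); apply: lte_add_pinfty => //.
  by rewrite lte_mul_pinfty// lee_fin.
rewrite -(@lte_pmul2l _ c%:E)// ?lte_fin//.
by rewrite gt0_muley ?lte_fin.
Qed.

Let u_power_lty : (\int[mu]_(x in Omega) (`|u x| `^ q)%:E < +oo)%E.
Proof.
have [C C_ge0 /(_ u Wu) HC] := W10_sobolev oOmega Omega_lty yP aN.
apply: (le_lt_trans HC).
have : (\sum_(i < N) \int[mu]_(x in Omega) (`|weak_partial Omega i u x| `^ a)%:E < +oo)%E.
  by apply: lte_sum_pinfty => i _; exact: w_power_lty.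
have : (0 <= \sum_(i < N) \int[mu]_(x in Omega) (`|weak_partial Omega i u x| `^ a)%:E)%E.
  by apply: sume_ge0 => i _; apply: integral_ge0 => x _; rewrite lee_fin powR_ge0.
move: (\sum_(i < N) _)%E => -[X| |]// _ _.
by rewrite -EFinD -EFinM poweR_EFin ltry.
Qed.

Let coordE x i : grad x ord0 i = w i x. Proof. by rewrite mxE. Qed.

Let measurable_enorm : measurable_fun OL (fun x => enorm (grad x)).
Proof.
apply: (measurableT_comp (continuous_measurable_fun (@sqrt_continuous R))).
rewrite /dot; apply: measurable_sum => i.
under eq_fun do rewrite coordE.
exact: measurable_funM.
Qed.

Let Y e s x := weight e s (u x) * (1 + `|u x| `^ a + `|u x| `^ q).

Let chain (G : R -> R) (K : R) : smooth1 G -> G 0 = 0 -> (forall t, `|derive1 G t| <= K) ->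
  W10 Omega Phi (G \o u) /\ forall i, {ae mu, forall x : L, Omega x ->
    weak_partial Omega i (G \o u) x = derive1 G (u x) * w i x}.
Proof. by move=> sG G0 GK; exact: (W10_chain_rule oOmega Omega_lty yP sG G0 GK Wu). Qed.

Let weight_props e s : 0 < e -> e <= 1 -> 0 <= s ->
  let G := fun t : R => t * weight e s t in
  [/\ smooth1 G, G 0 = 0, (forall t : R, `|derive1 G t| <= (1 + 2 * s) * e `^ (- s))
    & forall t : R, weight e s t <= derive1 G t <= (1 + 2 * s) * weight e s t].
Proof.
move=> e0 e1 s0 G; have dG t := derive_mul_weight t e0 e1 s0.
split => //; [by apply: smooth1_mul_weight; exact: ltW|by rewrite /G mul0r|].
move=> t; have /andP[H1 H2] := dG t.
rewrite ger0_norm; last exact: le_trans (le_trans ler01 (weight_ge1 t (ltW e0) e1 s0)) H1.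
apply: (le_trans H2); rewrite ler_wpM2l ?addr_ge0 ?mulr_ge0//.
exact: weight_bounded.
Qed.

(* The equation is tested with [G o u]. On the left [G'] is at least the weight and
   [phi (|grad u|) |grad u|^2] at least [Phi (|grad u|)], which is coercive; on the
   right the growth of [g] enters. *)
Let energy e s : 0 < e -> e <= 1 -> 0 <= s ->
  (\int[mu]_(x in Omega) (weight e s (u x) * (c * enorm (grad x) `^ a))%:E <=
    (c' + C0)%:E * \int[mu]_(x in Omega) (Y e s x)%:E)%E.
Proof.
move=> e0 e1 s0; have [sG G0 GK dG] := weight_props e0 e1 s0.
set G := (fun t => t * weight e s t) in sG G0 GK dG *.
have [WG wG] := chain sG G0 GK.
have w1 t : 1 <= weight e s t by exact: (weight_ge1 t (ltW e0) e1 s0).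
have w0 t : 0 <= weight e s t by exact: le_trans (w1 t).
have [_ /(_ _ WG)[iE iF EF]] := weak_u.
have mwt : measurable_fun OL (fun x => weight e s (u x)) by exact: measurable_weight.
have mpow r : measurable_fun OL (fun x => `|u x| `^ r).
  by apply/measurable_EFinP; exact: measurable_norm_power.
pose E' x := derive1 G (u x) * (phi (enorm (grad x)) * dot (grad x) (grad x)).
have Phi_dot x : Phi (enorm (grad x)) <= phi (enorm (grad x)) * dot (grad x) (grad x).
  apply: (le_trans (Phi_le_phi (enorm_ge0 _))).
  by rewrite -sqr_enorm expr2 mulrA mulrC.
have Phi0' x : 0 <= Phi (enorm (grad x)) by exact: (young_ge0 yP (enorm_ge0 _)).
have EE' : {ae mu, forall x : L, Omega x ->
    phi (enorm (grad x)) * dot (grad x) (weak_gradient Omega (G \o u) x) = E' x}.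
  have wG' : {ae mu, forall x : L, forall i, Omega x ->
      weak_partial Omega i (G \o u) x = derive1 G (u x) * w i x}.
    by apply: filter_forall => i; exact: wG.
  move: wG'; apply: filterS => x H Ox.
  rewrite (@dotZr _ _ (grad x) (weak_gradient Omega (G \o u) x) (derive1 G (u x))).
    by rewrite /E'; ring.
  by move=> i; rewrite coordE mxE; exact: H.
apply: (@energy_le _ _ _ mu OL _ _ E' _ (Y e s) c' C0 mOmega _ _ _ iE iF _ _ _ c'0 C00 EE' _ _ EF).
- apply: (measurable_funM mwt); apply: measurable_funM; first exact: measurable_cst.
  exact: (measurableT_comp (measurable_powR a) measurable_enorm).
- apply: (ae_eq_measurable (g := fun x =>
    phi (enorm (grad x)) * dot (grad x) (weak_gradient Omega (G \o u) x))).
    by move: EE'; apply: filterS => x H Ox; rewrite H.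
  by apply/measurable_EFinP; exact: measurable_int iE.
- apply: (measurable_funM mwt); apply: measurable_funD; last exact: mpow.
  by apply: measurable_funD; [exact: measurable_cst|exact: mpow].
- by move=> x; rewrite mulr_ge0// mulr_ge0 ?powR_ge0 ?(ltW c0).
- move=> x; have /andP[H1 _] := dG (u x).
  exact: mulr_ge0 (le_trans (w0 _) H1) (le_trans (Phi0' _) (Phi_dot _)).
- by move=> x; rewrite mulr_ge0// addr_ge0 ?powR_ge0// addr_ge0 ?powR_ge0.
- move=> x; have /andP[H1 _] := dG (u x).
  apply: (@le_trans _ _ (weight e s (u x) * (Phi (enorm (grad x)) + c'))).
    by rewrite ler_wpM2l// -lerBlDr; exact: (young_coercive yP (enorm_ge0 _)).
  rewrite mulrDr lerD//.
    by apply: ler_pM => //; exact: Phi_dot.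
  rewrite mulrC ler_wpM2l// ler_peMr// -addrA lerDl addr_ge0 ?powR_ge0//.
- move=> x Ox; rewrite /G /= normrM normrM (ger0_norm (w0 _)) mulrA.
  apply: (le_trans (ler_wpM2r (w0 _) (g_growth (u x) Ox))).
  by rewrite /Y -mulrA ler_wpM2l// mulrC.
Qed.

(* The function [H] carries the [a]-th root of the weight carried by [G]: the power
   [a] of the gradient of [H o u] is what [energy] controls. *)
Let gradient_le e s i : 0 < e -> e <= 1 -> 0 <= s ->
  (\int[mu]_(x in Omega)
     (`|weak_partial Omega i ((fun t => t * weight e (s / a) t) \o u) x| `^ a)%:E <=
   ((1 + 2 * (s / a)) `^ a / c * (c' + C0))%:E * \int[mu]_(x in Omega) (Y e s x)%:E)%E.
Proof.
move=> e0 e1 s0; have sa0 : 0 <= s / a by rewrite divr_ge0// ltW.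
have [sH H0 HK dH] := weight_props e0 e1 sa0.
set H := (fun t => t * weight e (s / a) t) in sH H0 HK dH *.
have [WH wH] := chain sH H0 HK.
have [W1H _] := WH.
have mwH : measurable_fun OL (weak_partial Omega i (H \o u)).
  by have [_ /(orlicz_lty oOmega yP _)[]] := W1_weak_partial oOmega yP i W1H.
have mdH : measurable_fun OL (fun x => derive1 H (u x)).
  apply: (measurableT_comp (f := derive1 H)) => //; apply: continuous_measurable_fun.
  exact/smooth1_continuous/smooth1_deriv.
have w0 r t : 0 <= r -> 0 <= weight e r t.
  by move=> r0; exact: le_trans (weight_ge1 t (ltW e0) e1 r0).
pose B := (1 + 2 * (s / a)) `^ a / c.
have B0 : 0 <= B by rewrite divr_ge0 ?powR_ge0// ltW.
rewrite EFinM -muleA; apply: (@le_trans _ _ (B%:E * \int[mu]_(x in Omega)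
    (weight e s (u x) * (c * enorm (grad x) `^ a))%:E)%E); last first.
  by rewrite lee_wpmul2l ?lee_fin//; exact: energy.
have mA : measurable_fun OL (fun x => weight e s (u x) * (c * enorm (grad x) `^ a)).
  apply: (measurable_funM (measurable_weight mU s e0)); apply: measurable_funM.
    exact: measurable_cst.
  exact: (measurableT_comp (measurable_powR a) measurable_enorm).
have A0 x : 0 <= weight e s (u x) * (c * enorm (grad x) `^ a).
  by rewrite mulr_ge0 ?w0// mulr_ge0 ?powR_ge0 ?(ltW c0).
have BA x : `|derive1 H (u x) * w i x| `^ a <=
    B * (weight e s (u x) * (c * enorm (grad x) `^ a)).
  have /andP[H1 H2] := dH (u x); have d0 := le_trans (w0 _ (u x) sa0) H1.
  rewrite normrM (ger0_norm d0) powRM//.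
  have -> : B * (weight e s (u x) * (c * enorm (grad x) `^ a)) =
      ((1 + 2 * (s / a)) `^ a * weight e s (u x)) * enorm (grad x) `^ a.
    by rewrite /B; field; rewrite gt_eqF.
  apply: ler_pM; rewrite ?powR_ge0//; last first.
    apply: (ler_powR2 (ltW a0) (normr_ge0 _)); rewrite -coordE; exact: coord_le_enorm.
  apply: (le_trans (ler_powR2 (ltW a0) d0 H2)).
  rewrite powRM ?w0//; last by rewrite addr_ge0// mulr_ge0.
  by rewrite weight_powR ?(ltW e0)// divfK// gt_eqF.
exact: (ae_power_integral_le mOmega mwH (measurable_funM mdH (mw i)) mA (wH i) B0 A0 BA).
Qed.

(** Combined with the Sobolev inequality for [t * weight e (s/a) t] composed with [u],
    the energy estimate is the hypothesis of the absorption argument. *)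
Theorem weak_solution_powers p : 0 <= p ->
  (\int[mu]_(x in Omega) (`|u x| `^ p)%:E < +oo)%E.
Proof.
apply: (absorption_powers mOmega Omega_lty mU a1 aq u_power_lty) => s s0.
have [C C_ge0 HC] := W10_sobolev oOmega Omega_lty yP aN.
pose K := (1 + 2 * (s / a)) `^ a / c * (c' + C0).
have K0 : 0 <= K.
  by rewrite mulr_ge0// ?addr_ge0// divr_ge0 ?powR_ge0// ltW.
exists C, (C * (N%:R * K)); split => //; first by rewrite mulr_ge0// mulr_ge0.
move=> e e0 e1; have sa0 : 0 <= s / a by rewrite divr_ge0// ltW.
have [sH H0 HK dH] := weight_props e0 e1 sa0.
have [WH _] := chain sH H0 HK.
have {}HC := HC _ WH.
apply: (le_trans HC); apply: le_poweR2.
- have q0 : 0 < q by exact: lt_trans aq.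
  by rewrite divr_ge0 ?ltW.
- rewrite mule_ge0 ?lee_fin// adde_ge0//; apply: sume_ge0 => i _.
  by apply: integral_ge0 => x _; rewrite lee_fin powR_ge0.
rewrite ge0_muleDr//; last first.
  apply: sume_ge0 => i _.
  by apply: integral_ge0 => x _; rewrite lee_fin powR_ge0.
rewrite mule1 leeD2l// EFinM -muleA lee_wpmul2l ?lee_fin//.
apply: (le_trans (lee_sum _ (fun i _ => gradient_le i e0 e1 s0))).
rewrite -ge0_sume_distrl; last by move=> i _; rewrite lee_fin.
have <- : (\sum_(i < N) K%:E = (N%:R * K)%:E)%E.
  by rewrite sumEFin sumr_const card_ord mulr_natl.
by [].
Qed.

End moser.

(** * Integrability of weak solutions to all powers *)

Lemma powR_le1D (R : realType) (r q t : R) : 0 <= r -> r <= q -> 0 <= t ->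
  t `^ r <= 1 + t `^ q.
Proof.
move=> r0 rq t0; have [t1|/ltW t1] := leP t 1.
  by have := ler_powR2 r0 t0 t1; rewrite powR1 => /le_trans; apply; rewrite lerDl powR_ge0.
by rewrite ler_wpDl//; exact: ler_powR.
Qed.

(** Only coercivity depends on the alternative between [l] and [m]. *)
Lemma Phi_young_function (R : realType) (N : nat) (phi : R -> R) (l m a : R) :
  C1 phi -> phi2 phi -> phi3 N phi l m ->
  (a = l \/ (equivalent_Nfun (Phi_of phi) (abs_power a) /\ 1 <= a)) ->
  exists c c', young_function (Phi_of phi) m a c c'.
Proof.
move=> C1phi p2 p3 al; have [/andP[l1 _] /andP[m1 _] _ _] := p3.
have a1 : 1 <= a by case: al => [->|[]].
have al' : a = l \/ equivalent_Nfun (Phi_of phi) (abs_power a).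
  by case: al => [->|[]]; [left|right].
have [c [c' [c0 c'0 H]]] := Phi_coercive C1phi p2 p3 al' (lt_le_trans ltr01 a1).
exists c, c'; split => //.
- exact: Phi0.
- by move=> t; exact: (Phi_ge0 C1phi p2).
- by move=> s t; exact: (Phi_nondecreasing C1phi p2).
- exact: (continuous_Phi_norm C1phi p2).
- move=> k t k1 t0; apply: le_trans (Phi_scale_ge C1phi p2 p3 k1 t0).
  rewrite ler_wpM2r//; first exact: (Phi_ge0 C1phi p2).
  by rewrite -[leLHS]powRr1 ?(le_trans ler01 k1)//; exact: ler_powR.
- by move=> k t k1 t0; exact: (Phi_scale_le C1phi p2 p3 k1 t0).
Qed.

Theorem corollary1p5 (R : realType) (N : nat) (Omega : set 'rV[R]_N)
    (phi : R -> R) (l m : R) (g : 'rV[R]_N -> R -> R) (alpha : R)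
    (u : 'rV[R]_N -> R) :
  (2 <= N)%N ->
  smooth_bounded_domain Omega ->
  C1 phi ->
  (forall t, Phi_of phi (- t) = Phi_of phi t) ->
  phi1 phi -> phi2 phi -> phi3 N phi l m ->
  caratheodory_fun Omega g ->
  alpha = l \/ alpha = m ->
  (exists2 C : R, 0 < C &
    (exists2 r : R, alpha < r < sobolev_exponent N alpha &
      forall x t, Omega x ->
        `|g x t| <= C * (`|t| `^ (alpha - 1) + `|t| `^ (r - 1))) \/
    (forall x t, Omega x ->
      `|g x t| <= C * (`|t| `^ (alpha - 1)
                       + `|t| `^ (sobolev_exponent N alpha - 1)))) ->
  (~ equivalent_Nfun (Phi_of phi) (abs_power m) /\ alpha = l) \/
  (equivalent_Nfun (Phi_of phi) (abs_power m) /\ alpha = m) ->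
  weak_solution Omega phi g u ->
  forall q : R, 1 <= q -> Lp Omega q u.
Proof.
case: N Omega g u => [|[|n]]// Omega g u _ [_ oOmega _ bOmega _] C1phi _ _ p2 p3 _ _
  [C C_gt0 Hg] Halpha Hu q q1.
have [/andP[l1 lN] /andP[m1 mN] _ _] := p3.
have aE : alpha = l \/ (equivalent_Nfun (Phi_of phi) (abs_power alpha) /\ 1 <= alpha).
  by case: Halpha => [[_ ->]|[H ->]]; [left|right; split => //; exact: ltW].
have [c [c' yP]] := Phi_young_function C1phi p2 p3 aE.
have a1 := young_exponent yP.
have aN : alpha < n.+2%:R by case: Halpha => [[_ ->]|[_ ->]].
have mO := borel_measurable_lebesgue (open_measurable_rV oOmega).
have O_lty := bounded_set_lty bOmega mO.
have [W1u _] := Hu.1; have [ou _] := W1u.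
split; first by case: ou.
pose as_ := sobolev_exponent n.+2 alpha.
have aas : alpha <= as_.
  rewrite /as_ /sobolev_exponent ler_pdivlMr ?subr_gt0// mulrBr lerBlDr lerDl.
  by rewrite mulr_ge0// (le_trans ler01 a1).
have g_growth x t : Omega x ->
    `|g x t| * `|t| <= 2 * C * (1 + `|t| `^ alpha + `|t| `^ as_).
  move=> Ox.
  suff [r /andP[ar ras] Hr] : exists2 r, alpha <= r <= as_ &
      `|g x t| <= C * (`|t| `^ (alpha - 1) + `|t| `^ (r - 1)).
    have r1 := le_trans a1 ar.
    apply: (le_trans (ler_wpM2r (normr_ge0 t) Hr)).
    have -> : C * (`|t| `^ (alpha - 1) + `|t| `^ (r - 1)) * `|t| =
        C * (`|t| `^ alpha + `|t| `^ r).
      by rewrite -(mulr_powRB1 (normr_ge0 t) (lt_le_trans ltr01 a1))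
        -(mulr_powRB1 (normr_ge0 t) (lt_le_trans ltr01 r1)); ring.
    rewrite [2 * C]mulrC -[leRHS]mulrA; apply: (ler_wpM2l (ltW C_gt0)).
    have := powR_le1D (le_trans ler01 r1) ras (normr_ge0 t).
    have := powR_ge0 `|t| alpha; have := powR_ge0 `|t| as_.
    by move: (`|t| `^ alpha) (`|t| `^ as_) (`|t| `^ r) => A B D; lra.
  case: Hg => [[r /andP[ar ras] Hr]|Hr]; [exists r|exists as_]; try exact: Hr.
  - by rewrite !ltW.
  - by rewrite aas lexx.
apply: (@weak_solution_powers _ _ Omega phi m alpha c c' (2 * C) g u) => //.
- by move=> t t0; exact: (Phi_le C1phi p2).
- by rewrite mulr_ge0// ltW.
- exact: le_trans q1.
Qed.
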